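(* Let $G=G_0,\dots,G_r$ be the reduction series for a graph $G$. Let $i\in\{0,\dots,r-1\}$ and let $H_i$ be a quotient of $G_i$. Then there is a quotient $H_{i+1}$ of $G_{i+1}$ such that $H_i$ can be constructed from $H_{i+1}$ by replacing each edge, loop and half-edge of $H_{i+1}$ that is the projection of an edge of $G_{i+1}$ replacing an atom $A$ of $G_i$ by the subgraph corresponding to the edge-quotient, the loop-quotient, or a half-quotient of the atom $A$, respectively.
   Context: GRAPHS. A graph is a tuple $(D,V,\iota,\lambda)$ with $D$ a finite set of darts, $V$ a finite set of vertices, $\iota:D\to V$ a partial function (incidence) and $\lambda:D\to D$ an involution. Edges are the orbits $\{d,\lambda d\}$ of $\lambda$ of size 2, half-edges are the orbits of size 1. An edge is standard if $\iota(d),\iota(\lambda d)$ are defined and distinct, a loop if they are defined and equal, pendant if exactly one is defined, free if none is defined. A pendant edge at $v$ is single if it is the only pendant edge attached to $v$. Edges are colored and have one of three types: halvable, undirected, directed (the latter with an orientation); pendant edges are undirected. The graph $G$ is connected, without loops and half-edges (quotients may contain loops and half-edges). When vertices are removed, their incident edges are kept as pendant or free edges; a free edge is a connected component. Automorphisms and isomorphisms are bijections on vertices and darts that commute with $\iota$ and $\lambda$ and preserve colors, types and orientations of edges. SEMIREGULARITY AND QUOTIENTS. A group $\Gamma\le\mathrm{Aut}(G)$ is semiregular if stabilizers of all vertices, darts and non-halvable edges are trivial; a halvable edge may be fixed by an involution interchanging its two darts. An automorphism $\pi$ is semiregular if $\langle\pi\rangle$ is. For semiregular $\Gamma$, the quotient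 $G/\Gamma$ has as vertices and darts the $\Gamma$-orbits of vertices and darts, with induced incidence, pairing, colors; $p:G\to G/\Gamma$ is the projection to orbits. An edge whose two darts lie in one orbit is mapped to a half-edge. A quotient of $G$ is a graph isomorphic to some $G/\Gamma$ with $\Gamma$ semiregular. BLOCK-TREE. An articulation is a vertex $u$ with $G\setminus u$ disconnected. Blocks are the maximal 2-connected subgraphs, where bridge-edges and pendant edges also count as blocks. The block-tree is the incidence graph between articulations and blocks; its center is a single vertex, called the central articulation or the central block ($K_1$, possibly with one pendant edge, is regarded as having a central articulation). The tree is rooted at its center; the rooted subtree determined by a node $x$ consists of $x$ and all nodes whose path to the center passes through $x$. ATOMS. For a subgraph $A$, $\partial A$ is the set of vertices of $A$ incident with an edge not in $A$, and $\mathring A=A\setminus\partial A$. Parts are the following subgraphs. Block part: the union $S$ of all blocks in the rooted subtree determined by a node other than the central block, where $S$ is not a single pendant edge. Proper part: given a block $B$ and a 2-cut $U=\{u,v\}$ of $B$ (i.e. $B\setminus U$ has at least two connected components containing vertices) with $u,v$ of degree at least 3 in $B$, the subgraph consisting of $u,v$ and a connected component $K$ of $G\setminus U$ that contains a component of $B\setminus U$ (with the edges joining $K$ to $U$), where $K$ is not a single free edge and $K$ does not contain all vertices of the central block or the central articulation. Dipole part (dipole): two vertices with all edges joining them, there being at least two such edges. Atoms are the inclusion-minimal parts: block atoms, proper atoms, dipoles. The boundary $\partial A$ is: the articulation at which $A$ is attached for a block atom (the center, for a star of pendant edges); $U$ for a proper atom; the two vertices for a dipole. A graph is primitive if it has no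 atoms. SYMMETRY TYPES. $\mathrm{Aut}_{\partial A}(A)$ is the set-wise stabilizer of $\partial A$ in $\mathrm{Aut}(A)$. A proper atom or dipole $A$ with $\partial A=\{u,v\}$ is halvable if some semiregular involution in $\mathrm{Aut}_{\partial A}(A)$ exchanges $u,v$; symmetric if it is not halvable but some element of $\mathrm{Aut}_{\partial A}(A)$ exchanges $u,v$; asymmetric otherwise. A $\partial$-isomorphism $A\to A'$ is an isomorphism mapping $\partial A$ onto $\partial A'$. REDUCTION. $G_{i+1}$ arises from $G_i$ by replacing simultaneously the interior of every atom $A$ of $G_i$ by an edge $e_A$, with a new color for each $\partial$-isomorphism class of atoms: a pendant edge at $u$ if $A$ is a block atom with $\partial A=\{u\}$; a halvable/undirected/directed edge $uv$ if $A$ is a halvable/symmetric/asymmetric proper atom or dipole with $\partial A=\{u,v\}$, directed edges being oriented consistently with $\partial$-isomorphisms inside each class. Atoms in all steps are taken with respect to the image of the central block/articulation of $G$. The reduction series $G=G_0,\dots,G_r$ stops when $G_r$ is primitive. QUOTIENTS OF ATOMS AND REPLACEMENT. The edge-quotient of an atom $A$ is $A$ itself. The loop-quotient of a proper atom or dipole $A$ with $\partial A=\{u,v\}$ is obtained from $A$ by identifying $u$ and $v$ (keeping $\mathring A$). A half-quotient of a halvable proper atom or dipole $A$ is $A/\langle\tau\rangle$ for a semiregular involution $\tau\in\mathrm{Aut}_{\partial A}(A)$ exchanging $u$ and $v$. Let $p_{i+1}:G_{i+1}\to H_{i+1}$ be the projection. If $p_{i+1}(e_A)$ is an edge with distinct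 ends $x=p_{i+1}(u),y=p_{i+1}(v)$ (or a pendant edge at $x=p_{i+1}(u)$, for a block atom), replacing it by the edge-quotient means deleting it and inserting a copy of $A$ with $u,v$ glued to $x,y$ (with $u$ glued to $x$, respectively). If $p_{i+1}(e_A)$ is a loop or a half-edge at $x$, replacing it means deleting it and inserting a copy of the loop-quotient, or of a half-quotient, with the common image of $u$ and $v$ glued to $x$. Edges, loops and half-edges of $H_{i+1}$ that are not projections of edges $e_A$ are kept. *)

(* Defs.v *)
From HB Require Import structures.
From mathcomp Require Import all_boot all_fingroup.

Set Implicit Arguments.
Unset Strict Implicit.
Unset Printing Implicit Defensive.

Local Open Scope group_scope.

Inductive ekind := Halvable | Undirected | Directed.

Definition ekind_code (k : ekind) : option bool :=
  match k with Halvable => None | Undirected => Some false | Directed => Some true end.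
Definition ekind_decode (o : option bool) : ekind :=
  match o with None => Halvable | Some b => if b then Directed else Undirected end.
Lemma ekind_codeK : cancel ekind_code ekind_decode. Proof. by case. Qed.
HB.instance Definition _ := Equality.copy ekind (can_type ekind_codeK).

(** [inc] is the partial incidence, [flip] the pairing of darts.  Colours and
    types of edges are carried by the darts.  The orientation of a directed
    edge is given by [fwd], which holds for exactly one of its two darts;
    [fwd] has no meaning on the other edges. *)
Record graph := Graph {
  vert : finType;
  dart : finType;
  inc : dart -> option vert;
  flip : dart -> dart;
  color : dart -> nat;
  kind : dart -> ekind;
  fwd : dart -> bool;
  flipK : involutive flip;
  color_flip : forall d, color (flip d) = color d;
  kind_flip : forall d, kind (flip d) = kind d;
  fwd_flip : forall d, kind d = Directed -> flip d != d -> fwd (flip d) = ~~ fwd d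
}.

Definition edge_of (G : graph) (d : dart G) : {set dart G} := [set d; flip d].

Definition loopless (G : graph) : Prop :=
  forall (d : dart G) v, inc d = Some v -> inc (flip d) <> Some v.
Definition no_half_edge (G : graph) : Prop := forall d : dart G, flip d <> d.
Definition pendant_undirected (G : graph) : Prop :=
  forall (d : dart G) v, inc d = Some v -> inc (flip d) = None -> kind d = Undirected.

Definition gmap (G H : graph) : Type :=
  ((vert G -> vert H) * (dart G -> dart H))%type.

Definition preserves (G H : graph) (fv : vert G -> vert H) (fd : dart G -> dart H) : bool :=
  [forall d, [&& inc (fd d) == omap fv (inc d), fd (flip d) == flip (fd d),
                 color (fd d) == color d, kind (fd d) == kind d &
                 (kind d == Directed) ==> (fwd (fd d) == fwd d)]].

Definition is_iso (G H : graph) (f : gmap G H) : Prop :=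
  [/\ bijective f.1, bijective f.2 & preserves f.1 f.2].

Definition isomorphic (G H : graph) : Prop := exists f : gmap G H, is_iso f.

Definition gperm (G : graph) := ({perm vert G} * {perm dart G})%type.

Definition Aut (G : graph) : {set gperm G} := [set f : gperm G | preserves f.1 f.2].

Lemma Aut_group_set G : group_set (Aut G).
Proof.
apply/group_setP; split.
  rewrite inE; apply/forallP=> d; rewrite !perm1 !eqxx implybT /= andbT.
  by case: (inc d) => [v|] //=; rewrite perm1.
move=> x y; rewrite !inE => /forallP px /forallP py; apply/forallP=> d.
have /and5P[/eqP x1 /eqP x2 /eqP x3 /eqP x4 /implyP x5] := px d.
have /and5P[/eqP y1 /eqP y2 /eqP y3 /eqP y4 /implyP y5] := py (x.2 d).
rewrite !permM y1 x1 x2 y2 y3 x3 y4 x4 !eqxx /=; apply/andP; split.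
  by case: (inc d) => [v|] //=; rewrite permM.
by apply/implyP=> kd; rewrite (eqP (y5 _)) ?x4 // x5.
Qed.
Canonical Aut_group G := Group (Aut_group_set G).

(** A nontrivial element fixing a halvable edge but none of its darts
    interchanges the two darts, and is then an involution. *)
Definition semiregular (G : graph) (Gam : {set gperm G}) : bool :=
  [forall g : gperm G in Gam, (g != 1) ==>
     [&& [forall v, g.1 v != v], [forall d, g.2 d != d] &
         [forall d, (kind d != Halvable) ==> (g.2 d != flip d)]]].

Section Quotient.
Variables (G : graph) (Gam : {group gperm G}) (sGam : Gam \subset Aut G).

Definition vorb (v : vert G) : {set vert G} := [set g.1 v | g : gperm G in Gam].
Definition dorb (d : dart G) : {set dart G} := [set g.2 d | g : gperm G in Gam].

Definition qvert := {O : {set vert G} | O \in codom vorb}.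
Definition qdart := {O : {set dart G} | O \in codom dorb}.

Definition qproj_v (v : vert G) : qvert := exist _ (vorb v) (codom_f vorb v).
Definition qproj_d (d : dart G) : qdart := exist _ (dorb d) (codom_f dorb d).
Definition qrepr (O : qdart) : dart G := iinv (valP O).

Lemma qreprK O : qproj_d (qrepr O) = O.
Proof. by apply: val_inj; rewrite /= f_iinv. Qed.

Lemma qproj_dP d d' :
  reflect (exists2 g, g \in Gam & d' = g.2 d) (qproj_d d == qproj_d d').
Proof.
apply: (iffP eqP) => [/(congr1 val)/= E | [g gG ->]].
  have : d' \in dorb d by rewrite E; apply/imsetP; exists 1; rewrite ?perm1.
  by case/imsetP=> g gG ->; exists g.
apply: val_inj => /=; apply/setP=> x; apply/imsetP/imsetP=> -[h hG ->].
  by exists (g^-1 * h); rewrite ?groupM ?groupV // permM permK.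
by exists (g * h); rewrite ?groupM // permM.
Qed.

Lemma qrepr_proj d : exists2 g, g \in Gam & qrepr (qproj_d d) = g.2 d.
Proof. by apply/qproj_dP; rewrite qreprK. Qed.

Let autP g : g \in Gam -> forall d,
  [/\ g.2 (flip d) = flip (g.2 d), color (g.2 d) = color d, kind (g.2 d) = kind d &
      kind d = Directed -> fwd (g.2 d) = fwd d].
Proof.
move=> gG d; have := subsetP sGam g gG; rewrite inE => /forallP/(_ d).
case/and5P=> _ /eqP -> /eqP -> /eqP -> /implyP h; split=> // kd.
by apply/eqP/h/eqP.
Qed.

(** On [G / Gam] incidence, pairing, colours, types and orientations are read
    off a representative of the orbit; the choice is immaterial. *)
Definition qflip (O : qdart) : qdart := qproj_d (flip (qrepr O)).

Lemma qflip_proj d : qflip (qproj_d d) = qproj_d (flip d).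
Proof.
rewrite /qflip; have [g gG ->] := qrepr_proj d.
apply/esym/eqP/qproj_dP; exists g => //.
by have [->] := autP gG d.
Qed.

Fact qflipK : involutive qflip.
Proof. by move=> O; rewrite -{1}(qreprK O) !qflip_proj flipK qreprK. Qed.

Fact qcolor_flip O : color (qrepr (qflip O)) = color (qrepr O).
Proof.
rewrite /qflip; have [g gG ->] := qrepr_proj (flip (qrepr O)).
by have [_ -> _ _] := autP gG (flip (qrepr O)); rewrite color_flip.
Qed.

Fact qkind_flip O : kind (qrepr (qflip O)) = kind (qrepr O).
Proof.
rewrite /qflip; have [g gG ->] := qrepr_proj (flip (qrepr O)).
by have [_ _ -> _] := autP gG (flip (qrepr O)); rewrite kind_flip.
Qed.

Fact qfwd_flip O : kind (qrepr O) = Directed -> qflip O != O ->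
  fwd (qrepr (qflip O)) = ~~ fwd (qrepr O).
Proof.
move=> kO nO; rewrite /qflip; have [g gG ->] := qrepr_proj (flip (qrepr O)).
have [_ _ _ ->] := autP gG (flip (qrepr O)); last by rewrite kind_flip.
apply: fwd_flip => //; apply: contraNneq nO => e.
by rewrite /qflip e qreprK.
Qed.

Definition quot : graph :=
  @Graph qvert qdart (fun O => omap qproj_v (inc (qrepr O))) qflip
         (fun O => color (qrepr O)) (fun O => kind (qrepr O))
         (fun O => fwd (qrepr O))
         qflipK qcolor_flip qkind_flip qfwd_flip.

End Quotient.

(** [p] is the projection of [G] onto its quotient [H], up to an isomorphism
    between [G / Gam] and [H]. *)
Definition quotient_projection (G H : graph) (p : gmap G H) : Prop :=
  exists (Gam : {group gperm G}) (sGam : Gam \subset Aut G) (f : gmap (quot sGam) H),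
    [/\ semiregular Gam, is_iso f,
        forall v, p.1 v = f.1 (qproj_v Gam v) & forall d, p.2 d = f.2 (qproj_d Gam d)].

Definition is_quotient (G H : graph) : Prop :=
  exists p : gmap G H, quotient_projection p.

(** Subgraphs are sets of vertices and darts.  Deleting vertices from such a
    set while keeping its darts produces the pendant and free edges: a dart is
    attached, inside [S], to its vertex only if that vertex belongs to [S]. *)
Section Cells.
Variable G : graph.

Definition cell := (vert G + dart G)%type.

Definition link : rel cell := fun x y =>
  match x, y with
  | inr d, inr d' => d' == flip d
  | inr d, inl v | inl v, inr d => inc d == Some v
  | inl _, inl _ => false
  end.

Definition link_in (S : {set cell}) : rel cell :=
  fun x y => [&& x \in S, y \in S & link x y].

Definition component (S : {set cell}) (x : cell) : {set cell} :=
  [set y in S | connect (link_in S) x y].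
Definition components (S : {set cell}) : {set {set cell}} := [set component S x | x in S].

Definition connected (S : {set cell}) : bool :=
  [forall x in S, forall y in S, connect (link_in S) x y].

Definition verts (S : {set cell}) : {set vert G} := [set v | inl v \in S].
Definition vcells (U : {set vert G}) : {set cell} := [set inl v | v in U].
Definition edge_cells (d : dart G) : {set cell} := [set inr d; inr (flip d)].

Definition subgraph (S : {set cell}) : bool :=
  [forall d, (inr d \in S) ==>
     (inr (flip d) \in S) && (if inc d is Some v then inl v \in S else true)].

Definition articulation (S : {set cell}) (u : vert G) : bool :=
  (inl u \in S) && ~~ connected (S :\ inl u).

Definition pendant_edge (S : {set cell}) : bool :=
  [exists d, exists v, [&& inc d == Some v, inc (flip d) == None &
                           S == inl v |: edge_cells d]].

(** A single edge with two ends satisfies [biconnected], and it is maximal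
    exactly when it is a bridge without parallel edges; hence bridges are
    blocks below. *)
Definition biconnected (S : {set cell}) : bool :=
  [&& subgraph S, 1 < #|verts S|, connected S & [forall u, ~~ articulation S u]].

Definition block (S : {set cell}) : bool := maxset biconnected S || pendant_edge S.

(** The nodes of the block-tree are the blocks and the singletons of articulations. *)
Definition artic_node (x : {set cell}) : bool :=
  [exists u, articulation setT u && (x == [set inl u])].
Definition node (x : {set cell}) : bool := artic_node x || block x.
Definition tree_adj : rel {set cell} := fun x y =>
  [|| [&& artic_node x, block y & x \subset y]
    | [&& artic_node y, block x & y \subset x]].

Definition ecc_le (x : {set cell}) (n : nat) : Prop :=
  forall y, node y -> exists p, [/\ path tree_adj x p, last x p = y & size p <= n].

Definition tree_center (c : {set cell}) : Prop :=
  node c /\ exists n, ecc_le c n /\ forall x m, node x -> ecc_le x m -> n <= m.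

(** For a connected loopless graph without half-edges, the first alternative
    describes [K_1], possibly with one pendant edge. *)
Definition is_center (c : {set cell}) : Prop :=
  if (#|vert G| == 1%N) && (#|dart G| <= 2) then c = vcells setT else tree_center c.

End Cells.

(** A graph with a distinguished central articulation (a singleton) or central
    block, which roots the block-tree. *)
Record rooted := Rooted { rgraph :> graph; center : {set cell rgraph} }.

Section Atoms.
Variable R : rooted.
Notation G := (rgraph R).
Notation c := (center R).

(** Every path of the block-tree from the center to [y] passes through [x]. *)
Definition in_subtree (x y : {set cell G}) : bool :=
  (y == x) || ~~ connect (fun a b => [&& tree_adj a b, a != x & b != x]) c y.

(** The empty union only occurs for [K_1], which has no parts. *)
Definition block_part (S : {set cell G}) : bool :=
  [exists x, [&& node x, ~~ (block x && (x == c)),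
                 S == \bigcup_(B | block B && in_subtree x B) B,
                 S != set0 & ~~ pendant_edge S]].

Definition degree_in (B : {set cell G}) (u : vert G) : nat :=
  #|[set d | (inr d \in B) && (inc d == Some u)]|.

Definition two_cut (B : {set cell G}) (u v : vert G) : bool :=
  [&& u != v, inl u \in B, inl v \in B &
      1 < #|[set C in components (B :\: vcells [set u; v]) | verts C != set0]|].

(** The component [K] of [G \ U] contains the darts of the edges joining it to
    [U], since these become pendant edges after the removal of [U]. *)
Definition proper_part (S : {set cell G}) : bool :=
  [exists B, exists u, exists v,
    [&& block B, two_cut B u v, 2 < degree_in B u, 2 < degree_in B v &
      [exists K in components (~: vcells [set u; v]),
        [&& [exists C in components (B :\: vcells [set u; v]), C \subset K],
            [forall d, K != edge_cells d],
            ~~ (verts c \subset verts K) &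
            S == vcells [set u; v] :|: K]]]].

Definition joins (d : dart G) (u v : vert G) : bool :=
  (inc d == Some u) && (inc (flip d) == Some v).

Definition dipole (S : {set cell G}) : bool :=
  [exists u, exists v, [&& u != v, 1 < #|[set d | joins d u v]| &
    S == vcells [set u; v] :|: [set inr d | d in [pred d | joins d u v || joins d v u]]]].

Definition part (S : {set cell G}) : bool := [|| block_part S, proper_part S | dipole S].

Definition atom := {A : {set cell G} | minset part A}.

(** A pendant block consisting of parallel edges is both a block part and a
    dipole; it is treated as a dipole, so that block atoms never contain
    parallel edges. *)
Definition block_atom (A : atom) : bool := block_part (val A) && ~~ dipole (val A).

(** The clause on [c] concerns block atoms attached at the central articulation;
    it is needed when the whole graph is a star of pendant edges. *)
Definition boundary (A : atom) : {set vert G} :=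
  if dipole (val A) then verts (val A) else
  [set v | (inl v \in val A) &&
           ((c == [set inl v]) || [exists d, (inc d == Some v) && (inr d \notin val A)])].

End Atoms.

(** Pairing on a subset of darts; the default is used only if the subset is
    not closed under the pairing. *)
Section FlipOn.
Variables (G : graph) (P : pred (dart G)).
Definition flip_on (d : {d | P d}) : {d | P d} := insubd d (flip (val d)).

Lemma flip_onE d : val (flip_on d) = if P (flip (val d)) then flip (val d) else val d.
Proof. by rewrite /flip_on val_insubd. Qed.
Fact flip_onK : involutive flip_on.
Proof.
move=> d; apply: val_inj; rewrite !flip_onE.
by case h: (P (flip (val d))); rewrite ?flipK ?(valP d) ?h.
Qed.
Fact color_flip_on d : color (val (flip_on d)) = color (val d).
Proof. by rewrite flip_onE; case: ifP => // _; rewrite color_flip. Qed.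
Fact kind_flip_on d : kind (val (flip_on d)) = kind (val d).
Proof. by rewrite flip_onE; case: ifP => // _; rewrite kind_flip. Qed.
Fact fwd_flip_on d : kind (val d) = Directed -> flip_on d != d ->
  fwd (val (flip_on d)) = ~~ fwd (val d).
Proof.
move=> kd; rewrite -val_eqE /= flip_onE.
by case: ifP => _; [apply: fwd_flip | rewrite eqxx].
Qed.
End FlipOn.

Definition sub_graph (G : graph) (S : {set cell G}) : graph :=
  @Graph {v : vert G | inl v \in S} {d : dart G | inr d \in S}
         (fun d => obind insub (inc (val d))) (@flip_on G _)
         (fun d => color (val d)) (fun d => kind (val d)) (fun d => fwd (val d))
         (@flip_onK G _) (@color_flip_on G _) (@kind_flip_on G _) (@fwd_flip_on G _).

Section Symmetry.
Variable R : rooted.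

Definition agraph (A : atom R) : graph := sub_graph (val A).

Definition avert (A : atom R) (v : vert (agraph A)) : vert R := val v.

Definition aboundary (A : atom R) : {set vert (agraph A)} :=
  [set v | avert v \in boundary A].

Definition Aut_boundary (A : atom R) : {set gperm (agraph A)} :=
  [set t in Aut (agraph A) | [set t.1 b | b in aboundary A] == aboundary A].

Definition exchanging (A : atom R) (t : gperm (agraph A)) : bool :=
  (t \in Aut_boundary A) && [forall b in aboundary A, t.1 b != b].

Definition halving (A : atom R) (t : gperm (agraph A)) : bool :=
  [&& exchanging t, #[t] == 2%N & semiregular <[t]>].

Lemma halving_sub (A : atom R) (t : gperm (agraph A)) :
  halving t -> <[t]> \subset Aut (agraph A).
Proof. by case/and3P=> /andP[]; rewrite inE cycle_subG => /andP[]. Qed.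

Definition atom_kind (A : atom R) : ekind :=
  if block_atom A then Undirected
  else if [exists t : gperm (agraph A), halving t] then Halvable
  else if [exists t : gperm (agraph A), exchanging t] then Undirected
  else Directed.

Definition boundary_iso (A A' : atom R) (f : gmap (agraph A) (agraph A')) : Prop :=
  is_iso f /\ [set f.1 b | b in aboundary A] = aboundary A'.

(** The choices left open by the reduction: the new colours and, for every atom
    [A], the boundary vertex [tail A] at which the forward dart of [e_A] is
    attached. *)
Record labelling := Labelling {
  new_color : atom R -> nat;
  tail : atom R -> vert R;
  tail_boundary : forall A, tail A \in boundary A;
  new_color_fresh : forall A (d : dart R), new_color A <> color d;
  new_colorP : forall A A', new_color A = new_color A' <->
    exists f : gmap (agraph A) (agraph A'), boundary_iso f;
  tail_iso : forall A A' (f : gmap (agraph A) (agraph A')),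
    atom_kind A = Directed -> boundary_iso f ->
    forall v, avert v = tail A -> avert (f.1 v) = tail A'
}.

Section Reduce.
Variable l : labelling.

Definition kept_vert (v : vert R) : bool :=
  [forall A : atom R, (inl v \in val A) ==> (v \in boundary A)].
Definition kept_dart (d : dart R) : bool := [forall A : atom R, inr d \notin val A].

(** [inr (A, true)] and [inr (A, false)] are the darts of [e_A]; the second one
    is attached to no vertex if the boundary of [A] has only one vertex. *)
Definition rvert := {v : vert R | kept_vert v}.
Definition rdart := ({d : dart R | kept_dart d} + atom R * bool)%type.

Definition rinc (x : rdart) : option rvert :=
  match x with
  | inl d => obind insub (inc (val d))
  | inr (A, b) =>
      obind insub (if b then Some (tail l A) else [pick v in boundary A | v != tail l A])
  end.
Definition rflip (x : rdart) : rdart :=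
  match x with inl d => inl (flip_on d) | inr (A, b) => inr (A, ~~ b) end.
Definition rcolor (x : rdart) : nat :=
  match x with inl d => color (val d) | inr (A, _) => new_color l A end.
Definition rkind (x : rdart) : ekind :=
  match x with inl d => kind (val d) | inr (A, _) => atom_kind A end.
Definition rfwd (x : rdart) : bool :=
  match x with inl d => fwd (val d) | inr (_, b) => b end.

Fact rflipK : involutive rflip.
Proof. by case=> [d|[A b]] /=; rewrite ?flip_onK ?negbK. Qed.
Fact rcolor_flip x : rcolor (rflip x) = rcolor x.
Proof. by case: x => [d|[A b]] //=; rewrite color_flip_on. Qed.
Fact rkind_flip x : rkind (rflip x) = rkind x.
Proof. by case: x => [d|[A b]] //=; rewrite kind_flip_on. Qed.
Fact rfwd_flip x : rkind x = Directed -> rflip x != x -> rfwd (rflip x) = ~~ rfwd x.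
Proof.
by case: x => [d|[A b]] //= kd nd; apply: fwd_flip_on.
Qed.

Definition reduced_graph : graph :=
  @Graph rvert rdart rinc rflip rcolor rkind rfwd
         rflipK rcolor_flip rkind_flip rfwd_flip.

(** Image of the center: in the central block, the edges lying in an atom [A]
    are replaced by [e_A]. *)
Definition reduced_center : {set cell reduced_graph} :=
  [set x : rvert + rdart | match x with
    | inl v => inl (val v) \in center R
    | inr (inl d) => inr (val d) \in center R
    | inr (inr (A, _)) => [exists d, (inr d \in val A) && (inr d \in center R)]
    end].

Definition reduce : rooted := @Rooted reduced_graph reduced_center.

Definition old_vert (v : vert reduce) : vert R := val (v : rvert).
Definition e_dart (A : atom R) (b : bool) : dart reduce := inr (A, b) : rdart.

End Reduce.
End Symmetry.

Definition primitive (R : rooted) : Prop := forall A : {set cell R}, ~~ minset (@part R) A.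

Record reduction_series (G : graph) := ReductionSeries {
  root : {set cell G};
  root_center : is_center root;
  len : nat;
  term : nat -> rooted;
  term_label : forall i : 'I_len, labelling (term i);
  term0 : term 0 = Rooted root;
  termS : forall i : 'I_len, term i.+1 = reduce (term_label i);
  term_not_primitive : forall i : 'I_len, ~ primitive (term i);
  term_last : primitive (term len)
}.

Section AtomQuotients.
Variables (R : rooted) (A : atom R).

(** The vertex [None] results from identifying the boundary vertices. *)
Definition loop_quot : graph :=
  @Graph (option {v : vert (agraph A) | v \notin aboundary A}) (dart (agraph A))
         (fun d => omap insub (inc d)) (@flip (agraph A)) (@color (agraph A))
         (@kind (agraph A)) (@fwd (agraph A)) (@flipK (agraph A))
         (@color_flip (agraph A)) (@kind_flip (agraph A)) (@fwd_flip (agraph A)).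

Inductive atom_quotient :=
  | EdgeQuotient
  | LoopQuotient
  | HalfQuotient (t : gperm (agraph A)) of halving t.

Definition quotient_graph (k : atom_quotient) : graph :=
  match k with
  | EdgeQuotient => agraph A
  | LoopQuotient => loop_quot
  | HalfQuotient t h => quot (halving_sub h)
  end.

Definition quotient_map (k : atom_quotient) : vert (agraph A) -> vert (quotient_graph k) :=
  match k with
  | EdgeQuotient => id
  | LoopQuotient => fun v => (insub v : vert loop_quot)
  | HalfQuotient t h => qproj_v <[t]>
  end.

Definition quotient_boundary (k : atom_quotient) : {set vert (quotient_graph k)} :=
  [set quotient_map k b | b in aboundary A].

End AtomQuotients.

Section Expansion.
Variables (R : rooted) (l : labelling R) (H : graph) (p : gmap (reduce l) H).

Definition image_edge (A : atom R) : {set dart H} := edge_of (p.2 (e_dart l A true)).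

Definition replaced (d : dart H) : bool := [exists A, d \in image_edge A].

(** [T] contains exactly one atom [A] over each edge, loop or half-edge of [H]
    which is the projection of some [e_A]. *)
Definition selects (T : {set atom R}) : Prop :=
  forall A : atom R, exists! A', A' \in T /\ image_edge A' = image_edge A.

(** The edge-quotient is used for standard and pendant edges. *)
Definition fits (A : atom R) (k : atom_quotient A) : Prop :=
  let d := p.2 (e_dart l A true) in
  match k with
  | EdgeQuotient => flip d <> d /\ inc d <> inc (flip d)
  | LoopQuotient => flip d <> d /\ inc d = inc (flip d)
  | HalfQuotient _ _ => flip d = d
  end.

Variables (T : {set atom R}) (k : forall A : atom R, atom_quotient A).

Definition copy (A : {A : atom R | A \in T}) : graph := quotient_graph (k (val A)).

Definition copy_interior (A : {A : atom R | A \in T}) : finType :=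
  {w : vert (copy A) | w \notin quotient_boundary (k (val A))}.

Definition xvert := (vert H + {A : {A : atom R | A \in T} & copy_interior A})%type.
Definition xdart :=
  ({d : dart H | ~~ replaced d} + {A : {A : atom R | A \in T} & dart (copy A)})%type.

(** The image in [copy A] of a boundary vertex [b] of [A] is glued to the
    projection of [b]. *)
Definition glue (A : {A : atom R | A \in T}) (w : vert (copy A)) : option xvert :=
  if insub w is Some w' then Some (inr (Tagged copy_interior w'))
  else omap (fun x => inl (p.1 x))
         [pick x : vert (reduce l) |
            [exists b in aboundary (val A),
               (avert b == old_vert x) && (quotient_map (k (val A)) b == w)]].

Definition xinc (x : xdart) : option xvert :=
  match x with
  | inl d => omap inl (inc (val d))
  | inr y => obind (@glue (tag y)) (inc (tagged y))
  end.
Definition xflip (x : xdart) : xdart :=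
  match x with
  | inl d => inl (flip_on d)
  | inr y => inr (Tagged (fun A => dart (copy A)) (flip (tagged y)))
  end.
Definition xcolor (x : xdart) : nat :=
  match x with inl d => color (val d) | inr y => color (tagged y) end.
Definition xkind (x : xdart) : ekind :=
  match x with inl d => kind (val d) | inr y => kind (tagged y) end.
Definition xfwd (x : xdart) : bool :=
  match x with inl d => fwd (val d) | inr y => fwd (tagged y) end.

Fact xflipK : involutive xflip.
Proof. by case=> [d|[A d]] /=; rewrite ?flip_onK ?flipK. Qed.
Fact xcolor_flip x : xcolor (xflip x) = xcolor x.
Proof. by case: x => [d|[A d]] /=; rewrite ?color_flip_on ?color_flip. Qed.
Fact xkind_flip x : xkind (xflip x) = xkind x.
Proof. by case: x => [d|[A d]] /=; rewrite ?kind_flip_on ?kind_flip. Qed.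
Fact xfwd_flip x : xkind x = Directed -> xflip x != x -> xfwd (xflip x) = ~~ xfwd x.
Proof.
case: x => [d|[A d]] /= kd nd; [apply: fwd_flip_on | apply: fwd_flip] => //;
by apply: contraNneq nd; rewrite /Tagged /= => ->.
Qed.

Definition expansion : graph :=
  @Graph xvert xdart xinc xflip xcolor xkind xfwd xflipK xcolor_flip xkind_flip xfwd_flip.

End Expansion.

(** [H0] is constructed from the quotient [H] of the reduced graph, with
    projection [p], by replacing every edge, loop and half-edge of [H] that is
    the projection of some [e_A]. *)
Definition constructed_from (R : rooted) (l : labelling R) (H : graph)
    (p : gmap (reduce l) H) (H0 : graph) : Prop :=
  exists (T : {set atom R}) (k : forall A : atom R, atom_quotient A),
    [/\ selects p T, forall A, A \in T -> fits p (k A) &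
        isomorphic (expansion p T k) H0].

(* Main.v *)
(** Two distinct atoms have no common dart.  An atom is a dipole, a star of pendant edges, or a set
    of one or two boundary vertices together with a component of their complement; if two of them
    overlap, uncrossing produces a smaller part inside one of the two, against minimality.  Hence
    boundary vertices survive the reduction, and a semiregular group [Gam] of automorphisms of [G_i]
    acts on [G_(i+1)].  The action is semiregular: an element that exchanges the darts of [e_A]
    restricts to an involution of [A], so that [A] is halvable.  Choosing one atom in every orbit,
    the cells of the expansion of [G_(i+1) / Gam] correspond to the [Gam]-orbits of cells of [G_i].

    This requires the automorphisms of [G_i] to preserve the center.  For [G_0] the center is unique
    because all leaves of the block-tree are blocks.  An automorphism of [G_(i+1)] lifts to [G_i]
    by choosing, for every atom, a boundary isomorphism which agrees with it at the boundary, so the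
    property is inherited by [G_(i+1)]. *)

Require Import Defs.
From mathcomp Require Import all_boot all_fingroup cyclic.

Set Implicit Arguments.
Unset Strict Implicit.
Unset Printing Implicit Defensive.

(** * Reachability and blocks *)

(** All geometry is phrased as reachability between cells. The basic fact is that a walk leaving a
    block can return only through the vertex at which it left; otherwise an ear would enlarge the
    block. It turns subtrees of the block-tree into components of [G] minus a vertex, and separation
    inside a block into separation in [G]. The center decides the overlaps that minimality cannot:
    when two sets together cover the graph, the center would have to avoid both. Two choices break
    symmetry. Automorphisms need not respect the tails of a labelling, so the action on the darts of
    [e_A] carries a correction bit; the bound of two boundary vertices makes it consistent. In a
    loop-quotient the boundary vertices are identified although no element stabilizing the atom
    exchanges them: they lie in one [Gam]-orbit for another reason. Interior cells are therefore
    compared by the stabilizer of the atom, boundary vertices by all of [Gam]. Isomorphisms are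
    built as relations and made into functions at the end, so that no argument depends on a
    representative of an orbit. *)

Lemma connect_ind (T : finType) (e : rel T) (P : T -> Prop) x y :
  (forall a b, P a -> e a b -> P b) -> connect e x y -> P x -> P y.
Proof.
move=> cl /connectP[p pp ->]; elim: p x pp => //= a p IH x /andP[xa pa] Px.
exact: IH pa (cl _ _ Px xa).
Qed.

Lemma connect_exit (T : finType) (e : rel T) (P : pred T) x y :
  connect e x y -> P x -> ~~ P y -> exists a b, [/\ connect e x a, P a, ~~ P b & e a b].
Proof.
move=> /connectP[p pp ->]; elim: p x pp => [|a p IH] x /=; first by move=> _ ->.
case/andP=> xa pa Px nPy; case Pa: (P a); last by exists x, a; rewrite Px Pa.
have [a' [b' [c1 c2 c3 c4]]] := IH a pa Pa nPy.
by exists a', b'; split=> //; apply: connect_trans c1; apply: connect1.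
Qed.

Section Reach.
Variable G : graph.
Implicit Types (S B K : {set cell G}) (x y z : cell G) (u v w : vert G) (d : dart G).

Definition reach S x y := connect (link_in S) x y.

Lemma link_sym : symmetric (@link G).
Proof.
by case=> [u|d] [v|e] //=; apply/eqP/eqP=> ->; rewrite flipK.
Qed.

Lemma link_in_sym S : symmetric (link_in S).
Proof. by move=> x y; rewrite /link_in link_sym andbCA. Qed.

Lemma reach_sym S x y : reach S x y = reach S y x.
Proof. by apply: (sym_connect_sym (@link_in_sym S)). Qed.

Lemma reach_trans S y x z : reach S x y -> reach S y z -> reach S x z.
Proof. exact: connect_trans. Qed.

Lemma reach0 S x : reach S x x. Proof. exact: connect0. Qed.

Lemma reach1 S x y : x \in S -> y \in S -> link x y -> reach S x y.
Proof. by move=> xS yS l; apply: connect1; rewrite /link_in xS yS. Qed.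

Lemma reachW S S' x y : S \subset S' -> reach S x y -> reach S' x y.
Proof.
move=> sSS'; apply: connect_sub => a b /and3P[aS bS l].
by apply: reach1 => //; apply: (subsetP sSS').
Qed.

Lemma reach_ind S (P : cell G -> Prop) x y :
  (forall a b, P a -> a \in S -> b \in S -> link a b -> P b) -> reach S x y -> P x -> P y.
Proof.
move=> cl; apply: connect_ind => a b Pa /and3P[aS bS l]; exact: cl l.
Qed.

Lemma reach_mem S x y : reach S x y -> x \in S -> y \in S.
Proof. by apply: (@reach_ind S (fun z => z \in S)). Qed.

Lemma reach_exit S (P : pred (cell G)) x y : reach S x y -> P x -> ~~ P y ->
  exists a b, [/\ reach S x a, P a, ~~ P b & [/\ a \in S, b \in S & link a b]].
Proof.
move=> r Px Py; have [a [b [h1 h2 h3 /and3P[h4 h5 h6]]]] := connect_exit r Px Py.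
by exists a, b.
Qed.

Lemma reach_into S S' x y :
  (forall z, reach S x z -> z \in S') -> reach S x y -> reach S' x y.
Proof.
move=> h r; suff [] : reach S x y /\ reach S' x y by [].
apply: (@reach_ind S (fun z => reach S x z /\ reach S' x z) x y _ r) => [a b [r1 r2] aS bS l|];
  last by split; apply: reach0.
have r3 : reach S x b by apply: reach_trans r1 (reach1 aS bS l).
by split=> //; apply: reach_trans r2 (reach1 _ _ l); apply: h.
Qed.

Lemma in_component S x y : (y \in component S x) = (y \in S) && reach S x y.
Proof. by rewrite inE. Qed.

Lemma component_eq S x y : reach S x y -> component S x = component S y.
Proof.
move=> r; apply/setP=> z; rewrite !in_component; congr (_ && _).
by apply/idP/idP; apply: reach_trans; rewrite // reach_sym.
Qed.

Lemma connectedP S : reflect (forall x y, x \in S -> y \in S -> reach S x y) (connected S).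
Proof.
apply: (iffP forall_inP) => [h x y xS yS|h x xS]; first exact: (forall_inP (h x xS)).
by apply/forall_inP => y yS; apply: h.
Qed.

Lemma connected_from S a : (forall x, x \in S -> reach S a x) -> connected S.
Proof.
move=> h; apply/connectedP=> x y xS yS; apply: reach_trans (h _ yS).
by rewrite reach_sym h.
Qed.

Lemma subgraph_flip S d : subgraph S -> inr d \in S -> inr (flip d) \in S.
Proof. by move/forallP/(_ d)/implyP=> h /h /andP[]. Qed.

Lemma subgraph_inc S d v : subgraph S -> inr d \in S -> inc d = Some v -> inl v \in S.
Proof. by move/forallP/(_ d)/implyP=> h /h /andP[_] + e; rewrite e. Qed.

Lemma in_vcells U v : (@inl _ (dart G) v \in vcells U) = (v \in U).
Proof. by rewrite /vcells mem_imset //; apply: inl_inj. Qed.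

Lemma inr_vcells U d : (@inr (vert G) _ d \in vcells U) = false.
Proof. by apply/imsetP=> -[]. Qed.

Lemma link_dartP d x : link (inr d) x -> x = inr (flip d) \/ exists2 v, inc d = Some v & x = inl v.
Proof.
by case: x => [v|e] /= /eqP h; [right; exists v|left; rewrite h].
Qed.

Lemma link_vertP v x : link (inl v) x -> exists2 d, inc d = Some v & x = inr d.
Proof. by case: x => [//|e] /= /eqP h; exists e. Qed.

Lemma in_verts S v : (v \in verts S) = (inl v \in S).
Proof. by rewrite inE. Qed.

(** [g] is the vertex of [B] through which the component of [x] outside [B] is reached. *)
Definition att B x g :=
  exists2 d, (inl g \in B /\ inr d \notin B) & inc d = Some g /\ reach (~: B) (inr d) x.

End Reach.

Section Blocks.
Variable G : graph.
Hypotheses (conn : connected [set: cell G]) (noloop : loopless G).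
Implicit Types (S B K : {set cell G}) (x y z : cell G) (u v w : vert G) (d : dart G).

Lemma reachT x y : reach setT x y.
Proof. by move/connectedP: conn; apply; rewrite inE. Qed.

Lemma biconnected_del S w : biconnected S -> connected (S :\ inl w).
Proof.
case/and4P=> _ _ cS /forallP/(_ w); rewrite /articulation negb_and negbK.
case: (boolP (inl w \in S)) => //= wS _; rewrite (_ : S :\ inl w = S) //.
by apply/setDidPl; rewrite disjoint_sym disjoints1.
Qed.

Lemma biconnected_two S w : biconnected S -> exists2 v, inl v \in S & v != w.
Proof.
case/and4P=> _ c2 _ _; have /card_gt0P[v] : 0 < #|verts S :\ w|.
  by move: c2; rewrite (cardsD1 w (verts S)); case: (_ \in _); case: #|_|.
by rewrite !inE => /andP[vw vS]; exists v.
Qed.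

(** After deletion of the other end of the edge, the two darts are linked to nothing else, while
    another vertex of [S] survives; this contradicts biconnectedness. *)
Lemma biconnected_inc S d : biconnected S -> inr d \in S -> exists v, inc d = Some v.
Proof.
move=> bS dS; case e: (inc d) => [v|]; first by exists v.
have sS : subgraph S by case/and4P: bS.
(* [v0] is the other end of the edge if there is one, and an arbitrary vertex otherwise. *)
have [v0 v0P] : exists v0, forall v, inc (flip d) = Some v -> v = v0.
  case f: (inc (flip d)) => [v|]; first by exists v => ? [->].
  have /card_gt0P[v _] : 0 < #|verts S| by case/and4P: bS => _ /ltnW.
  by exists v.
have [w wS wv0] := biconnected_two v0 bS.
have /connectedP/(_ (inr d) (inl w)) := biconnected_del v0 bS.
rewrite !inE dS wS /= => /(_ isT); rewrite (inj_eq (@inl_inj _ _)) wv0 => /(_ isT) r.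
have : inl w \in edge_cells d.
  apply: (reach_ind (P := fun z => z \in edge_cells d) _ r); last by rewrite !inE eqxx.
  move=> a b; rewrite !inE => /orP[]/eqP-> _ /andP[bv _] /link_dartP[->|[v ev be]].
  - by rewrite eqxx orbT.
  - by rewrite ev in e.
  - by rewrite flipK eqxx.
  - by move: bv; rewrite be (v0P _ ev) eqxx.
by rewrite !inE.
Qed.

Lemma pendant_edgeP S : reflect
  (exists d v, [/\ inc d = Some v, inc (flip d) = None & S = inl v |: edge_cells d])
  (pendant_edge S).
Proof.
apply: (iffP existsP) => [[d /existsP[v /and3P[/eqP h1 /eqP h2 /eqP h3]]]|[d [v [h1 h2 h3]]]].
  by exists d, v.
by exists d; apply/existsP; exists v; rewrite h1 h2 h3 !eqxx.
Qed.

Lemma block_cases B : block B -> (maxset (@biconnected G) B) \/ (exists d v, [/\ inc d = Some v,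
  inc (flip d) = None & B = inl v |: edge_cells d]).
Proof. by case/orP => [|/pendant_edgeP]; [left|right]. Qed.

Lemma block_sub B : block B -> subgraph B.
Proof.
case/block_cases => [/maxsetp/and4P[]//|[d [v [h1 h2 ->]]]].
apply/forallP=> e; apply/implyP; rewrite !inE /= => /orP[]/eqP[->].
  by rewrite h1 !inE !eqxx orbT.
by rewrite flipK h2 !eqxx.
Qed.

Lemma reach_flip S d : inr d \in S -> inr (flip d) \in S -> reach S (inr d) (inr (flip d)).
Proof. by move=> h1 h2; apply: reach1 => //=. Qed.

Lemma reach_inc S d v : inr d \in S -> inl v \in S -> inc d = Some v -> reach S (inr d) (inl v).
Proof. by move=> h1 h2 /eqP e; apply: (reach1 h1 h2). Qed.

Lemma block_del B w : block B -> connected (B :\ inl w).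
Proof.
case/block_cases => [/maxsetp/biconnected_del//|[d [v [h1 h2 ->]]]].
set S := _ :\ _.
have dS : inr d \in S by rewrite !inE eqxx.
have fS : inr (flip d) \in S by rewrite !inE eqxx orbT.
apply: (@connected_from _ S (inr d)) => x xS; move: (xS);
  rewrite !inE => /andP[xw /or3P[]/eqP e]; rewrite e.
- by apply: reach_inc; rewrite -?e.
- exact: reach0.
- exact: reach_flip.
Qed.

Lemma block_reach B w x y : block B -> x \in B -> y \in B -> x != inl w -> y != inl w ->
  reach (~: [set inl w]) x y.
Proof.
move=> bB xB yB xw yw; apply: (@reachW _ (B :\ inl w)).
  by apply/subsetP=> z; rewrite !inE => /andP[].
by move/connectedP: (block_del w bB); apply; rewrite !inE ?xw ?yw.
Qed.

Lemma block_conn B : block B -> connected B.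
Proof.
case/block_cases => [/maxsetp/and4P[]//|[d [v [h1 h2 ->]]]].
set S := _ |: _.
have dS : inr d \in S by rewrite !inE eqxx.
have fS : inr (flip d) \in S by rewrite !inE eqxx orbT.
apply: (@connected_from _ S (inr d)) => x xS; move: (xS); rewrite !inE => /or3P[]/eqP e; rewrite e.
- by apply: reach_inc; rewrite -?e.
- exact: reach0.
- exact: reach_flip.
Qed.

Lemma block_vert_dart B v : block B -> inl v \in B -> exists2 d, inr d \in B & inc d = Some v.
Proof.
move=> /block_cases[mB|[d [u [h1 h2 ->]]]] vB; last first.
  have -> : v = u by move: vB; rewrite !inE /= orbF => /eqP[].
  by exists d => //; rewrite !inE eqxx.
have bB := maxsetp mB; have [w wB wv] := biconnected_two v bB.
have /and4P[_ _ /connectedP/(_ _ _ vB wB) r _] := bB.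
have [| |a [b [_ /eqP-> _ [_ bB' /link_vertP[d e be]]]]] := reach_exit (P := pred1 (inl v)) r.
- by rewrite /= eqxx.
- by rewrite /= (inj_eq (@inl_inj _ _)).
- by exists d => //; rewrite -be.
Qed.

Lemma block_vert B : block B -> exists v, inl v \in B.
Proof.
move=> /block_cases[/maxsetp/and4P[_ /ltnW/card_gt0P[v vB] _ _]|[d [u [h1 h2 ->]]]].
  by exists v; rewrite -in_verts.
by exists u; rewrite !inE eqxx.
Qed.

Lemma block_dart B : block B -> exists d, inr d \in B.
Proof.
move=> bB; have [v vB] := block_vert bB.
by have [d dB _] := block_vert_dart bB vB; exists d.
Qed.

Lemma attW B x y g : att B x g -> reach (~: B) x y -> att B y g.
Proof. by move=> [d h1 [h2 h3]] r; exists d => //; split=> //; apply: reach_trans r. Qed.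

Lemma att_notin B x g : att B x g -> x \notin B.
Proof. by case=> d [_ dB] [_ r]; have := reach_mem r; rewrite !inE => ->. Qed.

Lemma att_in B x g : att B x g -> inl g \in B.
Proof. by case=> d []. Qed.

Lemma link_out B x y : subgraph B -> x \in B -> y \notin B -> link x y ->
  exists g d, [/\ x = inl g, y = inr d & inc d = Some g].
Proof.
move=> sB; case: x => [g|d] xB yB.
  by case/link_vertP=> d e ye; exists g, d.
case/link_dartP => [ye|[v e ye]].
  by rewrite ye (subgraph_flip sB xB) in yB.
by rewrite ye (subgraph_inc sB xB e) in yB.
Qed.

(** On a walk from [x] to [B], the step into [B] goes from a dart to a vertex, because a subgraph
    contains the partners and the ends of its darts. *)
Lemma att_ex B x : subgraph B -> B != set0 -> x \notin B -> exists g, att B x g.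
Proof.
move=> sB /set0Pn[z zB] xB.
have nx : ~~ reach (~: B) x z by apply/negP=> /reach_mem; rewrite !inE xB zB => /(_ isT).
have [a [b [_ ra rb [_ _ l]]]] := reach_exit (P := reach (~: B) x) (reachT x z) (reach0 _ _) nx.
have aB : a \notin B by have := reach_mem ra; rewrite !inE => ->.
have bB : b \in B.
  by apply: contraNT rb => bB; apply: reach_trans ra (reach1 _ _ l); rewrite inE.
have [g [d [eb ea e]]] := link_out sB bB aB (etrans (link_sym _ _) l).
by exists g, d; rewrite -?ea -?eb; split=> //; rewrite reach_sym.
Qed.

Lemma path_reach S x p : path (@link G) x p -> {subset x :: p <= S} -> reach S x (last x p).
Proof.
elim: p x => [|y p IH] x /=; first by move=> _ _; apply: reach0.
case/andP=> xy py sub; apply: (@reach_trans _ S y).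
  by apply: (reach1 _ _ xy); apply: sub; rewrite !inE eqxx ?orbT.
by apply: IH py _ => z zp; apply: sub; rewrite inE zp orbT.
Qed.

(** * Ears: adding a path to a biconnected set *)

Section Ear.
Variables (B : {set cell G}) (g g' : vert G) (q : seq (cell G)).
Hypotheses (bB : biconnected B) (gB : inl g \in B) (gB' : inl g' \in B).
Hypotheses (pq : path (@link G) (inl g) (rcons q (inl g'))).
Hypotheses (uq : uniq (inl g :: rcons q (inl g'))).

Let S := B :|: [set x in q].

(** A cell of the ear is joined to [B] by at least one of the two ends of the ear. *)
Lemma ear_del (W : {set cell G}) : (forall a b, a \in W -> b \in W -> a = b) ->
  connected (B :\: W) -> connected (S :\: W).
Proof.
move=> W1 /connectedP cB.
have sBS : B :\: W \subset S :\: W by apply: setSD; apply: subsetUl.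
have toB x : x \in S :\: W -> exists2 y, y \in B :\: W & reach (S :\: W) x y.
  move=> xS; move: (xS); rewrite inE => /andP[xW]; rewrite inE => /orP[xB|].
    by exists x; rewrite ?reach0 // inE xW.
  rewrite inE => xq.
  have subS : {subset inl g :: rcons q (inl g') <= S}.
    move=> z; rewrite inE mem_rcons inE => /or3P[/eqP->|/eqP->|zq]; rewrite inE ?gB ?gB' //.
    by rewrite inE zq orbT.
  move: pq uq subS; case/splitPr: xq => p1 p2; rewrite rcons_cat rcons_cons cat_path /=.
  set p2' := rcons p2 _ => /and3P[h1 h2 h3] u subS.
  have {}u : uniq ((inl g :: p1) ++ x :: p2') by exact: u.
  move: u; rewrite cat_uniq => /and3P[_ /hasPn dj _].
  have [/hasP[w wp wW]|/hasPn nW] := boolP (has (mem W) (inl g :: p1)).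
    have nW' z : z \in x :: p2' -> z \notin W.
      by move=> /dj zx; apply: contra zx => zW; rewrite /= (W1 z w).
    exists (inl g').
      by rewrite inE gB' andbT nW' // inE mem_rcons inE eqxx orbT.
    rewrite -(last_rcons x p2 (inl g')); apply: path_reach => // z zx.
    by rewrite in_setD nW' //=; apply: subS; rewrite -cat_cons mem_cat zx orbT.
  exists (inl g); first by rewrite inE gB andbT; apply: nW; rewrite inE eqxx.
  rewrite reach_sym; have -> : x = last (inl g) (rcons p1 x) by rewrite last_rcons.
  apply: path_reach; first by rewrite rcons_path h1.
  move=> z; rewrite inE mem_rcons inE orbCA => /orP[/eqP->|zp]; first exact: xS.
  have {}zp : z \in inl g :: p1 by rewrite inE.
  by rewrite in_setD (nW z zp); apply: subS; rewrite -cat_cons mem_cat zp.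
apply/connectedP=> x y /toB[x' x'B rx] /toB[y' y'B ry].
apply: reach_trans rx _; rewrite reach_sym; apply: reach_trans ry _.
by apply: (reachW sBS); apply: cB.
Qed.

(** A dart is linked to at most two cells, its partner and its vertex. The two neighbours of a dart
    on the ear are distinct because the path is simple, so they are exactly these cells. *)
Lemma ear_sub : subgraph S.
Proof.
have sB : subgraph B by case/and4P: bB.
apply/forallP=> d; apply/implyP; rewrite inE => /orP[dB|].
  rewrite in_setU (subgraph_flip sB dB); case e: (inc d) => [v|] //.
  by rewrite in_setU (subgraph_inc sB dB e).
rewrite inE => dq.
have subS : {subset inl g :: rcons q (inl g') <= S}.
  move=> z; rewrite inE mem_rcons inE => /or3P[/eqP->|/eqP->|zq]; rewrite inE ?gB ?gB' //.
  by rewrite inE zq orbT.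
move: pq uq subS; case/splitPr: dq => p1 p2; rewrite rcons_cat rcons_cons cat_path.
have [b [p3 ->]] : exists b p3, rcons p2 (inl g') = b :: p3.
  by case: p2 => [|b p2]; [exists (inl g'), [::]|exists b, (rcons p2 (inl g'))].
move=> /= /and4P[_ la lb _] u subS.
have aS : last (inl g) p1 \in S by apply: subS; rewrite -cat_cons mem_cat mem_last.
have bS : b \in S by apply: subS; rewrite !inE mem_cat !inE eqxx !orbT.
have ab : last (inl g) p1 != b.
  have : uniq ((inl g :: p1) ++ [:: inr d, b & p3]) by exact: u.
  rewrite cat_uniq => /and3P[_ /hasPn/(_ b) + _]; rewrite !inE eqxx orbT => /(_ isT).
  by apply: contraNneq => <-; rewrite -in_cons; apply: mem_last.
move: ab aS bS; rewrite link_sym in la.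
case/link_dartP: la => [->|[v e ->]]; case/link_dartP: lb => [->|[w f ->]].
- by rewrite eqxx.
- by move=> _ ->; rewrite f.
- by rewrite e => _ -> ->.
- by move: f; rewrite e => -[->]; rewrite eqxx.
Qed.

Lemma ear_biconnected : biconnected S.
Proof.
have [sB c2 cB aB] := and4P bB.
apply/and4P; split.
- exact: ear_sub.
- apply: leq_trans c2 _; apply: subset_leq_card; apply/subsetP=> v.
  by rewrite !inE => ->.
(* Connectedness is the case where the deleted set is empty; absence of articulations, below, is the
   case of a single vertex. *)
- by rewrite -[S]setD0; apply: ear_del; rewrite ?setD0 // => a b; rewrite inE.
- apply/forallP=> w; rewrite negb_and negbK; apply/orP; right.
  apply: ear_del; last exact: biconnected_del.
  by move=> a b /set1P-> /set1P->.
Qed.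

End Ear.

(** Two distinct attachment vertices would be the ends of a simple path outside [B], and adding this
    ear would contradict the maximality of [B]. A pendant edge has only one vertex. *)
Lemma ear B x g g' : block B -> att B x g -> att B x g' -> g = g'.
Proof.
case/block_cases => [mB|[d [v [h1 h2 ->]]]]; last first.
  move=> /att_in + /att_in; rewrite !inE /= !orbF.
  by move=> /eqP[->] /eqP[->].
move=> [d [gB dB] [dg rd]] [d' [gB' dB'] [dg' rd']].
apply/eqP; apply/negPn/negP=> ng.
have: reach (~: B) (inr d) (inr d') by apply: reach_trans rd _; rewrite reach_sym.
case/connectP => p0 pp0 lp0; case/shortenP: pp0 lp0 => p pp up _ lp.
have pB : {subset inr d :: p <= ~: B}.
  move=> z; rewrite inE => /orP[/eqP->|zp]; first by rewrite inE.
  elim: p (inr d) pp zp {up lp} => //= a p IH y /andP[/and3P[_ aB _] pp].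
  by rewrite inE => /orP[/eqP->//|]; apply: IH pp.
have pq : path (@link G) (inl g) (rcons (inr d :: p) (inl g')).
  rewrite /= dg eqxx /= rcons_path -lp /= dg' eqxx andbT.
  by apply: sub_path pp => a b /and3P[].
have uq : uniq (inl g :: rcons (inr d :: p) (inl g')).
  rewrite cons_uniq rcons_uniq up andbT mem_rcons inE negb_or (inj_eq (@inl_inj _ _)) ng /=.
  by apply/andP; split; apply/negP=> /pB; rewrite !inE ?gB ?gB'.
have bS := ear_biconnected (maxsetp mB) gB gB' pq uq.
have := maxsetsup mB bS (subsetUl _ _) => /setP/(_ (inr d)).
by rewrite !inE eqxx orbT (negPf dB).
Qed.

(** By [ear], a step from this region into [B] could only lead to [u], which the walk avoids. *)
Lemma att_closed B u x y : block B -> inl u \in B -> att B x u -> reach (~: [set inl u]) x y ->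
  att B y u.
Proof.
move=> bB uB ax r; apply: (@reach_ind _ _ (fun z => att B z u) x y _ r) => //.
move=> a b aa _ bu l.
have aB := att_notin aa; case: (boolP (b \in B)) => bB'; last first.
  by apply: attW aa (reach1 _ _ l); rewrite inE.
have [g [d [eb ea e]]] := link_out (block_sub bB) bB' aB (etrans (link_sym _ _) l).
suff eg : g = u by move: bu; rewrite eb eg !inE eqxx.
apply: (ear bB _ aa); exists d; first by rewrite -ea -eb.
by split=> //; rewrite ea; apply: reach0.
Qed.

Lemma att_sep B u x y : block B -> att B x u -> y \in B -> ~~ reach (~: [set inl u]) x y.
Proof.
move=> bB ax yB; apply/negP=> r; have := att_notin (att_closed bB (att_in ax) ax r).
by rewrite yB.
Qed.

(** Maximality settles the biconnected case. A biconnected set has at least two vertices and no dart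
    without a vertex, so it neither contains nor is contained in a pendant edge. *)
Lemma block_max B B' : block B -> block B' -> B \subset B' -> B = B'.
Proof.
move=> bB bB'; case/block_cases: (bB') => [mB'|[d' [v' [h1' h2' eB']]]].
  case/block_cases: (bB) => [mB|[d [v [h1 h2 ->]]]] sBB';
    first exact/esym/(maxsetsup mB (maxsetp mB')).
  have [] := @biconnected_inc B' (flip d) (maxsetp mB'); last by rewrite h2.
  by apply: (subsetP sBB'); rewrite !inE eqxx !orbT.
case/block_cases: (bB) => [mB|[d [v [h1 h2 ->]]]] sBB'.
  have [w wB] := biconnected_two v' (maxsetp mB).
  by have := subsetP sBB' _ wB; rewrite eB' !inE /= orbF (inj_eq (@inl_inj _ _)) => ->.
have : inr d \in B' by apply: (subsetP sBB'); rewrite !inE eqxx orbT.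
rewrite eB' !inE /= => /orP[]/eqP[ed]; first by rewrite -ed; move: h1' h1; rewrite ed => -> [->].
by move: h1; rewrite ed h2'.
Qed.

(** [g] is the gate of [y] on [B]: [y] lies in [{g}] together with what hangs on [B] at [g]. *)
Definition gate B (y : {set cell G}) g :=
  inl g \in B /\ forall z, z \in y -> z = inl g \/ att B z g.

(** Some cell of [B'] lies outside [B] and hangs at a vertex [g]. Since [B'] stays connected without
    [g], the rest of [B'] hangs at [g] as well. *)
Lemma block_gate B B' : block B -> block B' -> B != B' -> exists g, gate B B' g.
Proof.
move=> bB bB' nBB'.
have [z zB' zB] : exists2 z, z \in B' & z \notin B.
  by apply/subsetPn; apply: contraNN nBB' => /(block_max bB' bB)->.
have [v vB] := block_vert bB.
have [g ag] : exists g, att B z g.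
  by apply: att_ex zB; [apply: block_sub|apply/set0Pn; exists (inl v)].
exists g; split; first exact: att_in ag.
move=> x xB'; case: (eqVneq x (inl g)) => [|xg]; [by left|right].
apply: (att_closed bB (att_in ag) ag).
apply: (block_reach bB' zB' xB' _ xg); by apply: contraNneq zB => ->; apply: att_in ag.
Qed.

End Blocks.

(** * The block-tree *)

Section Tree.
Variable G : graph.
Hypotheses (conn : connected [set: cell G]) (noloop : loopless G).
Implicit Types (S B K a b c : {set cell G}) (x y z : cell G) (u v w g : vert G) (d : dart G).

Lemma artic_nodeP a : reflect (exists2 u, articulation setT u & a = [set inl u]) (artic_node a).
Proof.
apply: (iffP existsP) => [[u /andP[h /eqP ->]]|[u h ->]]; first by exists u.
by exists u; rewrite h eqxx.
Qed.

Lemma articulationTE u : articulation setT u = ~~ connected (~: [set inl u : cell G]).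
Proof. by rewrite /articulation inE setTD. Qed.

Lemma articulation_sep u x y : x != inl u -> y != inl u -> ~~ reach (~: [set inl u]) x y ->
  articulation setT u.
Proof.
by move=> xu yu; rewrite articulationTE; apply: contra => /connectedP; apply; rewrite !inE.
Qed.

Lemma artic_not_block a : artic_node a -> block a = false.
Proof.
case/artic_nodeP=> u _ ->; apply/negP=> /(block_dart)[d].
by rewrite !inE.
Qed.

Lemma tree_adj_sym : symmetric (@tree_adj G).
Proof. by move=> a b; rewrite /tree_adj orbC. Qed.

Definition tree_conn m a b := connect (fun a b => [&& tree_adj a b, a != m & b != m]) a b.

Lemma tree_conn_sym m a b : tree_conn m a b = tree_conn m b a.
Proof.
apply: sym_connect_sym => {}a {}b; rewrite tree_adj_sym; congr (_ && _).
by rewrite andbC.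
Qed.

Lemma tree_conn_trans m b a c : tree_conn m a b -> tree_conn m b c -> tree_conn m a c.
Proof. exact: connect_trans. Qed.

Lemma tree_conn_artic m u b : articulation setT u -> block b -> inl u \in b -> m != [set inl u] ->
  m != b -> tree_conn m [set inl u] b.
Proof.
move=> au bb ub mu mb; apply: connect1; rewrite eq_sym mu eq_sym mb !andbT.
apply/orP; left; rewrite bb sub1set ub !andbT.
by apply/artic_nodeP; exists u.
Qed.

(** Consecutive nodes share a vertex other than [w], and a block stays connected when [w] is
    deleted; hence a walk in the block-tree becomes a walk in the graph. *)
Lemma tree_conn_del w a b z : tree_conn [set inl w] a b ->
  (forall x, x \in a -> x != inl w -> reach (~: [set inl w]) z x) ->
  (forall x, x \in b -> x != inl w -> reach (~: [set inl w]) z x).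
Proof.
move=> r; pose P a := forall x, x \in a -> x != inl w -> reach (~: [set inl w]) z x.
apply: (@connect_ind _ _ P _ _ _ r) => {r}a' b' Pa /and3P[+ aw bw].
case/orP=> /and3P[art blk sub]; last by move=> x xb; apply: Pa; apply: (subsetP sub).
case/artic_nodeP: art => v _ av x xb xw.
have va : inl v \in a' by rewrite av set11.
have vw : inl v != inl w :> cell G by apply: contraNneq aw; rewrite av => ->.
by apply: reach_trans (Pa _ va vw) (block_reach blk (subsetP sub _ va) xb vw xw).
Qed.

Lemma gate_uniq B z g g' : block B -> inl g \in B -> inl g' \in B ->
  z = inl g \/ att B z g -> z = inl g' \/ att B z g' -> g = g'.
Proof.
move=> bB gB gB' [->|h] [e|h'].
- by case: e.
- by have := att_notin h'; rewrite gB.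
- by have := att_notin h; rewrite e gB'.
- exact: (ear bB h h').
Qed.

Lemma block_ne B : block B -> B != set0.
Proof. by move=> /(block_vert)[v vB]; apply/set0Pn; exists (inl v). Qed.

Lemma node_gate B a : block B -> node a -> B != a -> exists g, gate B a g.
Proof.
move=> bB /orP[/artic_nodeP[v _ ->]|ba] nBa; last exact: block_gate.
case: (boolP (inl v \in B)) => vB.
  by exists v; split=> // z; rewrite inE => /eqP; left.
have [g ag] := att_ex conn (block_sub bB) (block_ne bB) vB.
by exists g; split=> [|z]; [apply: att_in ag|rewrite inE => /eqP->; right].
Qed.

(** Adjacent nodes share a vertex, and by [gate_uniq] a cell has only one gate, so the gate cannot
    change along the walk. *)
Lemma tree_conn_gate B a b g : block B -> tree_conn B a b -> gate B a g -> gate B b g.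
Proof.
move=> bB r; apply: (@connect_ind _ _ (fun a => gate B a g) _ _ _ r) => {r}{}a {}b.
move=> [gB ga] /and3P[+ aB bB'].
case/orP=> /and3P[art blk sub]; last first.
  by split=> // z zb; apply: ga; apply: (subsetP sub).
rewrite eq_sym in bB'.
have [g' [gB' gb]] := block_gate conn bB blk bB'.
case/artic_nodeP: art => v _ av.
have va : inl v \in a by rewrite av set11.
by rewrite (gate_uniq bB gB gB' (ga _ va) (gb _ (subsetP sub _ va))).
Qed.

(** An edge with two ends spans a biconnected set, which extends to a maximal one; a pendant edge is
    itself a block. The vertex [v] excludes a free edge, which would be the whole connected
    graph. *)
Lemma dart_block d v : exists2 B, block B & inr d \in B.
Proof.
have key d' u : inc d' = Some u -> exists2 B, block B & inr d' \in B.
  case e: (inc (flip d')) => [w|] eu; last first.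
    exists (inl u |: edge_cells d'); last by rewrite !inE eqxx orbT.
    by apply/orP; right; apply/(pendant_edgeP); exists d', u.
  have uw : u != w by apply: contraPneq e => <-; apply: noloop.
  pose S := [set inl u; inl w; inr d'; inr (flip d')] : {set cell G}.
  have inS x : x \in S = [|| x == inl u, x == inl w, x == inr d' | x == inr (flip d')].
    by rewrite !inE -!orbA.
  have sS : subgraph S.
    apply/forallP=> t; apply/implyP; rewrite !inS /= => /orP[]/eqP[->].
      by rewrite eu !inS !eqxx !orbT.
    by rewrite flipK e !inS !eqxx !orbT.
  have cd (z : vert G) : connected (S :\ inl z).
    have r1 : reach (S :\ inl z) (inr d') (inr (flip d')).
      by apply: reach_flip; rewrite in_setD1 inS eqxx ?orbT.
    apply: (@connected_from _ _ (inr d')) => x xS.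
    move: (xS); rewrite in_setD1 inS => /andP[_ /or4P[]/eqP ex]; rewrite ex.
    - by apply: reach_inc; rewrite // -?ex // in_setD1 inS eqxx ?orbT.
    - by apply: reach_trans r1 (reach_inc _ _ e); rewrite // -?ex // in_setD1 inS eqxx ?orbT.
    - exact: reach0.
    - exact: r1.
  have cS : connected S.
    have r1 : reach S (inr d') (inr (flip d')) by apply: reach_flip; rewrite inS eqxx ?orbT.
    apply: (@connected_from _ _ (inr d')) => x; rewrite inS => /or4P[]/eqP->.
    - by apply: reach_inc; rewrite // inS eqxx ?orbT.
    - by apply: reach_trans r1 (reach_inc _ _ e); rewrite // inS eqxx ?orbT.
    - exact: reach0.
    - exact: r1.
  have bS : biconnected S.
    apply/and4P; split=> //; last by apply/forallP=> z; rewrite negb_and negbK cd orbT.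
    have -> : verts S = [set u; w].
      by apply/setP=> z; rewrite in_verts inS !inE !(inj_eq (@inl_inj _ _)) /= !orbF.
    by rewrite cards2 uw.
  have [B mB sSB] := maxset_exists bS.
  by exists B; [rewrite /block mB|apply: (subsetP sSB); rewrite inS eqxx !orbT].
case e: (inc d) => [u|]; first exact: key e.
case f: (inc (flip d)) => [u|].
  have [B bB fB] := key _ _ f; exists B => //.
  by rewrite -(flipK d); apply: subgraph_flip fB; apply: block_sub.
suff : inl v \in edge_cells d by rewrite !inE.
apply: (@reach_ind _ _ (fun z => z \in edge_cells d) _ _ _ (reachT conn (inr d) (inl v))).
  move=> x y; rewrite !inE => /orP[]/eqP-> _ _ /link_dartP[->|[w]].
  - by rewrite eqxx orbT.
  - by rewrite e.
  - by rewrite flipK eqxx.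
  - by rewrite f.
by rewrite !inE eqxx.
Qed.

Lemma link_block (v0 : vert G) x y : link x y -> exists B, [/\ block B, x \in B & y \in B].
Proof.
have key d v : inc d = Some v -> exists B, [/\ block B, inr d \in B & inl v \in B].
  move=> e; have [B bB dB] := dart_block d v.
  by exists B; split=> //; apply: subgraph_inc e => //; apply: block_sub.
case: x => [v|d]; first by case/link_vertP=> d e ->; have [B []] := key _ _ e; exists B.
case/link_dartP=> [->|[v e ->]]; last exact: key.
have [B bB dB] := dart_block d v0; exists B; split=> //.
by apply: subgraph_flip => //; apply: block_sub.
Qed.

Lemma vert_dart v x : x != inl v -> exists d, inc d = Some v.
Proof.
move=> xv; have r := reachT conn (inl v) x.
have [|//|a [b [_ /eqP-> _ [_ _ /link_vertP[d e _]]]]] := @reach_exit _ _ (pred1 (inl v)) _ _ r.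
  by rewrite /= eqxx.
by exists d.
Qed.

Lemma cell_block v0 x : x != inl v0 -> exists2 B, block B & x \in B.
Proof.
case: x => [v|d] xv; last exact: dart_block.
have nv : inl v0 != inl v :> cell G by rewrite eq_sym.
have [d e] := vert_dart nv; have [B bB dB] := dart_block d v.
by exists B; rewrite // (subgraph_inc (block_sub bB) dB e).
Qed.

(** Only the gate of [B'] on [B] can be common to both. It separates a dart of [B] from a dart of
    [B'], hence is an articulation. *)
Lemma block_share B B' x : block B -> block B' -> B != B' -> x \in B -> x \in B' ->
  exists2 u, x = inl u & articulation setT u.
Proof.
move=> bB bB' nBB' xB xB'; have [g [gB gt]] := block_gate conn bB bB' nBB'.
case: (gt _ xB') => [xg|/att_notin]; last by rewrite xB.
exists g => //; have [d dB] := block_dart bB; have [d' dB'] := block_dart bB'.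
apply: (@articulation_sep g (inr d') (inr d)) => //.
by case: (gt _ dB') => // h; apply: att_sep h dB.
Qed.

Lemma tree_conn_share B B1 B2 x : block B -> block B1 -> block B2 -> x \in B1 -> x \in B2 ->
  x \notin B -> tree_conn B B1 B2.
Proof.
move=> bB bB1 bB2 x1 x2 xB; case: (eqVneq B1 B2) => [->|n12]; first exact: connect0.
have [u xu au] := block_share bB1 bB2 n12 x1 x2; move: xB x1 x2; rewrite xu => xB x1 x2.
have nu : B != [set inl u] by apply: contraNneq xB => ->; rewrite set11.
have n1 : B != B1 by apply: contraNneq xB => ->.
have n2 : B != B2 by apply: contraNneq xB => ->.
apply: (@tree_conn_trans _ [set inl u]); last exact: tree_conn_artic.
by rewrite tree_conn_sym; apply: tree_conn_artic.
Qed.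

(** A walk outside [B] from the attaching dart to [x] is followed block by block. Consecutive blocks
    share a cell outside [B], so the walk in the block-tree never passes through [B]. *)
Lemma tree_conn_hang B B' x u : block B -> att B x u -> block B' -> x \in B' ->
  articulation setT u /\ tree_conn B [set inl u] B'.
Proof.
move=> bB [d0 [uB dB] [du r]] bB' xB'.
have [B0 bB0 dB0] := dart_block d0 u.
have uB0 : inl u \in B0 by apply: subgraph_inc du => //; apply: block_sub.
have n0 : B != B0 by apply: contraNneq dB => ->.
have [_ [<-] au] := block_share bB bB0 n0 uB uB0; split=> //.
have nu : B != [set inl u] by apply: contraTneq bB => ->; rewrite artic_not_block //;
  apply/artic_nodeP; exists u.
apply: (@tree_conn_trans _ B0); first exact: tree_conn_artic.
suff h : forall B', block B' -> x \in B' -> tree_conn B B0 B' by apply: h.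
apply: (@reach_ind _ _ (fun x => forall B', block B' -> x \in B' -> tree_conn B B0 B') _ _ _ r).
  move=> x1 x2 IH x1B x2B l B2 bB2 x2B2.
  have [B3 [bB3 x13 x23]] := link_block u l.
  apply: (@tree_conn_trans _ B3); first exact: IH.
  by apply: tree_conn_share x23 x2B2 _ => //; move: x2B; rewrite inE.
by move=> B2 bB2 dB2; apply: tree_conn_share dB0 dB2 _.
Qed.

Lemma gate_tree_conn B a u : block B -> node a -> gate B a u ->
  a = [set inl u] \/ tree_conn B [set inl u] a.
Proof.
move=> bB /orP[/artic_nodeP[v av ->]|ba] [uB ga]; last first.
  have [d da] := block_dart ba; case: (ga _ da) => // ad.
  by right; case: (tree_conn_hang bB ad ba da).
case: (ga _ (set11 _)) => [[->]|h]; first by left.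
right; have nuv : inl u != inl v :> cell G.
  by apply: contraTneq uB => ->; apply: att_notin h.
have [B' bB' vB'] : exists2 B', block B' & inl v \in B'.
  by apply: (@cell_block u); rewrite eq_sym.
have [_ c1] := tree_conn_hang bB h bB' vB'.
apply: tree_conn_trans c1 _; rewrite tree_conn_sym; apply: tree_conn_artic => //.
  by apply: contraNneq (att_notin h) => ->; rewrite set11.
by apply: contraNneq (att_notin h) => ->.
Qed.

Lemma gate_tree_conn2 B a b u : block B -> node a -> node b -> gate B a u -> gate B b u ->
  a = b \/ tree_conn B a b.
Proof.
move=> bB na nb ga gb.
case: (gate_tree_conn bB na ga) => [->|h1]; case: (gate_tree_conn bB nb gb) => [->|h2].
- by left.
- by right.
- by right; rewrite tree_conn_sym.
- by right; apply: tree_conn_trans h2; rewrite tree_conn_sym.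
Qed.

Lemma gate_notin B a u x y : block B -> gate B a u -> x \in a -> x != inl u -> y \in B ->
  ~~ reach (~: [set inl u]) y x.
Proof.
move=> bB [uB ga] xa xu yB; rewrite reach_sym.
by case: (ga _ xa) => [e|h]; [rewrite e eqxx in xu|apply: att_sep h yB].
Qed.

(** Another block lies below [B] exactly when its gate on [B] differs from the gate [u] of [c]. The
    subtree thus becomes a component of the complement of [u], a form in which parts can be
    uncrossed. *)
Lemma subtree_block c B (below := [set a | (a == B) || ~~ tree_conn B c a]) :
  node c -> block B -> c != B -> exists u d,
  [/\ inr d \in B, \bigcup_(B' | block B' && (B' \in below)) B' =
    inl u |: component (~: [set inl u]) (inr d) &
    forall x, x \in c -> x \notin component (~: [set inl u]) (inr d)].
Proof.
move=> nc bB ncB; have [u gc] : exists u, gate B c u.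
  by apply: node_gate; rewrite // eq_sym.
have [uB cu] := gc; have [d dB] := block_dart bB; exists u, d; split=> //; last first.
  move=> x xc; rewrite in_component !inE; apply/negP=> /andP[xu r].
  by have := gate_notin bB gc xc xu dB; rewrite r.
have inK x : x \in B -> x != inl u -> reach (~: [set inl u]) (inr d) x.
  move=> xB xu; exact: (block_reach bB dB xB _ xu).
apply/setP=> x; rewrite in_setU1 in_component; apply/bigcupP/idP.
  case=> B' /andP[bB']; rewrite inE; case: (eqVneq B' B) => [->|nB'] /= h xB'.
    by case: eqVneq => //= xu; rewrite inK // !inE xu.
  rewrite eq_sym in nB'; have [g gB'] := block_gate conn bB bB' nB'.
  have gu : g != u.
    apply: contraNneq h => gu; rewrite gu in gB'.
    have ndB' : node B' by rewrite /node bB' orbT.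
    by have [->|//] := gate_tree_conn2 bB nc ndB' gc gB'; apply: connect0.
  case: gB' => gB /(_ x xB')[->|[e [_ eB] [eg r]]].
    have gu' : inl g != inl u :> cell G by rewrite (inj_eq (@inl_inj _ _)).
    by rewrite inK // !inE gu' orbT.
  have gu' : inl g != inl u :> cell G by rewrite (inj_eq (@inl_inj _ _)).
  have sB : ~: B \subset ~: [set inl u].
    by apply/subsetP=> z; rewrite !inE; apply: contraNneq => ->.
  have r1 : reach (~: [set inl u]) (inr d) x.
    apply: reach_trans (inK _ gB gu') _; apply: reach_trans (reachW sB r).
    by rewrite reach_sym; apply: reach_inc; rewrite ?inE.
  by rewrite r1 (reach_mem r1 _) ?orbT // !inE.
case/predU1P=> [->|/andP[xu r]].
  by exists B; rewrite ?bB // inE eqxx.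
case: (boolP (x \in B)) => xB; first by exists B; rewrite ?bB // inE eqxx.
have [g ag] := att_ex conn (block_sub bB) (block_ne bB) xB.
have [B' bB' xB'] : exists2 B', block B' & x \in B'.
  by apply: (@cell_block u); move: xu; rewrite !inE.
exists B' => //; rewrite bB' inE /=; apply/orP; right; apply/negP=> h.
have [_ /(_ x xB')] := tree_conn_gate bB h gc.
case=> [e|au]; first by move: xu; rewrite e !inE eqxx.
by have := att_sep bB au dB; rewrite reach_sym r.
Qed.

End Tree.

(** * Uniqueness of the center *)

Section Center.
Variable G : graph.
Hypotheses (conn : connected [set: cell G]) (noloop : loopless G).
Implicit Types (S B K a b c m : {set cell G}) (x z : cell G) (y : {set cell G}) (u v w g : vert G)
  (d : dart G).

Lemma path_tree_conn m c p : path (@tree_adj G) c p -> m \notin c :: p -> tree_conn m c (last c p).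
Proof.
elim: p c => [|a p IH] c /=; first by move=> _ _; apply: connect0.
case/andP=> ca pa; rewrite inE negb_or => /andP[mc ma].
apply: (@tree_conn_trans _ _ a); last exact: IH.
apply: connect1; rewrite ca eq_sym mc eq_sym.
by move: ma; rewrite inE negb_or => /andP[].
Qed.

Lemma tree_path_via m c p : path (@tree_adj G) c p -> c != m -> ~~ tree_conn m c (last c p) ->
  (exists q, [/\ path (@tree_adj G) c q, last c q = m & size q <= size p]) /\
  (exists q, [/\ path (@tree_adj G) m q, last m q = last c p & size q < size p]).
Proof.
move=> pp cm nc; have mp : m \in p.
  apply: contraNT nc => mp; apply: path_tree_conn => //.
  by rewrite inE negb_or eq_sym cm.
move: pp nc; case/splitPr: mp => p1 p2; rewrite cat_path last_cat /= => /and3P[h1 h2 h3] _.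
split; last by exists p2; rewrite size_cat /= addnS ltnS leq_addl.
exists (rcons p1 m); rewrite rcons_path h1 last_rcons size_rcons size_cat /= addnS ltnS leq_addr.
by split.
Qed.

Lemma tree_adj_artic a b : tree_adj a b -> artic_node b = ~~ artic_node a.
Proof.
case/orP=> /and3P[art blk _]; first by rewrite art; apply: contraTF blk => /artic_not_block->.
by rewrite art; case e: (artic_node a) => //; move/artic_not_block: e; rewrite blk.
Qed.

(** The block-tree is bipartite between articulations and blocks, so the length of a path has the
    parity given by the kinds of its ends. *)
Lemma tree_path_artic c p : path (@tree_adj G) c p ->
  artic_node (last c p) = artic_node c (+) odd (size p).
Proof.
elim: p c => [|a p IH] c /=; first by rewrite addbF.
by case/andP=> /tree_adj_artic e /IH->; rewrite e addNb addbN.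
Qed.

Lemma node_cell c v : node c -> c != [set inl v] -> exists2 x, x \in c & x != inl v.
Proof.
case/orP=> [/artic_nodeP[w _ ->]|/block_dart[d dc] _]; last by exists (inr d).
by move=> wv; exists (inl w); rewrite ?set11 //; apply: contraNneq wv => ->.
Qed.

(** A farthest node is a leaf, and the leaves of the block-tree are blocks. *)
Lemma ecc_pred c n : node c -> ecc_le c n -> artic_node c = ~~ odd n -> ecc_le c n.-1.
Proof.
case: n => [//|n] nc ec ac y ny; have [p [pp lp sp]] := ec y ny.
have ap := tree_path_artic pp.
move: sp; rewrite leq_eqVlt => /orP[/eqP sp|]; last by exists p.
have : artic_node y by rewrite -lp ap ac sp addNb addbb.
case/artic_nodeP=> v av yv.
case: (eqVneq c y) => [<-|cy]; first by exists [::].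
have [x0 x0c x0v] : exists2 x, x \in c & x != inl v by apply: node_cell; rewrite -?yv.
(* [y] is an articulation [v] at distance exactly [n.+1]. Some cell [x] lies beyond [v] as seen from
   [c], and a block [B] containing [v] leads there. *)
have [x xv nx] : exists2 x, x != inl v & ~~ reach (~: [set inl v]) x0 x.
  apply/exists_inP; rewrite articulationTE in av; apply: contraNT av.
  rewrite negb_exists_in => /forall_inP h; apply/connectedP=> a b; rewrite !inE => aS bS.
  apply: (@reach_trans _ _ x0); last by move/negPn: (h b bS).
  by rewrite reach_sym; move/negPn: (h a aS).
have ax : exists g, att [set inl v] x g.
  apply: att_ex => //; last by rewrite inE.
    by apply/forallP=> d; rewrite !inE.
  by apply/set0Pn; exists (inl v); rewrite set11.
have [g [d [gv dv] [eg r]]] := ax; move: gv; rewrite inE => /eqP[gv]; rewrite {}gv in eg ax.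
have [B bB dB] := dart_block conn noloop d v.
have nB : node B by rewrite /node bB orbT.
have [q [pq lq sq]] := ec B nB.
(* A path of length [n.+1] would, by parity, end in an articulation. The path to [B] is therefore
   shorter, and it passes through [y]. *)
have sn : size q <= n.
  move: sq; rewrite leq_eqVlt => /orP[/eqP sq|//]; have := tree_path_artic pq.
  rewrite lq sq ac addNb addbb => aB.
  by have := artic_not_block aB; rewrite bB.
have nBt : ~~ tree_conn y c (last c q).
  rewrite lq yv; apply: contra nx => tc.
  apply: reach_trans r; apply: (tree_conn_del tc) => //.
  move=> z zc zv; rewrite yv in cy.
  case/orP: nc => [/artic_nodeP[w _ ew]|bc].
    by move: x0c zc; rewrite ew => /set1P-> /set1P->; apply: reach0.
  exact: (block_reach bc x0c zc x0v zv).
have [[q1 [h1 h2 h3]] _] := tree_path_via pq cy nBt.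
by exists q1; split=> //; apply: leq_trans sn.
Qed.

(** Nodes of the same kind are not adjacent, so some node lies strictly between them. For blocks it
    is the gate of one on the other. For articulations [u], [u'] it is the block [B] leaving [u]
    towards [u'] if [B] contains [u'], and otherwise the gate of [u'] on [B]. *)
Lemma node_sep c c' : node c -> node c' -> c != c' -> artic_node c = artic_node c' ->
  exists m, [/\ node m, m != c, m != c' & forall y, ~~ (tree_conn m c y && tree_conn m c' y)].
Proof.
move=> nc nc' ncc' ac.
have sep m : ~~ tree_conn m c c' -> forall y, ~~ (tree_conn m c y && tree_conn m c' y).
  move=> h y; apply: contra h => /andP[h1 h2]; apply: tree_conn_trans h1 _.
  by rewrite tree_conn_sym.
have artm u : articulation setT u -> node [set inl u].
  by move=> au; apply/orP; left; apply/artic_nodeP; exists u.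
case: (boolP (artic_node c)) ac => [/artic_nodeP[u au cu] /esym/artic_nodeP[u' au' cu']|nac nac'];
  last first.
  have bc : block c by move: nc; rewrite /node (negPf nac).
  have bc' : block c' by move: nc'; rewrite /node -nac'.
  have [w [wc gc']] := block_gate conn bc bc' ncc'.
  have [d dc] := block_dart bc; have [d' dc'] := block_dart bc'.
  have ad' : att c (inr d') w by case: (gc' _ dc').
  have nr := att_sep bc ad' dc.
  have aw : articulation setT w by apply: (@articulation_sep _ w (inr d') (inr d)).
  have mb b : block b -> [set inl w] != b.
    move=> bb; apply: contraTneq bb => <-; rewrite artic_not_block //.
    by apply/artic_nodeP; exists w.
  exists [set inl w]; split; rewrite ?mb ?artm //; apply: sep.
  rewrite tree_conn_sym; apply: contra nr => tc; apply: (tree_conn_del tc) => //.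
  by move=> x xc' xw; apply: (block_reach bc' dc' xc').
have uu' : u != u' by apply: contraNneq ncc' => uu'; rewrite cu cu' uu'.
have iuu' : inl u != inl u' :> cell G by rewrite (inj_eq (@inl_inj _ _)).
have : exists g, att [set inl u] (inl u') g.
  apply: att_ex => //; last by rewrite inE eq_sym.
    by apply/forallP=> d; rewrite !inE.
  by apply/set0Pn; exists (inl u); rewrite set11.
case=> g [d [gv dv] [eg r]]; move: gv; rewrite inE => /eqP[gv]; rewrite {}gv in eg.
have [B bB dB] := dart_block conn noloop d u.
have uB : inl u \in B by apply: subgraph_inc eg => //; apply: block_sub.
have Bn v : articulation setT v -> B != [set inl v].
  by move=> av; apply: contraTneq bB => ->; rewrite artic_not_block //; apply/artic_nodeP; exists v.
case: (boolP (inl u' \in B)) => uB'.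
  exists B; split; rewrite ?cu ?cu' ?Bn // /node ?bB ?orbT //; rewrite -?cu -?cu';
    apply: (sep B); rewrite cu cu'.
  apply/negP=> tc.
  have gu : gate B [set inl u] u by split=> // z /set1P; left.
  have [_ /(_ (inl u') (set11 _))[[e]|h]] := tree_conn_gate conn bB tc gu.
    by rewrite e eqxx in uu'.
  by have := att_notin h; rewrite uB'.
have [g' ag] := att_ex conn (block_sub bB) (block_ne bB) uB'.
have gu : g' != u.
  apply: contraTneq r => gu; rewrite gu in ag; rewrite reach_sym.
  exact: att_sep ag dB.
have igu : inl g' != inl u :> cell G by rewrite (inj_eq (@inl_inj _ _)).
have igu' : inl g' != inl u' :> cell G by apply: contraTneq (att_in ag) => ->.
have nr := att_sep bB ag uB.
have ag' : articulation setT g' by apply: (@articulation_sep _ g' (inl u') (inl u));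
  rewrite // eq_sym.
have neq v : inl g' != inl v :> cell G -> [set inl g'] != [set inl v : cell G].
  by apply: contraNneq => /setP/(_ (inl g')); rewrite set11 inE => /esym/eqP ->.
exists [set inl g']; split; rewrite ?artm ?cu ?cu' ?neq //; rewrite -?cu -?cu'; apply: sep.
rewrite cu cu' tree_conn_sym; apply: contra nr => tc.
by apply: (tree_conn_del tc); rewrite ?set11 1?eq_sym // => x /set1P-> _; apply: reach0.
Qed.

(** Let [n] be the minimal eccentricity. By [ecc_pred] its parity fixes the kind of a center, so two
    centers would be of the same kind and a node [m] would lie strictly between them. Every node is
    separated by [m] from one of the centers, so [m] would have eccentricity at most [n.-1]. *)
Lemma tree_center_uniq c c' : tree_center c -> tree_center c' -> c = c'.
Proof.
case=> nc [n [en mn]] [nc' [n' [en' mn']]]; apply/eqP/negPn/negP=> cc'.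
have nn' : n = n' by apply/eqP; rewrite eqn_leq (mn c') // (mn' c).
rewrite -{n'}nn' in en' mn'.
have n0 : 0 < n.
  case: n en {mn en' mn'} => // en; have [p [_ lp]] := en c' nc'.
  by case: p lp => // lp; rewrite -lp eqxx in cc'.
have odd_artic a : node a -> ecc_le a n -> artic_node a = odd n.
  move=> na ea; apply: contraTeq n0 => h; rewrite -leqNgt.
  have h' : artic_node a = ~~ odd n by move: h; case: (artic_node a); case: (odd n).
  by have := mn a n.-1 na (ecc_pred na ea h'); case: (n) => // k; rewrite ltnn.
have [m [nm mc mc' sep]] : exists m, [/\ node m, m != c, m != c' &
    forall y, ~~ (tree_conn m c y && tree_conn m c' y)].
  by apply: node_sep; rewrite // !odd_artic.
suff /(mn m n.-1 nm) : ecc_le m n.-1 by rewrite -ltnS prednK // ltnn.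
move=> y ny.
have via a : node a -> m != a -> ecc_le a n -> ~~ tree_conn m a y ->
    exists p, [/\ path (@tree_adj G) m p, last m p = y & size p <= n.-1].
  move=> na ma ea; have [p [pp lp sp]] := ea y ny; rewrite -lp => nt.
  rewrite eq_sym in ma; have [_ [q [h1 h2 h3]]] := tree_path_via pp ma nt.
  by exists q; split=> //; rewrite -ltnS prednK //; apply: leq_trans h3 sp.
case: (boolP (tree_conn m c y)) (sep y) => [_ /=|h _]; last exact: (via c).
exact: (via c').
Qed.

End Center.

(** * Parts and atoms *)

Section BlockParts.
Variable R : rooted.
Notation G := (Defs.rgraph R).
Notation c := (center R).
Hypotheses (conn : connected [set: cell G]) (noloop : loopless G).
Implicit Types (S A B K a b : {set cell G}) (x y z : cell G) (u v w g : vert G) (d : dart G).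

Definition hanging u d : {set cell G} := component (~: [set inl u]) (inr d).

Definition hanging_part A := exists u d,
  [/\ A = inl u |: hanging u d, forall x, x \in c -> x \notin hanging u d, c != set0 &
      exists v, inl v \in hanging u d].

(** The first clause determines [A] from its center [u], so two stars with the same center
    coincide. *)
Definition star_part A := exists u,
  A = \bigcup_(B | block B && @in_subtree R [set inl u] B) B /\
  forall x, x \in A -> x = inl u \/
    exists d, [/\ inc d = Some u, inc (flip d) = None, x \in edge_cells d & edge_cells d \subset A].

Lemma in_hanging u d x : (x \in hanging u d) = (x != inl u) && reach (~: [set inl u]) (inr d) x.
Proof. by rewrite in_component !inE. Qed.

Lemma hanging_attach u d : exists2 e, inr e \in hanging u d & inc e = Some u.
Proof.
have r := reachT conn (inr d) (inl u).
have [||a [b [_ Pa Pb [_ _ l]]]] := @reach_exit _ _ (fun x => x \in hanging u d) _ _ r.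
- by rewrite in_hanging reach0.
- by rewrite in_hanging eqxx.
have bu : b = inl u.
  apply/eqP; apply: contraNT Pb => bu; rewrite in_hanging bu.
  move: Pa; rewrite in_hanging => /andP[au ra]; apply: reach_trans ra (reach1 _ _ l);
    by rewrite !inE.
rewrite bu link_sym in l; have [e ee ae] := link_vertP l.
by exists e => //; rewrite -ae.
Qed.

Lemma hanging_flip u d e : inr e \in hanging u d -> inr (flip e) \in hanging u d.
Proof.
rewrite !in_hanging /= => r; apply: reach_trans r _.
by apply: reach_flip; rewrite !inE.
Qed.

Lemma hanging_inc u d e v : inr e \in hanging u d -> inc e = Some v -> v != u ->
  inl v \in hanging u d.
Proof.
rewrite !in_hanging /= (inj_eq (@inl_inj _ _)) => r ev vu; rewrite vu; apply: reach_trans r _.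
by apply: reach_inc; rewrite // !inE ?(inj_eq (@inl_inj _ _)).
Qed.

Lemma hanging_pendant u d e : inc e = Some u -> inc (flip e) = None -> inr e \in hanging u d ->
  hanging u d = edge_cells e.
Proof.
move=> eu eN eK; apply/eqP; rewrite eqEsubset; apply/andP; split; last first.
  by apply/subsetP=> x; rewrite !inE => /orP[]/eqP->; rewrite -?in_hanging ?hanging_flip.
apply/subsetP=> x xK.
have r : reach (~: [set inl u]) (inr e) x.
  move: eK xK; rewrite !in_hanging => /andP[_ r1] /andP[_ r2].
  by apply: reach_trans r2; rewrite reach_sym.
apply: (@reach_ind _ _ (fun z => z \in edge_cells e) _ _ _ r); last by rewrite !inE eqxx.
move=> a b; rewrite !inE => /orP[]/eqP-> _ bu /link_dartP[be|[w ew bw]].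
- by rewrite be eqxx orbT.
- by move: bu; rewrite bw; move: ew; rewrite eu => -[->]; rewrite eqxx.
- by rewrite be flipK eqxx.
- by rewrite eN in ew.
Qed.

Lemma hanging_vert u d : ~~ pendant_edge (inl u |: hanging u d) -> exists v, inl v \in hanging u d.
Proof.
have [e eK eu] := hanging_attach u d.
case f: (inc (flip e)) => [w|] np.
  exists w; apply: (hanging_inc (hanging_flip eK)) => //.
  by apply: contraPneq f => ->; apply: noloop.
case/negP: np; apply/pendant_edgeP; exists e, u; split=> //.
by rewrite (hanging_pendant eu f eK).
Qed.

Lemma block_cover v0 d0 x : exists2 B, block B & x \in B.
Proof.
case: x => [v|d]; last exact: dart_block.
have [|d ed] := @vert_dart _ conn v (inr d0); first by [].
by have [B bB dB] := dart_block conn noloop d v; exists B;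
  rewrite // (subgraph_inc (block_sub bB) dB ed).
Qed.

Lemma pendant_block_inc B w : block B -> pendant_edge B -> inl w \in B ->
  exists d, [/\ inc d = Some w, inc (flip d) = None & B = inl w |: edge_cells d].
Proof.
move=> bB /pendant_edgeP[d [v [e f ->]]]; rewrite !inE /= orbF => /eqP[->].
by exists d.
Qed.

(** Otherwise [w] with its pendant edges would be closed under links, although the connected graph
    also contains [u]. *)
Lemma nonpendant_block_at w u : w != u -> exists B, [/\ block B, ~~ pendant_edge B & inl w \in B].
Proof.
move=> wu; pose X z := (z == inl w) || [exists d, [&& inc d == Some w,
  inc (flip d) == None & z \in edge_cells d]].
have [||a [b [_ Xa Xb [_ _ l]]]] := @reach_exit _ _ X _ _ (reachT conn (inl w) (inl u)).
- by rewrite /X eqxx.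
- rewrite /X negb_or (inj_eq (@inl_inj _ _)) eq_sym wu /=; apply/existsP=> -[d].
  by rewrite !inE !andbF.
case/orP: Xa => [/eqP aw|/existsP[d /and3P[/eqP e /eqP f]]]; last first.
  move=> H; case/negP: Xb; rewrite /X; move: l H; rewrite !inE => l /orP[]/eqP ea;
    rewrite {}ea in l.
    case/link_dartP: l => [->|[v ev ->]].
      by apply/orP; right; apply/existsP; exists d; rewrite e f !inE !eqxx orbT.
    by move: ev; rewrite e => -[->]; rewrite eqxx.
  case/link_dartP: l => [->|[v ev ->]].
    by apply/orP; right; apply/existsP; exists d; rewrite e f flipK !inE !eqxx.
  by move: ev; rewrite f.
rewrite {}aw in l; have [d ed bd] := link_vertP l.
have [B bB dB] := dart_block conn noloop d w.
exists B; split=> //; last by apply: subgraph_inc ed => //; apply: block_sub.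
apply/negP=> /pendant_edgeP[d' [v [e f eB]]]; move: dB; rewrite eB !inE /= => /orP[]/eqP[dd].
  case/negP: Xb; rewrite /X bd; apply/orP; right; apply/existsP; exists d.
  by rewrite ed eqxx dd f eqxx !inE eqxx.
by rewrite dd f in ed.
Qed.

Lemma tree_conn_center (m a : {set cell G}) : ~~ node c -> node a -> tree_conn m c a = false.
Proof.
move=> nc na; apply/negP; case/connectP=> -[|b p] /=; first by move=> _ ac; rewrite -ac na in nc.
case/andP=> /andP[l _] _ _; case/negP: nc; rewrite /node.
by case/orP: l => /and3P[h1 h2 _]; rewrite ?h1 ?h2 ?orbT.
Qed.

(** The nodes on the walk are reachable from [a] without [m], and [m'] is not among these. *)
Lemma tree_conn_other (m m' a b : {set cell G}) :
  ~~ tree_conn m a m' -> tree_conn m a b -> tree_conn m' a b.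
Proof.
move=> nam r; suff [] : tree_conn m a b /\ tree_conn m' a b by [].
apply: (@connect_ind _ _ (fun t => tree_conn m a t /\ tree_conn m' a t) _ _ _ r); last by split;
  apply: connect0.
move=> t t' [r1 r2] l; have lt : tree_conn m t t' by apply: connect1.
have r3 := tree_conn_trans r1 lt.
split=> //; apply: tree_conn_trans r2 _; apply: connect1; case/and3P: l => -> _ _ /=.
by apply/andP; split; apply: contraNneq nam => <-.
Qed.

Lemma part_in_atom A S : minset (@part R) A -> part S -> S \subset A -> S = A.
Proof. exact: minsetinf. Qed.

(** The subtree of a block gives a hanging part. Below an articulation, a block that is not a
    pendant edge would determine a part inside [A], so by minimality this part is [A]; if there is
    no such block, [A] is a star. If [c] is not a node, nothing is reached from [c] in the tree and
    every subtree is everything. *)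
Lemma block_atom_cases A : minset (@part R) A -> block_part A ->
  [\/ hanging_part A, star_part A | A = setT].
Proof.
move=> mA /existsP[x /and5P[nx nxc /eqP eA A0 npA]].
have [z zA] := set0Pn _ A0.
have [B0 bB0] : exists B0, block B0.
  by move: zA; rewrite eA => /bigcupP[B /andP[bB _] _]; exists B.
have [v0 v0B] := block_vert bB0; have [d0 d0B] := block_dart bB0.
case: (boolP (node c)) => nc; last first.
  apply: Or33; apply/setP=> y; rewrite inE eA; apply/bigcupP.
  have [B bB yB] := block_cover v0 d0 y; exists B; rewrite // bB /in_subtree.
  by rewrite -/(tree_conn x c B) tree_conn_center ?orbT // /node bB orbT.
have c0 : c != set0.
  case/orP: nc => [/artic_nodeP[w _ ->]|/(@block_ne _)//].
  by apply/set0Pn; exists (inl w); rewrite set11.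
have key B : block B -> c != B -> ~~ pendant_edge (\bigcup_(B' | block B' && @in_subtree R B B')
  B') ->
    hanging_part (\bigcup_(B' | block B' && @in_subtree R B B') B').
  move=> bB cB; have [u [d [dB]]] := subtree_block conn noloop nc bB cB.
  set S := \bigcup_(B' | _) _ => eS cK.
  have -> : \bigcup_(B' | block B' && @in_subtree R B B') B' = S.
    by apply: eq_bigl => B'; rewrite inE.
  rewrite eS => /hanging_vert hv; exists u, d; split=> //.
case/orP: (nx) => [ax|bx]; last first.
  have cx : c != x by move: nxc; rewrite bx /= eq_sym.
  by apply: Or31; rewrite eA; apply: key => //; rewrite -eA.
have nbx B : block B -> B != x by move=> bB; apply: contraTneq bB => ->; rewrite artic_not_block.
case: (pickP (fun B => [&& block B, in_subtree x B & ~~ pendant_edge B])) =>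
  [B /and3P[bB xB npB]|allp].
  have nBx := nbx _ bB; move: xB; rewrite /in_subtree (negPf nBx) /= => nxB.
  have cB : c != B by apply: contraNneq nxB => <-; apply: connect0.
  have sub : \bigcup_(B' | block B' && @in_subtree R B B') B' \subset A.
    rewrite eA; apply/bigcupsP=> B' /andP[bB' BB']; apply: bigcup_sup.
    rewrite bB' /in_subtree (negPf (nbx _ bB')) /=.
    case/orP: BB' => [/eqP->//|]; apply: contra => r; exact: (tree_conn_other nxB r).
  have BS : B \subset \bigcup_(B' | block B' && @in_subtree R B B') B'.
    by apply: bigcup_sup; rewrite bB /in_subtree eqxx.
  have npS : ~~ pendant_edge (\bigcup_(B' | block B' && @in_subtree R B B') B').
    apply: contra npB => pS.
    by rewrite (block_max bB _ BS) // /block pS orbT.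
  apply: Or31; rewrite -(part_in_atom mA _ sub); first exact: key.
  apply/or3P; apply: Or31; apply/existsP; exists B; apply/and5P; split=> //.
  - by rewrite /node bB orbT.
  - by rewrite bB eq_sym.
  - have [v vB] := block_vert bB; apply/set0Pn; exists (inl v); exact: (subsetP BS).
apply: Or32; have [u au xu] := artic_nodeP _ ax; exists u; rewrite -xu; split=> // y.
rewrite {1}eA => /bigcupP[P /andP[bP xP] yP].
have pP : pendant_edge P by move: (allp P); rewrite bP xP /= => /negbFE.
have [w wP] := block_vert bP; have [d [ew ef eP]] := pendant_block_inc bP pP wP.
suff wu : w = u.
  move: yP; rewrite eP in_setU1 wu => /orP[/eqP->|yd]; [by left|right].
  exists d; rewrite -wu; split=> //; rewrite eA; apply: subset_trans (bigcup_sup P _).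
    by rewrite eP; apply: subsetUr.
  by rewrite bP.
(* A pendant edge at another vertex [w] would share the articulation [w] with a block that is not a
   pendant edge, and this block would lie below [x] too. *)
apply/eqP; apply: contraT => wu.
have [B [bB npB wB]] := nonpendant_block_at wu.
have nBP : B != P by apply: contraNneq npB => ->.
have [_ [<-] aw] := block_share conn bB bP nBP wB wP.
have xw : x != [set inl w].
  by rewrite xu; apply: contraNneq wu => /setP/(_ (inl w)); rewrite set11 inE.
have := allp B; rewrite bB npB andbT /= /in_subtree (negPf (nbx _ bB)) /= => /negbFE r.
move: xP; rewrite /in_subtree (negPf (nbx _ bP)) /= => /negP[].
have cB : tree_conn x [set inl w] B by apply: tree_conn_artic; rewrite // eq_sym nbx.
have cP : tree_conn x [set inl w] P by apply: tree_conn_artic; rewrite // eq_sym nbx.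
apply: tree_conn_trans r _; apply: tree_conn_trans cP; by rewrite tree_conn_sym.
Qed.

End BlockParts.

(** * Proper parts as lobes of 2-cuts *)

Section ProperParts.
Variable R : rooted.
Notation G := (Defs.rgraph R).
Notation c := (center R).
Hypotheses (conn : connected [set: cell G]) (noloop : loopless G).
Implicit Types (S A B K a b : {set cell G}) (x z : cell G) (u v w g y : vert G) (d e : dart G).

Definition off u v : {set cell G} := ~: vcells [set u; v].

Lemma in_off u v x : (x \in off u v) = (x != inl u) && (x != inl v).
Proof.
case: x => [w|d]; rewrite inE ?inr_vcells // in_vcells !inE negb_or.
by rewrite !(inj_eq (@inl_inj _ _)).
Qed.

Lemma offC u v : off u v = off v u.
Proof. by apply/setP=> x; rewrite !in_off andbC. Qed.

Definition lobe u v y : {set cell G} := component (off u v) (inl y).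

Lemma lobeC u v y : lobe u v y = lobe v u y.
Proof. by rewrite /lobe offC. Qed.

Lemma in_lobe u v y x : (x \in lobe u v y) = [&& x != inl u,
  x != inl v & reach (off u v) (inl y) x].
Proof. by rewrite in_component in_off andbA. Qed.

(** A reformulation of [two_cut], with the degree conditions, in which two vertices of [B] are
    separated in the whole graph rather than only inside [B]; [two_cutP] shows that this is the
    same. *)
Record splitting B u v : Prop := Splitting {
  split_max : maxset (@biconnected G) B;
  split_neq : u != v;
  split_l : inl u \in B;
  split_r : inl v \in B;
  split_degl : 2 < degree_in B u;
  split_degr : 2 < degree_in B v;
  split_sep : exists y y', [/\ inl y \in B :&: off u v, inl y' \in B :&: off u v &
    ~~ reach (off u v) (inl y) (inl y')]
}.

Lemma splittingC B u v : splitting B u v -> splitting B v u.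
Proof.
by case=> h1 h2 h3 h4 h5 h6 h7; split; rewrite // 1?eq_sym // offC.
Qed.

Lemma split_block B u v : splitting B u v -> block B.
Proof. by case=> h _ _ _ _ _ _; rewrite /block h. Qed.

Lemma max_block B : maxset (@biconnected G) B -> block B.
Proof. by rewrite /block => ->. Qed.

Lemma setD_off B u v : B :\: vcells [set u; v] = B :&: off u v.
Proof. by rewrite setDE. Qed.

(** A walk avoiding [u] and [v] leaves and re-enters [B] through the same vertex. *)
Lemma reach_block B u v y x : block B -> inl y \in B :&: off u v -> x \in B ->
  reach (off u v) (inl y) x -> reach (B :&: off u v) (inl y) x.
Proof.
move=> bB yB xB r; have sB := block_sub bB.
(* Invariant of the walk: its current cell is joined to [y] inside [B], or hangs on [B] at a vertex
   that is. *)
pose P z := (z \in B /\ reach (B :&: off u v) (inl y) z) \/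
            exists2 g, att B z g & reach (B :&: off u v) (inl y) (inl g).
have : P x.
  apply: (@reach_ind _ _ P _ _ _ r); last first.
    by left; split; [move: yB; rewrite inE => /andP[]|apply: reach0].
  move=> a b Pa aO bO l; case: (boolP (b \in B)) => bB'; case: Pa => [[aB ra]|[g ag rg]].
  - left; split=> //; apply: reach_trans ra (reach1 _ _ l); by rewrite inE ?aB ?bB'.
  - left; split=> //; have [g' [d [eb ea e]]] := link_out sB bB' (att_notin ag) (etrans (link_sym _
      _) l).
    rewrite eb (ear bB (_ : att B a g') ag) //; exists d; first by rewrite -eb -ea (att_notin ag).
    by rewrite -ea; split=> //; apply: reach0.
  - right; have [g [d [ea eb e]]] := link_out sB aB bB' l.
    exists g; last by rewrite -ea.
    exists d; first by rewrite -eb -ea.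
    by rewrite eb; split=> //; apply: reach0.
  - right; exists g => //; have aB := att_notin ag; apply: attW ag (reach1 _ _ l); by rewrite inE.
by case=> [[]//|[g /att_notin]]; rewrite xB.
Qed.

Lemma reach_in_off B u v x z : reach (B :&: off u v) x z -> reach (off u v) x z.
Proof. by apply: reachW; apply: subsetIr. Qed.

Lemma two_cutP B u v : maxset (@biconnected G) B -> 2 < degree_in B u -> 2 < degree_in B v ->
  two_cut B u v <-> splitting B u v.
Proof.
move=> mB du dv; have bB := max_block mB; rewrite /two_cut setD_off; split.
  case/and4P=> uv uB vB /card_gt1P[C [C' []]].
  rewrite !inE => /andP[/imsetP[x xB ->] /set0Pn[y]].
  rewrite in_verts in_component => /andP[yB rxy].
  move=> /andP[/imsetP[x' xB' ->] /set0Pn[y']].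
  rewrite in_verts in_component => /andP[yB' rxy'] nCC.
  split=> //; exists y, y'; split=> //; apply: contra nCC => r.
  have {}r : reach (B :&: off u v) (inl y) (inl y').
    by apply: reach_block => //; move: yB'; rewrite inE => /andP[].
  have rxx : reach (B :&: off u v) x x'.
    by apply: reach_trans rxy (reach_trans r _); rewrite reach_sym.
  by rewrite (component_eq rxx).
case=> _ uv uB vB _ _ [y [y' [yB yB' nr]]]; rewrite uv uB vB /=; apply/card_gt1P.
exists (component (B :&: off u v) (inl y)), (component (B :&: off u v) (inl y')).
have vy w : inl w \in B :&: off u v -> component (B :&: off u v) (inl w) \in
    [set C in components (B :&: off u v) | verts C != set0].
  move=> wB; rewrite inE imset_f //=; apply/set0Pn; exists w.
  by rewrite in_verts in_component wB reach0.
split; rewrite ?vy //; apply: contra nr => /eqP/setP/(_ (inl y')).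
by rewrite !in_component reach0 yB' /= => /reach_in_off.
Qed.

(** [B] minus [v] is connected, and a walk there from [y] to [u] can leave the lobe only by stepping
    to [u]. *)
Lemma lobe_attach B u v y : block B -> inl u \in B -> inl v \in B -> u != v -> inl y \in B ->
  inl y \in off u v -> exists2 d, inr d \in lobe u v y & inc d = Some u.
Proof.
move=> bB uB vB uv yB yO.
have [yu yv] := andP (etrans (esym (in_off _ _ _)) yO).
have r : reach (B :\ inl v) (inl y) (inl u).
  move/connectedP: (block_del v bB); apply; rewrite !inE ?yB ?yv ?uB //.
  by rewrite (inj_eq (@inl_inj _ _)) uv.
have [||a [b [_ Pa Pb [_ bB' l]]]] := @reach_exit _ _ (fun x => x \in lobe u v y) _ _ r.
- by rewrite in_lobe yu yv reach0.
- by rewrite in_lobe eqxx.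
have bu : b = inl u.
  apply/eqP; apply: contraNT Pb => bu; move: Pa; rewrite !in_lobe => /and3P[au av ra].
  move: bB'; rewrite !inE => /andP[bv _]; rewrite bu bv /=.
  by apply: reach_trans ra (reach1 _ _ l); rewrite in_off ?au ?av ?bu ?bv.
rewrite bu link_sym in l; have [e ee ae] := link_vertP l.
by exists e => //; rewrite -ae.
Qed.

Lemma lobe_step u v y x z : x \in lobe u v y -> link x z -> z != inl u -> z != inl v ->
  z \in lobe u v y.
Proof.
rewrite !in_lobe => /and3P[xu xv r] l zu zv; rewrite zu zv /=.
by apply: reach_trans r (reach1 _ _ l); rewrite in_off ?xu ?zu.
Qed.

Lemma proper_partP A : proper_part A <-> exists B u v y,
  [/\ splitting B u v, inl y \in B :&: off u v, ~~ (verts c \subset verts (lobe u v y)) &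
      A = vcells [set u; v] :|: lobe u v y].
Proof.
split.
  case/existsP=> B /existsP[u /existsP[v /and5P[bB tc du dv /exists_inP[K]]]].
  case/imsetP=> z zO eK /and4P[/exists_inP[C /imsetP[x xB eC] sCK] /forallP nK nc /eqP eA].
  have mB : maxset (@biconnected G) B.
    case/block_cases: bB => // -[d [w [_ _ eB]]]; move: tc; rewrite eB => /and4P[uv].
    by rewrite !inE /= !orbF => /eqP[uw] /eqP[vw]; rewrite uw vw eqxx in uv.
  have sp := (two_cutP mB du dv).1 tc; rewrite setD_off in xB eC.
  have [xB1 xO] : x \in B /\ x \in off u v by move: xB; rewrite inE => /andP[].
  have xK : x \in K by apply: (subsetP sCK); rewrite eC in_component xB reach0.
  have eKx : K = component (off u v) x.
    by move: xK; rewrite eK in_component => /andP[_ /component_eq].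
  suff [y yB ry] : exists2 y, inl y \in B :&: off u v & reach (off u v) x (inl y).
    have eKy : lobe u v y = K by rewrite eKx (component_eq ry).
    by exists B, u, v, y; rewrite eKy.
  case: x xB xB1 xO xK eKx {sCK eC} => [y|d] xB xB1 xO xK eKx; first by exists y; rewrite ?reach0.
  have dO e : inr e \in off u v by rewrite in_off.
  have fB := subgraph_flip (block_sub bB) xB1.
  (* A component that meets [B] in a dart but in no vertex consists of that single edge, since both
     of its ends lie in the cut; this is excluded by [nK]. *)
  apply/exists_inP; apply: contraT; rewrite negb_exists_in => /forall_inP nv; case/negP: (nK d).
  rewrite eqEsubset; apply/andP; split; last first.
    apply/subsetP=> t; rewrite eKx !inE => /orP[]/eqP->; rewrite ?inr_vcells ?reach0 //=.
    by apply: reach_flip.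
  apply/subsetP=> t; rewrite eKx in_component => /andP[_ r].
  apply: (@reach_ind _ _ (fun t => t \in edge_cells d) _ _ _ r); last by rewrite !inE eqxx.
  move=> a b + _ bO; rewrite !inE => /orP[]/eqP-> /link_dartP[->|[w ew bw]].
  - by rewrite eqxx orbT.
  - have wB : inl w \in B :&: off u v.
      by rewrite in_setI -bw bO bw (subgraph_inc (block_sub bB) xB1 ew).
    by case/negP: (nv w wB); rewrite reach_inc // -bw.
  - by rewrite flipK eqxx.
  - have wB : inl w \in B :&: off u v.
      by rewrite in_setI -bw bO bw (subgraph_inc (block_sub bB) fB ew).
    case/negP: (nv w wB); apply: (@reach_trans _ _ (inr (flip d))); first exact: reach_flip.
    by apply: reach_inc; rewrite // -bw.
case=> B [u [v [y [sp yB nc ->]]]]; have [mB uv uB vB du dv _] := sp.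
apply/existsP; exists B; apply/existsP; exists u; apply/existsP; exists v.
rewrite (split_block sp) ((two_cutP mB du dv).2 sp) du dv /=.
have yO : inl y \in off u v by move: yB; rewrite inE => /andP[].
apply/exists_inP; exists (lobe u v y); first by apply: imset_f.
rewrite eqxx nc !andbT; apply/andP; split; last first.
  apply/forallP=> d; apply: contraTneq (_ : inl y \in lobe u v y) => [->|]; first by rewrite !inE.
  by rewrite in_component yO reach0.
apply/exists_inP; exists (component (B :&: off u v) (inl y)).
  by rewrite setD_off; apply: imset_f.
apply/subsetP=> t; rewrite !in_component => /andP[]; rewrite inE => /andP[_ ->].
exact: reach_in_off.
Qed.

End ProperParts.

(** * Uncrossing of overlapping parts *)

Section Disjoint.
Variable R : rooted.
Notation G := (Defs.rgraph R).
Notation c := (center R).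
Hypotheses (conn : connected [set: cell G]) (noloop : loopless G).
Implicit Types (S A B K a b : {set cell G}) (W : {set vert G}) (x z t : cell G) (u v w g y : vert
  G) (d e : dart G).
Notation atomic A := (minset (@part R) A).

Lemma dipoleP A : dipole A <-> exists u v, [/\ u != v, 1 < #|[set d | joins d u v]| &
  A = vcells [set u; v] :|: [set inr d | d in [pred d | joins d u v || joins d v u]]].
Proof.
split=> [/existsP[u /existsP[v /and3P[h1 h2 /eqP h3]]]|[u [v [h1 h2 h3]]]]; first by exists u, v.
by apply/existsP; exists u; apply/existsP; exists v; rewrite h1 h2 h3 eqxx.
Qed.

Lemma in_dipole u v d :
  (inr d \in vcells [set u; v] :|: [set inr d | d in [pred d | joins d u v || joins d v u]]) =
  joins d u v || joins d v u.
Proof. by rewrite in_setU inr_vcells /= mem_imset //; apply: inr_inj. Qed.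

Lemma in_dipole_vert u v w (D : pred (dart G)) :
  (inl w \in vcells [set u; v] :|: [set inr d | d in D]) = (w == u) || (w == v).
Proof.
rewrite in_setU in_vcells !inE; case: imsetP => [[]//|_]; by rewrite orbF.
Qed.

(** The properties common to a hanging component, with [W] its articulation, and to a lobe, with [W]
    its 2-cut; they allow stars and dipoles to be compared with both at once. *)
Record lobelike K W : Prop := Lobelike {
  lobe_border : forall x t, x \in K -> link x t -> t \in K \/ t \in vcells W;
  lobe_off : forall x, x \in K -> x \notin vcells W;
  lobe_conn : forall x t, x \in K -> t \in K -> reach K x t;
  lobe_vert : exists v, inl v \in K;
  lobe_touch : forall w, w \in W -> exists2 d, inr d \in K & inc d = Some w
}.

Lemma component_conn S s x t : x \in component S s -> t \in component S s ->
  reach (component S s) x t.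
Proof.
rewrite !in_component => /andP[xS rx] /andP[tS rt].
have r : reach S x t by apply: reach_trans rt; rewrite reach_sym.
apply: reach_into r => z rz; rewrite in_component (reach_mem rz xS).
exact: reach_trans rx rz.
Qed.

Lemma component_border S s x t : x \in component S s -> link x t -> t \in S ->
  t \in component S s.
Proof.
rewrite !in_component => /andP[xS rx] l tS; rewrite tS.
by apply: reach_trans rx (reach1 _ _ l).
Qed.

Lemma vcells1 u : vcells [set u] = [set inl u : cell G].
Proof. by rewrite /vcells imset_set1. Qed.

Lemma hanging_lobelike u d v : inl v \in hanging u d -> lobelike (hanging u d) [set u].
Proof.
move=> vK; split.
- move=> x t xK l; case: (boolP (t \in vcells [set u])) => tu; [by right|left].
  by apply: component_border xK l _; rewrite inE -vcells1.
- by move=> x; rewrite in_hanging vcells1 inE => /andP[].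
- exact: component_conn.
- by exists v.
- by move=> w /set1P->; apply: hanging_attach.
Qed.

Lemma lobe_lobelike B u v y : splitting B u v -> inl y \in B :&: off u v ->
  lobelike (lobe u v y) [set u; v].
Proof.
move=> sp yBO; have [yB yO] : inl y \in B /\ inl y \in off u v by move: yBO; rewrite inE => /andP[].
have [mB uv uB vB _ _ _] := sp; split.
- move=> x t xK l; case: (boolP (t \in vcells [set u; v])) => tu; [by right|left].
  by apply: component_border xK l _; rewrite inE.
- by move=> x; rewrite in_component inE => /andP[].
- exact: component_conn.
- by exists y; rewrite in_component yO reach0.
- move=> w; rewrite !inE => /orP[]/eqP->; first exact: (lobe_attach (split_block sp)).
  by rewrite lobeC; apply: (lobe_attach (split_block sp)); rewrite // 1?eq_sym // offC.
Qed.

Lemma lobelike_flip K W d : lobelike K W -> inr d \in K -> inr (flip d) \in K.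
Proof.
move=> lK dK; case: (lobe_border lK dK (_ : link (inr d) (inr (flip d)))) => //=.
by rewrite inr_vcells.
Qed.

Lemma lobelike_dart K W d v : lobelike K W -> inl v \in K -> inc d = Some v -> inr d \in K.
Proof.
move=> lK vK /eqP e; case: (lobe_border lK vK (e : link (inl v) (inr d))) => //.
by rewrite inr_vcells.
Qed.

Lemma lobelike_inc K W d v : lobelike K W -> inr d \in K -> inc d = Some v ->
  inl v \in vcells W :|: K.
Proof.
move=> lK dK /eqP e; rewrite inE orbC.
by case: (lobe_border lK dK (e : link (inr d) (inl v))) => ->; rewrite ?orbT.
Qed.

Lemma lobelike_end K W d : lobelike K W -> inr d \in K ->
  exists2 v, inl v \in K & inc d = Some v \/ inc (flip d) = Some v.
Proof.
move=> lK dK; have [v vK] := lobe_vert lK; have r := lobe_conn lK dK vK.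
have [||a [b [_ Pa Pb [aK bK l]]]] := @reach_exit _ _ (fun x => x \in edge_cells d) _ _ r.
- by rewrite !inE eqxx.
- by rewrite !inE.
move: Pa Pb; rewrite !inE => /orP[]/eqP ea; rewrite ea in l.
  case/link_dartP: l => [->|[w ew bw]]; first by rewrite eqxx orbT.
  by move=> _; exists w; [rewrite -bw|left].
case/link_dartP: l => [->|[w ew bw]]; first by rewrite flipK eqxx.
by move=> _; exists w; [rewrite -bw|right].
Qed.

(** One end of the common edge lies in [K], and all darts at a vertex of [K] belong to [K]; hence
    every edge of the dipole does. *)
Lemma lobelike_dipole K W A d : lobelike K W -> dipole A -> inr d \in K -> inr d \in A ->
  A \subset vcells W :|: K.
Proof.
move=> lK /dipoleP[u [v [uv _ ->]]] dK; rewrite in_dipole => jd.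
have fK := lobelike_flip lK dK.
have inuv w : w = u \/ w = v -> inl w \in vcells W :|: K.
  by case/orP: jd => /andP[/eqP e1 /eqP e2] [->|->];
    apply: lobelike_inc lK _ _; [exact: dK|exact: e1|exact: fK|exact: e2|exact: fK|exact: e2|exact:
      dK|exact: e1].
have [s sK es] := lobelike_end lK dK.
have suv : s = u \/ s = v.
  by case/orP: jd => /andP[/eqP e1 /eqP e2]; case: es; rewrite ?e1 ?e2 => -[->]; auto.
apply/subsetP=> -[w|e].
  by rewrite in_dipole_vert => /orP[]/eqP->; apply: inuv; auto.
rewrite in_dipole inE => je; apply/orP; right.
have [es'|es'] : inc e = Some s \/ inc (flip e) = Some s.
  by case: suv => ->; case/orP: je => /andP[/eqP e1 /eqP e2]; auto.
  exact: (lobelike_dart lK sK es').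
by rewrite -(flipK e); apply: (lobelike_flip lK (lobelike_dart lK sK es')).
Qed.

Lemma lobelike_self K W d v : lobelike K W -> inr d \in K -> inc d = Some v ->
  inc (flip d) = None -> inl v \in K.
Proof.
by move=> lK dK e1 e2; have [s sK] := lobelike_end lK dK; rewrite e1 e2 => -[]// [->].
Qed.

Lemma lobelike_star K W A d : lobelike K W -> star_part A -> inr d \in K -> inr d \in A ->
  A \subset vcells W :|: K.
Proof.
move=> lK [u [_ Au]] dK dA.
have uK : inl u \in K.
  case: (Au _ dA) => // -[e [e1 e2 + _]]; rewrite !inE => /orP[]/eqP[ed]; rewrite ed in dK.
    exact: (lobelike_self lK dK e1 e2).
  have := lobelike_flip lK dK; rewrite flipK => eK; exact: (lobelike_self lK eK e1 e2).
apply/subsetP=> x /Au[->|[e [e1 e2]]]; first by rewrite inE uK orbT.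
have eK := lobelike_dart lK uK e1.
by rewrite !inE => /orP[]/eqP->; rewrite ?eK ?(lobelike_flip lK eK) orbT.
Qed.

Lemma lobelike_subgraph K W : lobelike K W -> subgraph (vcells W :|: K).
Proof.
move=> lK; apply/forallP=> d; apply/implyP; rewrite in_setU inr_vcells /= => dK.
rewrite in_setU (lobelike_flip lK dK) orbT /=; case e: (inc d) => [v|] //.
exact: lobelike_inc e.
Qed.

Lemma lobelike_has_dart K W v : lobelike K W -> W != set0 -> inl v \in vcells W :|: K ->
  exists2 d, inr d \in vcells W :|: K & inc d = Some v.
Proof.
move=> lK /set0Pn[w wW]; have [e eK _] := lobe_touch lK wW.
rewrite in_setU in_vcells => /orP[vW|vK].
  by have [d dK ed] := lobe_touch lK vW; exists d; rewrite // inE dK orbT.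
have [|d ed] := @vert_dart _ conn v (inr e); first by [].
by exists d; rewrite // inE (lobelike_dart lK vK ed) orbT.
Qed.

(** The second lobe is connected and avoids both [u] and [v], so it cannot leave the component that
    it meets. *)
Lemma lobe_subset u v y u' v' y' x : x \in lobe u v y -> x \in lobe u' v' y' ->
  inl u \notin lobe u' v' y' -> inl v \notin lobe u' v' y' -> lobe u' v' y' \subset lobe u v y.
Proof.
move=> xK xL uL vL; apply/subsetP=> t tL.
have r : reach (lobe u' v' y') x t by apply: component_conn.
move: xK; rewrite in_lobe => /and3P[_ _ rx].
have sO : lobe u' v' y' \subset off u v.
  by apply/subsetP=> z zL; rewrite in_off; apply/andP; split; apply: contraTneq zL => ->.
move: (subsetP sO _ tL); rewrite in_off => /andP[tu tv].
by rewrite in_lobe tu tv /=; apply: reach_trans rx (reachW sO r).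
Qed.

Definition proper_desc A B u v y :=
  [/\ splitting B u v, inl y \in B :&: off u v, ~~ (verts c \subset verts (lobe u v y)) &
      A = vcells [set u; v] :|: lobe u v y].

Lemma verts_lobeS K S : K \subset S -> ~~ (verts c \subset verts S) -> ~~ (verts c \subset verts K).
Proof.
move=> sKS; apply: contra => /subset_trans; apply; apply/subsetP=> v.
by rewrite !in_verts; apply: (subsetP sKS).
Qed.

Lemma proper_descC A B u v y : proper_desc A B u v y -> proper_desc A B v u y.
Proof.
case=> sp yB nc ->; split; [exact: splittingC|by rewrite offC|by rewrite lobeC|].
by rewrite lobeC [[set v; u]]setUC.
Qed.

Lemma proper_desc_part A B u v y : proper_desc A B u v y -> part A.
Proof.
by move=> h; apply/or3P; apply: Or32; apply/proper_partP; exists B, u, v, y.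
Qed.

Lemma lobe_notl u v y : inl u \notin lobe u v y.
Proof. by rewrite in_lobe eqxx. Qed.

Lemma lobe_notr u v y : inl v \notin lobe u v y.
Proof. by rewrite in_lobe eqxx andbF. Qed.

(** By minimality, [A] does not contain another part [{u', v'} :|: lobe u' v' y']. *)
Lemma nested_lobe A B u v y B' u' v' y' : atomic A -> proper_desc A B u v y ->
  splitting B' u' v' -> inl y' \in B' :&: off u' v' -> inl u' \in lobe u v y ->
  inl u \in lobe u' v' y' \/ inl v \in lobe u' v' y'.
Proof.
move=> mA dA sp' yB' uK; have [sp yB nc eA] := dA.
have lK := lobe_lobelike sp yB; have lL := lobe_lobelike sp' yB'.
apply/orP; apply: contraT; rewrite negb_or => /andP[uL vL].
have [d dL ed] := lobe_touch lL (set21 u' v'); have dK := lobelike_dart lK uK ed.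
have sLK := lobe_subset dK dL uL vL.
have [d2 d2L ed2] := lobe_touch lL (set22 u' v').
have v'A : inl v' \in A by rewrite eA; apply: lobelike_inc lK (subsetP sLK _ d2L) ed2.
have dS : proper_desc (vcells [set u'; v'] :|: lobe u' v' y') B' u' v' y'.
  by split=> //; apply: verts_lobeS nc.
have sSA : vcells [set u'; v'] :|: lobe u' v' y' \subset A.
  apply/subsetP=> x; rewrite inE => /orP[|/(subsetP sLK) xK]; last by rewrite eA inE xK orbT.
  by case/imsetP=> w; rewrite !inE => /orP[]/eqP-> -> //; rewrite eA inE uK orbT.
have eS := part_in_atom mA (proper_desc_part dS) sSA.
(* If the inner part were all of [A], both [u] and [v] would have to be its boundary vertex [v'],
   since [u'] is interior to [A]. *)
have key w : w \in [set u; v] -> inl w \notin lobe u' v' y' -> inl w \notin lobe u v y -> w = v'.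
  move=> wU wL wK; have : inl w \in A by rewrite eA inE in_vcells wU.
  rewrite -eS inE in_vcells (negPf wL) orbF !inE => /orP[]/eqP // wu.
  by rewrite wu uK in wK.
have [_ uv _ _ _ _ _] := sp; case/eqP: uv.
by rewrite (key u) ?lobe_notl ?set21 // (key v) ?lobe_notr ?set22.
Qed.

Lemma sep_cases B u v y : splitting B u v ->
  exists2 y', inl y' \in B :&: off u v & ~~ reach (off u v) (inl y) (inl y').
Proof.
case=> _ _ _ _ _ _ [y1 [y2 [h1 h2 nr]]].
case: (boolP (reach (off u v) (inl y) (inl y1))) => r; last by exists y1.
by exists y2 => //; apply: contra nr => r2; apply: reach_trans r2; rewrite reach_sym.
Qed.

(** Two parallel edges would give a dipole inside [A], a part that misses [v]. *)
Lemma no_dipole_in_lobe A B u v y w : atomic A -> proper_desc A B u v y -> inl w \in lobe u v y ->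
  #|[set d | joins d w u]| <= 1.
Proof.
move=> mA [sp yB _ eA] wK; rewrite leqNgt; apply/negP=> c2.
have lK := lobe_lobelike sp yB; have [_ uv _ _ _ _ _] := sp.
have wu : w != u by apply: contraTneq wK => ->; apply: lobe_notl.
have wv : w != v by apply: contraTneq wK => ->; apply: lobe_notr.
pose S : {set cell G} := vcells [set w; u] :|: [set inr d | d in [pred d | joins d w u || joins d u
  w]].
have dS : dipole S by apply/dipoleP; exists w, u.
have [d] : exists d, d \in [set d | joins d w u] by apply/card_gt0P; apply: ltnW.
rewrite inE => jd; have dK : inr d \in lobe u v y.
  by case/andP: jd => /eqP e _; apply: lobelike_dart lK wK e.
have dinS : inr d \in S by rewrite in_dipole jd.
have sSA : S \subset A by rewrite eA; apply: lobelike_dipole lK dS dK dinS.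
have pS : part S by rewrite /part dS !orbT.
have := part_in_atom mA pS sSA => /setP/(_ (inl v)).
rewrite in_dipole_vert eA inE in_vcells set22 /= => /orP[]/eqP vw.
  by rewrite vw eqxx in wv.
by rewrite vw eqxx in uv.
Qed.

(** Every lobe of [u', v'] meets [{u, v}] by [nested_lobe], so [u] and [v] lie in different lobes.
    These cut the lobe of [u, v] into corners bounded by [u', u] and by [u', v].  A vertex of [B] in
    a corner yields a smaller part; if there is none, all edges of [B] at [u'] lead to [u] or [v],
    and since [u'] has degree at least 3 in [B] they contain a dipole. *)
Lemma uncrossed A B u v y u' v' : atomic A -> proper_desc A B u v y ->
  splitting B u' v' -> inl u' \notin lobe u v y.
Proof.
move=> mA dA sp'; apply/negP=> uK; have [sp yB nc eA] := dA.
have [mB uv uB vB du dv _] := sp; have [_ uv' uB' vB' du' _ _] := sp'.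
have bB := split_block sp.
have lK := lobe_lobelike sp yB.
have meet (z : vert G) : inl z \in B :&: off u' v' ->
  inl u \in lobe u' v' z \/ inl v \in lobe u' v' z.
  by move=> zB; apply: (nested_lobe mA dA sp' zB uK).
have nr : ~~ reach (off u' v') (inl u) (inl v) /\ (inl u \in off u' v') && (inl v \in off u' v').
  have [_ _ _ _ _ _ [y1 [y2 [h1 h2 h3]]]] := sp'.
  have same x : x \in lobe u' v' y1 -> x \in lobe u' v' y2 -> False.
    rewrite !in_lobe => /and3P[_ _ r1] /and3P[_ _ r2]; case/negP: h3.
    by apply: reach_trans r1 _; rewrite reach_sym.
  have inO x (z : vert G) : x \in lobe u' v' z -> x \in off u' v' by rewrite in_component =>
    /andP[].
  case: (meet _ h1) => m1; case: (meet _ h2) => m2.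
  - by case: (same _ m1 m2).
  - rewrite (inO _ _ m1) (inO _ _ m2); split=> //; apply/negP=> r; apply: (same (inl v)) => //.
    rewrite in_component (inO _ _ m2); move: m1; rewrite in_lobe => /and3P[_ _ r1].
    exact: reach_trans r.
  - rewrite (inO _ _ m1) (inO _ _ m2); split=> //; apply/negP=> r; apply: (same (inl u)) => //.
    rewrite in_component (inO _ _ m2); move: m1; rewrite in_lobe => /and3P[_ _ r1].
    by apply: reach_trans r1 _; rewrite reach_sym.
  - by case: (same _ m1 m2).
case: nr => nr /andP[uO' vO'].
(* Otherwise a second lobe of [u, v] avoids [u'] and [v'] and joins [u] to [v], although these lie
   in different lobes of [u', v']. *)
have v'K : inl v' \notin lobe u v y.
  apply/negP=> v'K; have [y2 y2B nry] := sep_cases y sp.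
  have dj x : x \in lobe u v y2 -> x \notin lobe u v y.
    rewrite !in_lobe => /and3P[-> -> r2] /=; apply: contra nry => r1.
    by apply: reach_trans r1 _; rewrite reach_sym.
  have l2 := lobe_lobelike sp y2B.
  have [d dK ed] := lobe_touch l2 (set21 u v); have [d2 d2K ed2] := lobe_touch l2 (set22 u v).
  case/negP: nr; apply: (@reach_trans _ _ (inr d)); first by rewrite reach_sym; apply: reach_inc;
    rewrite // in_off.
  apply: (@reach_trans _ _ (inr d2)); last by apply: reach_inc; rewrite // in_off.
  apply: (reachW _ (component_conn dK d2K)); apply/subsetP=> x /dj xK.
  by rewrite in_off; apply/andP; split; apply: contraNneq xK => ->.
(* Stated for a variable pair [u0, v0] in order to be used for [u, v] and for [v, u]. A vertex [z]
   of [B] in the corner at [u0] makes [u0, u'] a 2-cut of [B] whose lobe at [z] gives a part inside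
   [A] without [v0]. *)
have corner u0 v0 (z : vert G) : proper_desc A B u0 v0 y -> inl u' \in lobe u0 v0 y ->
    inl v' \notin lobe u0 v0 y -> inl v0 \in off u' v' ->
    ~~ reach (off u' v') (inl u0) (inl v0) -> inl z \in B -> z != u' ->
    inl z \in lobe u0 v0 y -> inl u0 \notin lobe u' v' z.
  move=> dA0 uK0 v'K0 vO0 nr0 zB zu zK; apply/negP=> u0L.
  have [sp0 y0B nc0 eA0] := dA0; have [_ uv0 uB0 vB0 du0 dv0 _] := sp0.
  have lK0 := lobe_lobelike sp0 y0B.
  (* A walk from [z] avoiding [u0] and [u'] also avoids [v'], which is outside the lobe. It cannot
     arrive at [v0], because [z] is on the side of [u0]. *)
  have sP : lobe u0 u' z \subset lobe u0 v0 y.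
    apply/subsetP=> x; rewrite in_component => /andP[_ r].
    suff [] : x \in lobe u0 v0 y /\ reach (off u' v') (inl z) x by [].
    apply: (@reach_ind _ _ (fun x => x \in lobe u0 v0 y /\ reach (off u' v') (inl z) x) _ _ _ r).
      move=> a b [aK ra] _ bO l; move: bO; rewrite in_off => /andP[bu bu'].
      have aO' : a \in off u' v'.
        apply: reach_mem ra _; rewrite in_off (inj_eq (@inl_inj _ _)) zu /=.
        by apply: contraNneq v'K0 => <-.
      case: (eqVneq b (inl v0)) => [bv|bv].
        case/negP: nr0; move: u0L; rewrite in_lobe => /and3P[_ _ ru].
        apply: (@reach_trans _ _ (inl z)); first by rewrite reach_sym.
        by apply: reach_trans ra (reach1 _ _ _); rewrite // -bv.
      have bK : b \in lobe u0 v0 y by apply: lobe_step l bu bv.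
      split=> //; apply: reach_trans ra (reach1 aO' _ l).
      by rewrite in_off bu'; apply: contraNneq v'K0 => <-.
    by split=> //; apply: reach0.
  have zu0 : inl z != inl u0 :> cell G by apply: contraTneq zK => ->; apply: lobe_notl.
  have v0u' : inl v0 != inl u' :> cell G by move: vO0; rewrite in_off => /andP[].
  have v0u0 : inl v0 != inl u0 :> cell G by rewrite (inj_eq (@inl_inj _ _)) eq_sym.
  have v0P : inl v0 \notin lobe u0 u' z by apply/negP=> /(subsetP sP);
    rewrite (negPf (lobe_notr _ _ _)).
  have zBO : inl z \in B :&: off u0 u' by rewrite inE zB in_off zu0 (inj_eq (@inl_inj _ _)) zu.
  have v0BO : inl v0 \in B :&: off u0 u' by rewrite inE vB0 in_off v0u0.
  have spP : splitting B u0 u'.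
    split=> //; first by apply: contraTneq uK0 => <-; apply: lobe_notl.
    exists z, v0; split=> //.
    by apply: contra v0P => r; rewrite in_component r andbT; move: v0BO; rewrite inE => /andP[].
  have dS : proper_desc (vcells [set u0; u'] :|: lobe u0 u' z) B u0 u' z.
    by split=> //; apply: verts_lobeS nc0.
  have sSA : vcells [set u0; u'] :|: lobe u0 u' z \subset A.
    rewrite eA0; apply/subsetP=> x; rewrite inE => /orP[|/(subsetP sP) xK];
      last by rewrite inE xK orbT.
    by case/imsetP=> w; rewrite !in_set2 => /orP[]/eqP-> ->;
      rewrite inE ?uK0 ?in_vcells ?set21 ?orbT.
  have := part_in_atom mA (proper_desc_part dS) sSA => /setP/(_ (inl v0)).
  move: v0u0 v0u'; rewrite !(inj_eq (@inl_inj _ _)) => /negPf n1 /negPf n2.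
  by rewrite eA0 in_setU [in RHS]in_setU (negPf v0P) !in_vcells set22 orbF in_set2 n1 n2.
have only (z : vert G) : inl z \in B -> inl z \in lobe u v y -> z = u'.
  move=> zB zK; apply/eqP; apply: contraT => zu.
  have zBO : inl z \in B :&: off u' v'.
    rewrite inE zB in_off (inj_eq (@inl_inj _ _)) zu /=.
    by apply: contraTneq zK => ->.
  have nu : inl u \notin lobe u' v' z by exact: (corner u v).
  have nv : inl v \notin lobe u' v' z.
    apply: (corner v u) => //; rewrite 1?[lobe v u y]lobeC //; first exact: proper_descC.
    by rewrite reach_sym.
  by case: (meet z zBO); rewrite ?(negPf nu) ?(negPf nv).
have c1 : #|[set d | joins d u' u]| <= 1 by apply: no_dipole_in_lobe dA uK.
have c2 : #|[set d | joins d u' v]| <= 1.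
  by apply: (no_dipole_in_lobe mA (proper_descC dA)); rewrite lobeC.
suff : degree_in B u' <= #|[set d | joins d u' u] :|: [set d | joins d u' v]|.
  move=> h; have := leq_trans du' (leq_trans h (leq_of_leqif (leq_card_setU _ _))).
  by rewrite ltnNge (leq_add c1 c2).
apply: subset_leq_card; apply/subsetP=> d; rewrite !inE => /andP[dB /eqP ed].
rewrite /joins ed eqxx /=.
have fB := subgraph_flip (block_sub bB) dB.
have [w ew] := biconnected_inc (maxsetp mB) fB.
have wB := subgraph_inc (block_sub bB) fB ew.
have fK := lobelike_flip lK (lobelike_dart lK uK ed).
have := lobelike_inc lK fK ew; rewrite in_setU in_vcells !in_set2 ew => /orP[/orP[]/eqP->|wK];
  rewrite ?eqxx ?orbT //.
by move: ew; rewrite (only w wB wK) => /noloop; rewrite flipK.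
Qed.

(** [B] hangs on [B'] at a gate [g]. If [g] is [u'] or [v'], no vertex of [B] is in a lobe of
    [u', v']. Otherwise [B] avoids both and lies in a single component, so one of two lobes misses
    [u] and [v]. Either way [nested_lobe] is contradicted. *)
Lemma foreign A B u v y B' u' v' : atomic A -> proper_desc A B u v y ->
  splitting B' u' v' -> B != B' -> inl u' \notin lobe u v y.
Proof.
move=> mA dA sp' nBB'; apply/negP=> uK; have [sp yB nc eA] := dA.
have [mB uv uB vB du dv _] := sp; have [_ uv' uB' vB' du' _ _] := sp'.
have bB := split_block sp; have bB' := split_block sp'.
rewrite eq_sym in nBB'; have [g [gB' gB]] := block_gate conn bB' bB nBB'.
suff [y' yB' [nu nv]] : exists2 y', inl y' \in B' :&: off u' v' &
    inl u \notin lobe u' v' y' /\ inl v \notin lobe u' v' y'.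
  by case: (nested_lobe mA dA sp' yB' uK); rewrite ?(negPf nu) ?(negPf nv).
case: (boolP (g \in [set u'; v'])) => gU.
  have [_ _ _ _ _ _ [y1 [_ [h1 _ _]]]] := sp'; exists y1 => //.
  have key w : inl w \in B -> inl w \notin lobe u' v' y1.
    move=> wB; apply/negP=> wL; case: (gB _ wB) => [[wg]|h].
      by have := lobe_off (lobe_lobelike sp' h1) wL; rewrite in_vcells wg gU.
    have y1B' : inl y1 \in B' by move: h1; rewrite inE => /andP[].
    have := att_sep bB' h y1B'; rewrite reach_sym => /negP; apply.
    move: wL; rewrite in_component => /andP[_]; apply: reachW.
    by rewrite setCS -vcells1; apply: imsetS; rewrite sub1set.
  by rewrite !key.
have BO : B \subset off u' v'.
  apply/subsetP=> x xB; rewrite in_off.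
  have key w : inl w \in B' -> w \in [set u'; v'] -> x != inl w.
    move=> wB' wU; apply: contraTneq xB => ->; apply/negP=> /gB[[wg]|/att_notin];
      last by rewrite wB'.
    by rewrite -wg wU in gU.
  by rewrite !key ?set21 ?set22.
have ruv : reach (off u' v') (inl u) (inl v).
  by apply: (reachW BO); move/connectedP: (block_conn bB); apply.
have [_ _ _ _ _ _ [y1 [y2 [h1 h2 nr]]]] := sp'.
have ex (z : vert G) : inl u \notin lobe u' v' z -> inl u \notin lobe u' v' z /\
  inl v \notin lobe u' v' z.
  move=> h; split=> //; apply: contra h; rewrite !in_component (subsetP BO _ uB) => /andP[_ r].
  by apply: reach_trans r _; rewrite reach_sym.
case: (boolP (inl u \in lobe u' v' y1)) => m1; last by exists y1 => //; apply: ex.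
exists y2 => //; apply: ex; apply: contra nr; move: m1;
  rewrite !in_component => /andP[_ r1] /andP[_ r2].
by apply: reach_trans r1 _; rewrite reach_sym.
Qed.

Lemma lobe_outside A B u v y B' u' v' : atomic A -> proper_desc A B u v y ->
  splitting B' u' v' -> inl u' \notin lobe u v y /\ inl v' \notin lobe u v y.
Proof.
move=> mA dA sp'; have sp'' := splittingC sp'.
case: (eqVneq B B') => [eB|nB]; last by split;
  [apply: (foreign mA dA sp')|apply: (foreign mA dA sp'')].
by rewrite -eB in sp' sp''; split; [apply: (uncrossed mA dA sp')|apply: (uncrossed mA dA sp'')].
Qed.

Lemma proper_proper A B u v y A' B' u' v' y' x : atomic A -> atomic A' ->
  proper_desc A B u v y -> proper_desc A' B' u' v' y' ->
  x \in lobe u v y -> x \in lobe u' v' y' -> A = A'.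
Proof.
move=> mA mA' dA dA' xK xL; have [sp yB nc eA] := dA; have [sp' yB' nc' eA'] := dA'.
have [u'K v'K] := lobe_outside mA dA sp'; have [uL vL] := lobe_outside mA' dA' sp.
have sLK := lobe_subset xK xL uL vL; have sKL := lobe_subset xL xK u'K v'K.
have lK := lobe_lobelike sp yB; have lL := lobe_lobelike sp' yB'.
have pA : part A by apply: minsetp mA.
apply: (part_in_atom mA' pA); rewrite eA eA'; apply/subsetP=> t; rewrite inE.
case/orP=> [/imsetP[w wU ->]|/(subsetP sKL) tL]; last by rewrite inE tL orbT.
by have [d dK ed] := lobe_touch lK wU; apply: lobelike_inc lL (subsetP sKL _ dK) ed.
Qed.

Lemma hanging_off u d x S : x \in hanging u d -> S \subset ~: [set inl u] ->
  forall t, reach S x t -> t \in S -> t \in hanging u d.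
Proof.
rewrite in_hanging => /andP[_ r] sS t rt tS; have := subsetP sS _ tS; rewrite !inE => tu.
by rewrite tu; apply: reach_trans r (reachW sS rt).
Qed.

(** If [B] meets the hanging component, all of [B] except possibly [w] lies in it, and [A'] is
    inside [A] unless [w] is in the lobe. If [B] does not meet it, the hanging component lies inside
    the lobe. *)
Lemma hanging_proper A w d A' B u v y x : atomic A -> atomic A' ->
  A = inl w |: hanging w d -> (forall x, x \in c -> x \notin hanging w d) ->
  (exists v, inl v \in hanging w d) ->
  proper_desc A' B u v y -> x \in hanging w d -> x \in lobe u v y -> A = A'.
Proof.
move=> mA mA' eA cK [v0 v0K] dA' xK xL; have [sp yB nc eA'] := dA'.
have [mB uv uB vB du dv _] := sp; have bB := split_block sp.
have lK := hanging_lobelike v0K; have lL := lobe_lobelike sp yB.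
have pA : part A by apply: minsetp mA. have pA' : part A' by apply: minsetp mA'.
have eA2 : A = vcells [set w] :|: hanging w d by rewrite vcells1.
have yB2 : inl y \in B by move: yB; rewrite inE => /andP[].
have nwL : inl w \notin lobe u v y -> lobe u v y \subset hanging w d.
  move=> wL; apply/subsetP=> t tL; apply: (@hanging_off _ _ x (lobe u v y)) => //.
    by apply/subsetP=> z zL; rewrite !inE; apply: contraTneq zL => ->.
  exact: component_conn.
case: (boolP [exists z in B, z \in hanging w d]) => [/exists_inP[z zB zK]|/exists_inPn nBK].
  have BK t : t \in B -> t != inl w -> t \in hanging w d.
    move=> tB tw; apply: (@hanging_off _ _ z (B :\ inl w)) => //.
    - by apply/subsetP=> s; rewrite !inE => /andP[].
    - move/connectedP: (block_del w bB); apply; rewrite in_setD1 ?tw //.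
      by move: zK; rewrite in_hanging => /andP[-> _].
    - by rewrite in_setD1 tw.
  have BA t : t \in B -> t \in A.
    by move=> tB; rewrite eA in_setU1; case: eqVneq => //= tw; apply: BK.
  case: (boolP (inl w \in lobe u v y)) => wL; last first.
    apply/esym/(part_in_atom mA pA'); rewrite eA'; apply/subsetP=> t; rewrite inE.
    case/orP=> [/imsetP[s]|/(subsetP (nwL wL)) tK]; last by rewrite eA in_setU1 tK orbT.
    by rewrite !inE => /orP[]/eqP-> ->; apply: BA.
  have [wu wv] : inl w != inl u :> cell G /\ inl w != inl v :> cell G.
    by split; apply: contraTneq wL => ->; rewrite ?lobe_notl ?lobe_notr.
  have uvK s : s \in [set u; v] -> inl s \in hanging w d.
    by rewrite in_set2 => /orP[]/eqP->; apply: BK; rewrite // eq_sym.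
  (* With [w] in the lobe and [u], [v] in the hanging component, the two sets are closed under links
     and cover the graph. The center avoids the first, so its vertices would all be in the lobe. *)
  have all t : t \in hanging w d \/ t \in lobe u v y.
    apply: (@reach_ind _ _ (fun t => t \in hanging w d \/ t \in lobe u v y) _ _ _ (reachT conn x
      t)); last by left.
    move=> a b [aK|aL] _ _ l.
      by case: (lobe_border lK aK l); [left|rewrite vcells1 => /set1P->; right].
    by case: (lobe_border lL aL l); [right|case/imsetP=> s sU ->; left; apply: uvK].
  case/negP: nc; apply/subsetP=> s; rewrite !in_verts => /cK sK.
  by case: (all (inl s)) => //; rewrite (negPf sK).
have wL : inl w \in lobe u v y.
  apply: contraT => /nwL/subsetP/(_ (inl y)); rewrite (negPf (nBK _ yB2)).
  by apply; rewrite in_component reach0 andbT; move: yB; rewrite inE => /andP[].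
have sKL : hanging w d \subset lobe u v y.
  apply/subsetP=> t tK; have tO : hanging w d \subset off u v.
    apply/subsetP=> s sK; rewrite in_off.
    by apply/andP; split; apply: contraTneq sK => ->; apply: nBK.
  have r := reachW tO (component_conn xK tK).
  by move: xL; rewrite !in_component (subsetP tO _ tK) => /andP[_ rx]; apply: reach_trans r.
apply: (part_in_atom mA' pA); rewrite eA' eA; apply/subsetP=> t.
by rewrite in_setU1 in_setU => /orP[/eqP->|/(subsetP sKL)->]; rewrite ?wL orbT.
Qed.

(** If each component contains the articulation of the other, they cover the graph and leave no room
    for the nonempty center. In the other cases one part contains the other. *)
Lemma hanging_hanging A w d A' w' d' x : atomic A -> atomic A' ->
  A = inl w |: hanging w d -> (forall x, x \in c -> x \notin hanging w d) ->
  (exists v, inl v \in hanging w d) ->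
  A' = inl w' |: hanging w' d' -> (forall x, x \in c -> x \notin hanging w' d') ->
  (exists v, inl v \in hanging w' d') -> c != set0 ->
  x \in hanging w d -> x \in hanging w' d' -> A = A'.
Proof.
move=> mA mA' eA cK [v vK] eA' cL [v' vL] /set0Pn[z zc] xK xL.
have lK := hanging_lobelike vK; have lL := hanging_lobelike vL.
have pA : part A by apply: minsetp mA. have pA' : part A' by apply: minsetp mA'.
have sub u e u' e' : x \in hanging u e -> x \in hanging u' e' -> inl u' \notin hanging u e ->
    hanging u e \subset hanging u' e'.
  move=> x1 x2 nu; apply/subsetP=> t tK; apply: (@hanging_off _ _ x (hanging u e)) => //.
    by apply/subsetP=> s sK; rewrite !inE; apply: contraTneq sK => ->.
  exact: component_conn.
case: (boolP (inl w' \in hanging w d)) => w'K; case: (boolP (inl w \in hanging w' d')) => wL.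
- have all t : t \in hanging w d \/ t \in hanging w' d'.
    apply: (@reach_ind _ _ (fun t => t \in hanging w d \/ t \in hanging w' d') _ _ _ (reachT conn x
      t)); last by left.
    move=> a b [aK|aL] _ _ l.
      by case: (lobe_border lK aK l); [left|rewrite vcells1 => /set1P->; right].
    by case: (lobe_border lL aL l); [right|rewrite vcells1 => /set1P->; left].
  by case: (all z) => h; [have := cK z zc|have := cL z zc]; rewrite h.
- have s := sub _ _ _ _ xL xK wL; apply/esym/(part_in_atom mA pA'); rewrite eA eA';
    apply/subsetP=> t.
  by rewrite !in_setU1 => /orP[/eqP->|/(subsetP s)->]; rewrite ?w'K orbT.
- have s := sub _ _ _ _ xK xL w'K; apply: (part_in_atom mA' pA); rewrite eA eA'; apply/subsetP=> t.
  by rewrite !in_setU1 => /orP[/eqP->|/(subsetP s)->]; rewrite ?wL orbT.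
have s := sub _ _ _ _ xK xL w'K.
have [e eK ew] := hanging_attach conn w d.
have : inl w \in inl w' |: hanging w' d'.
  by rewrite -vcells1; apply: lobelike_inc lL (subsetP s _ eK) ew.
rewrite in_setU1 (negPf wL) orbF => /eqP ww.
apply: (part_in_atom mA' pA); rewrite eA eA' ww; apply/subsetP=> t.
by rewrite !in_setU1 => /orP[/eqP->|/(subsetP s)->]; rewrite ?eqxx ?orbT.
Qed.

End Disjoint.

(** * Atoms and their boundaries *)

Section AtomFacts.
Variable R : rooted.
Notation G := (Defs.rgraph R).
Notation c := (center R).
Hypotheses (conn : connected [set: cell G]) (noloop : loopless G).
Implicit Types (S A B K a b : {set cell G}) (W : {set vert G}) (x z t : cell G) (u v w g y : vert
  G) (d e : dart G).
Notation atomic A := (minset (@part R) A).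

(** [AtomAll] only occurs when the center is not a node of the block-tree: the subtree of every node
    is then the whole tree. *)
Inductive atom_spec A : Prop :=
| AtomHanging u d of A = inl u |: hanging u d & (forall x, x \in c -> x \notin hanging u d) &
    c != set0 & (exists v, inl v \in hanging u d)
| AtomStar of star_part A
| AtomAll of A = setT & block_part A
| AtomProper B u v y of proper_desc A B u v y
| AtomDipole of dipole A.

Lemma atomP A : atomic A -> atom_spec A.
Proof.
move=> mA; have := minsetp mA; rewrite /part => /or3P[bA|/proper_partP[B [u [v [y h]]]]|];
  last exact: AtomDipole.
  case: (block_atom_cases conn noloop mA bA) => [[u [d [h1 h2 h3 h4]]]|h|h].
  - exact: AtomHanging h1 h2 h3 h4.
  - exact: AtomStar.
  - exact: AtomAll.
exact: AtomProper h.
Qed.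

Lemma dipole_uniq A A' d : dipole A -> dipole A' -> inr d \in A -> inr d \in A' -> A = A'.
Proof.
move=> /dipoleP[u [v [uv _ ->]]] /dipoleP[u' [v' [uv' _ ->]]]; rewrite !in_dipole.
have swap : vcells [set v; u] :|: [set inr d | d in [pred d | joins d v u || joins d u v]] =
    vcells [set u; v] :|: [set inr d | d in [pred d | joins d u v || joins d v u]] :> {set cell G}.
  by rewrite [[set v; u]]setUC; congr (_ :|: _); apply/setP=> x; apply/imsetP/imsetP=> -[e];
    by rewrite inE orbC => je ->; exists e.
by case/orP=> /andP[/eqP e1 /eqP e2]; rewrite /joins e1 e2;
  case/orP=> /andP[/eqP[<-] /eqP[<-]]; rewrite // swap.
Qed.

Lemma star_uniq A A' d : star_part A -> star_part A' -> inr d \in A -> inr d \in A' -> A = A'.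
Proof.
move=> [u [eA Au]] [u' [eA' Au']] dA dA'.
suff uu : u = u' by rewrite eA eA' uu.
have [//|[e [e1 e2 ed _]]] := Au _ dA; have [//|[e' [e1' e2' ed' _]]] := Au' _ dA'.
move: ed ed'; rewrite !inE => /orP[]/eqP[->] /orP[]/eqP[ee].
- by move: e1; rewrite ee e1' => -[].
- by move: e1; rewrite ee e2'.
- by move: e2; rewrite ee e1'.
- by move/(can_inj (@flipK _)): ee => ee; move: e1; rewrite ee e1' => -[].
Qed.

Lemma star_dipole A A' d : star_part A -> dipole A' -> inr d \in A -> inr d \in A' -> False.
Proof.
move=> [u [eA Au]] /dipoleP[u' [v [_ _ ->]]] dA; rewrite in_dipole.
have [//|[e [e1 e2 ed _]]] := Au _ dA; move: ed; rewrite !inE /joins => /orP[]/eqP[->].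
  by rewrite e2 !andbF.
by rewrite e2.
Qed.

(** By minimality one inclusion suffices. Stars and dipoles lie inside any lobelike part that shares
    a dart with them, two lobelike parts are uncrossed, and an atom equal to the whole graph
    contains every other. *)
Lemma atom_dart_uniq A A' d : atomic A -> atomic A' -> inr d \in A -> inr d \in A' -> A = A'.
Proof.
move=> mA mA' dA dA'; have pA := minsetp mA; have pA' := minsetp mA'.
have sub1 : A \subset A' -> A = A' by apply: part_in_atom mA' pA.
have sub2 : A' \subset A -> A = A' by move=> h; rewrite (part_in_atom mA pA' h).
have key K W B C : lobelike K W -> B = vcells W :|: K -> star_part C \/ dipole C ->
    inr d \in B -> inr d \in C -> C \subset B.
  move=> lK -> h; rewrite in_setU inr_vcells /= => dK dC.
  by case: h => h; [apply: lobelike_star h dK dC|apply: lobelike_dipole h dK dC].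
have inU u e : inr d \in inl u |: hanging u e -> inr d \in hanging u e by rewrite in_setU1.
have inP u v y : inr d \in vcells [set u; v] :|: lobe u v y -> inr d \in lobe u v y.
  by rewrite in_setU inr_vcells.
have hk u e B C : B = inl u |: hanging u e -> (exists v, inl v \in hanging u e) ->
    star_part C \/ dipole C -> inr d \in B -> inr d \in C -> C \subset B.
  by move=> eB [v hv]; apply: key (hanging_lobelike conn hv) _; rewrite vcells1.
have pk B0 u v y B C : proper_desc B B0 u v y ->
    star_part C \/ dipole C -> inr d \in B -> inr d \in C -> C \subset B.
  by case=> sp yB _ eB; apply: key (lobe_lobelike sp yB) eB.
case: (atomP mA) => [u e eA cK c0 hv|sA|eA _|B u v y dsc|sA];
  case: (atomP mA') => [u' e' eA' cK' c0' hv'|sA'|eA' _|B' u' v' y' dsc'|sA'];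
  try (by apply: sub1; rewrite eA' subsetT); try (by apply: sub2; rewrite eA subsetT).
- move: (dA) (dA'); rewrite {1}eA {1}eA' => /inU dK /inU dL.
  exact: (hanging_hanging conn mA mA' eA cK hv eA' cK' hv' c0 dK dL).
- by apply: sub2; apply: (hk _ _ _ _ eA hv) => //; left.
- have [_ _ _ eA'] := dsc'; move: (dA) (dA'); rewrite {1}eA {1}eA' => /inU dK /inP dL.
  exact: (hanging_proper conn mA mA' eA cK hv dsc' dK dL).
- by apply: sub2; apply: (hk _ _ _ _ eA hv) => //; right.
- by apply: sub1; apply: (hk _ _ _ _ eA' hv') => //; left.
- exact: star_uniq dA dA'.
- by apply: sub1; apply: (pk _ _ _ _ _ _ dsc') => //; left.
- by case: (star_dipole sA sA' dA dA').
- have [_ _ _ eA] := dsc; move: (dA) (dA'); rewrite {1}eA {1}eA' => /inP dK /inU dL.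
  exact/esym/(hanging_proper conn mA' mA eA' cK' hv' dsc dL dK).
- by apply: sub2; apply: (pk _ _ _ _ _ _ dsc) => //; left.
- have [_ _ _ eA] := dsc; have [_ _ _ eA'] := dsc'.
  move: (dA) (dA'); rewrite {1}eA {1}eA' => /inP dK /inP dL.
  exact: (proper_proper conn noloop mA mA' dsc dsc' dK dL).
- by apply: sub2; apply: (pk _ _ _ _ _ _ dsc) => //; right.
- by apply: sub1; apply: (hk _ _ _ _ eA' hv') => //; right.
- by case: (star_dipole sA' sA dA' dA).
- by apply: sub1; apply: (pk _ _ _ _ _ _ dsc') => //; right.
- exact: dipole_uniq dA dA'.
Qed.

Lemma bigcup_block_sub (P : pred {set cell G}) : subgraph (\bigcup_(B | block B && P B) B).
Proof.
apply/forallP=> d; apply/implyP=> /bigcupP[B /andP[bB PB] dB]; have sB := block_sub bB.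
apply/andP; split; first by apply/bigcupP; exists B; rewrite ?bB ?PB ?(subgraph_flip sB dB).
case e: (inc d) => [v|] //; apply/bigcupP; exists B; rewrite ?bB ?PB //.
exact: subgraph_inc sB dB e.
Qed.

Lemma block_part_union A : block_part A -> exists P : pred {set cell G},
  A = \bigcup_(B | block B && P B) B.
Proof. by case/existsP=> x /and5P[_ _ /eqP-> _ _]; exists (in_subtree x). Qed.

Lemma atom_subgraph A : atomic A -> subgraph A.
Proof.
move=> mA; have := minsetp mA; rewrite /part =>
  /or3P[/block_part_union[P ->]|/proper_partP[B [u [v [y [sp yB _ ->]]]]]|].
- exact: bigcup_block_sub.
- exact: lobelike_subgraph (lobe_lobelike sp yB).
case/dipoleP=> u [v [_ _ ->]]; apply/forallP=> d; apply/implyP; rewrite !in_dipole => jd.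
have -> /= : joins (flip d) u v || joins (flip d) v u.
  by move: jd; rewrite /joins flipK orbC ![(inc (flip d) == _) && _]andbC.
case e: (inc d) => [w|] //; rewrite in_dipole_vert.
by move: jd; rewrite /joins e => /orP[]/andP[/eqP[->]]; rewrite eqxx ?orbT.
Qed.

Lemma atom_has_dart A v : atomic A -> inl v \in A -> exists2 d, inr d \in A & inc d = Some v.
Proof.
move=> mA; have := minsetp mA; rewrite /part =>
  /or3P[/block_part_union[P ->]|/proper_partP[B [u [w [y [sp yB _ ->]]]]]|].
- case/bigcupP=> B /andP[bB PB] vB; have [d dB ed] := block_vert_dart bB vB.
  by exists d => //; apply/bigcupP; exists B; rewrite ?bB ?PB.
- apply: (lobelike_has_dart conn (lobe_lobelike sp yB)).
  by apply/set0Pn; exists u; rewrite set21.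
case/dipoleP=> u [w [_ c2 ->]]; rewrite in_dipole_vert.
have [d] : exists d, d \in [set d | joins d u w] by apply/card_gt0P; apply: ltnW.
rewrite inE => jd /orP[]/eqP->; first by exists d; [rewrite in_dipole jd|case/andP: jd => /eqP].
exists (flip d); last by case/andP: jd => _ /eqP.
by rewrite in_dipole /joins flipK andbC -/(joins d u w) -[X in _ || X]andbC -/(joins d u w) jd orbT.
Qed.

Lemma boundary_in (A : atom R) v : v \in boundary A -> inl v \in val A.
Proof. by rewrite /boundary; case: ifP => _; rewrite inE // => /andP[]. Qed.

Lemma interior_dart (A : atom R) v d : inl v \in val A -> v \notin boundary A -> inc d = Some v ->
  inr d \in val A.
Proof.
move=> vA vb e; rewrite /boundary in vb; move: vb; case: ifP => _; rewrite inE vA //=.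
rewrite negb_or => /andP[_]; apply: contraNT => dA.
by apply/existsP; exists d; rewrite e eqxx.
Qed.

Lemma atom_eq (A A' : atom R) d : inr d \in val A -> inr d \in val A' -> A = A'.
Proof. move=> h h'; apply: val_inj; exact: atom_dart_uniq (valP A) (valP A') h h'. Qed.

(** All darts at an interior vertex of [A] belong to [A], while a vertex of [A'] has a dart in [A'];
    so an interior vertex would give a common dart. *)
Lemma shared_boundary (A A' : atom R) v : inl v \in val A -> inl v \in val A' -> A != A' ->
  v \in boundary A.
Proof.
move=> vA vA'; apply: contraNT => vb.
have [d dA' e] := atom_has_dart (valP A') vA'.
by apply/eqP/(atom_eq (interior_dart vA vb e) dA').
Qed.

Lemma lobelike_boundary (A : atom R) K W : lobelike K W -> val A = vcells W :|: K ->
  ~~ dipole (val A) -> (forall v, inl v \in K -> c != [set inl v]) -> boundary A \subset W.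
Proof.
move=> lK eA nd nc; apply/subsetP=> v; rewrite /boundary (negPf nd) inE eA in_setU in_vcells.
case: (v \in W) => //= /andP[vK]; rewrite (negPf (nc v vK)) /= => /existsP[d /andP[/eqP e]].
by rewrite in_setU (lobelike_dart lK vK e) orbT.
Qed.

(** The only candidate is the articulation of a hanging part or the center of a star. If the atom is
    everything, no dart lies outside it and only a vertex [v] with [c = [set inl v]] qualifies. *)
Lemma card_boundary_block (A : atom R) : block_atom A -> #|boundary A| <= 1.
Proof.
case/andP=> bA nd; case: (block_atom_cases conn noloop (valP A) bA) =>
  [[u [d [eA cK c0 [v hv]]]]|[u [eA Au]]|eA].
- have lK := hanging_lobelike conn hv.
  apply: leq_trans (subset_leq_card (lobelike_boundary lK _ nd _)) _; rewrite ?cards1 ?vcells1 //.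
  by move=> w wK; apply: contraTneq wK => cw; apply: cK; rewrite cw set11.
- apply: leq_trans (subset_leq_card (_ : boundary A \subset [set u])) _; last by rewrite cards1.
  apply/subsetP=> v /boundary_in /Au[[->]|[d [_ _]]]; first exact: set11.
  by rewrite !inE.
apply: leq_trans (_ : #|[set v | c == [set inl v]]| <= 1).
  apply/subset_leq_card/subsetP=> v; rewrite /boundary (negPf nd) eA !inE.
  by case/orP=> // /existsP[d]; rewrite inE andbF.
apply/card_le1_eqP => v w; rewrite !inE => /eqP-> /eqP/setP/(_ (inl v)).
by rewrite !inE eqxx (inj_eq (@inl_inj _ _)) => /esym/eqP.
Qed.

Lemma card_boundary (A : atom R) : #|boundary A| <= 2.
Proof.
case: (boolP (block_atom A)) => [/card_boundary_block h|]; first exact: leq_trans h _.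
rewrite negb_and negbK => h; have [dA|nd] := boolP (dipole (val A)).
  rewrite /boundary dA; case/dipoleP: dA => u [v [uv _ ->]].
  apply: leq_trans (subset_leq_card (_ : _ \subset [set u; v])) _; last by rewrite cards2;
    case: (u != v).
  by apply/subsetP=> w; rewrite in_verts in_dipole_vert !inE.
have := minsetp (valP A); rewrite /part; case/orP: h => [/negPf->|]; last by rewrite (negPf nd).
rewrite (negPf nd) orbF /= => /proper_partP[B [u [v [y [sp yB nc eA]]]]].
have lK := lobe_lobelike sp yB.
apply: leq_trans (subset_leq_card (lobelike_boundary lK eA nd _)) _; last by rewrite cards2;
  case: (u != v).
move=> w wK; apply: contraNneq nc => ->; apply/subsetP=> s; rewrite !in_verts inE => /eqP[->].
exact: wK.
Qed.

End AtomFacts.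

(** * Automorphisms *)

Local Open Scope group_scope.

Lemma preservesP (G H : graph) (fv : vert G -> vert H) (fd : dart G -> dart H) :
  reflect (forall d, [/\ inc (fd d) = omap fv (inc d), fd (flip d) = flip (fd d),
    color (fd d) = color d, kind (fd d) = kind d & kind d = Directed -> fwd (fd d) = fwd d])
  (preserves fv fd).
Proof.
apply: (iffP forallP) => h d; have := h d.
  by case/and5P=> /eqP-> /eqP-> /eqP-> /eqP-> /implyP k; split=> // e; apply/eqP/k/eqP.
case=> -> -> -> -> k; rewrite !eqxx /=; apply/implyP=> /eqP e; exact/eqP/k.
Qed.

(** * The action of automorphisms on sets of cells *)

Section Equivariance.
Variable G : graph.
Implicit Types (S B K a b c : {set cell G}) (x y z : cell G) (u v w : vert G) (d e : dart G) (g h :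
  gperm G).

Definition cperm g x : cell G := match x with inl v => inl (g.1 v) | inr d => inr (g.2 d) end.
Definition move g S : {set cell G} := [set cperm g x | x in S].

Lemma cpermM g h x : cperm (g * h) x = cperm h (cperm g x).
Proof. by case: x => [v|d] /=; rewrite permM. Qed.

Lemma cperm1 x : cperm 1 x = x.
Proof. by case: x => [v|d] /=; rewrite perm1. Qed.

Lemma cpermK g : cancel (cperm g) (cperm g^-1).
Proof. by move=> x; rewrite -cpermM mulgV cperm1. Qed.

Lemma cpermKV g : cancel (cperm g^-1) (cperm g).
Proof. by move=> x; rewrite -cpermM mulVg cperm1. Qed.

Lemma cperm_inj g : injective (cperm g).
Proof. exact: can_inj (cpermK g). Qed.

Lemma mem_move g S x : (cperm g x \in move g S) = (x \in S).
Proof. exact: mem_imset (@cperm_inj g). Qed.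

Lemma in_move g S x : (x \in move g S) = (cperm g^-1 x \in S).
Proof. by rewrite -{1}(cpermKV g x) mem_move. Qed.

Lemma moveM g h S : move (g * h) S = move h (move g S).
Proof. by rewrite /move -imset_comp; apply: eq_imset => x; rewrite /= cpermM. Qed.

Lemma move1 S : move 1 S = S.
Proof. by apply/setP=> x; rewrite in_move invg1 cperm1. Qed.

Lemma moveK g : cancel (move g) (move g^-1).
Proof. by move=> S; rewrite -moveM mulgV move1. Qed.

Lemma moveKV g : cancel (move g^-1) (move g).
Proof. by move=> S; rewrite -moveM mulVg move1. Qed.

Lemma move_inj g : injective (move g).
Proof. exact: can_inj (moveK g). Qed.

Lemma moveS g S S' : (move g S \subset move g S') = (S \subset S').
Proof.
apply/subsetP/subsetP=> h x; first by move=> xS; rewrite -(mem_move g); apply: h; rewrite mem_move.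
by rewrite !in_move; apply: h.
Qed.

Lemma moveT g : move g setT = setT.
Proof. by apply/setP=> x; rewrite in_move !inE. Qed.

Lemma move_set1 g v : move g [set inl v] = [set inl (g.1 v)].
Proof. by rewrite /move imset_set1. Qed.

Lemma moveU g S S' : move g (S :|: S') = move g S :|: move g S'.
Proof. exact: imsetU. Qed.

Lemma moveC g S : move g (~: S) = ~: move g S.
Proof. by apply/setP=> x; rewrite in_setC !in_move in_setC. Qed.

Lemma moveI g S S' : move g (S :&: S') = move g S :&: move g S'.
Proof. by apply/setP=> x; rewrite in_setI !in_move in_setI. Qed.

Lemma moveD1 g S v : move g (S :\ inl v) = move g S :\ inl (g.1 v).
Proof.
apply/setP=> x; rewrite in_setD1 !in_move in_setD1; congr (~~ _ && _).
by rewrite -(inj_eq (@cperm_inj g)) cpermKV.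
Qed.

Lemma move_vcells g u v : move g (vcells [set u; v]) = vcells [set g.1 u; g.1 v].
Proof. by rewrite /vcells !imsetU1 !imset_set1 moveU !move_set1. Qed.

Variable g : gperm G.
Hypothesis gA : g \in Defs.Aut G.

Lemma autP d : [/\ inc (g.2 d) = omap g.1 (inc d), g.2 (flip d) = flip (g.2 d),
  color (g.2 d) = color d, kind (g.2 d) = kind d & kind d = Directed -> fwd (g.2 d) = fwd d].
Proof. by move: gA; rewrite inE => /preservesP/(_ d). Qed.

Lemma aut_inc d : inc (g.2 d) = omap g.1 (inc d). Proof. by case: (autP d). Qed.
Lemma aut_flip d : g.2 (flip d) = flip (g.2 d). Proof. by case: (autP d). Qed.

Lemma aut_incE d v : (inc (g.2 d) == Some (g.1 v)) = (inc d == Some v).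
Proof.
rewrite aut_inc; case: (inc d) => [w|] //=; apply/eqP/eqP=> -[]; first by move/perm_inj->.
by move->.
Qed.

Lemma link_cperm x y : link (cperm g x) (cperm g y) = link x y.
Proof.
by case: x => [u|d]; case: y => [v|e] //=; rewrite ?aut_incE // -aut_flip (inj_eq (@perm_inj _ _)).
Qed.

Lemma reach_move S x y : reach S x y -> reach (move g S) (cperm g x) (cperm g y).
Proof.
move=> r; apply: (@reach_ind _ _ (fun y => reach (move g S) (cperm g x) (cperm g y)) _ _ _ r);
  last exact: reach0.
by move=> a b ra aS bS l; apply: reach_trans ra (reach1 _ _ _); rewrite ?mem_move ?link_cperm.
Qed.

Lemma connected_move S : connected S -> connected (move g S).
Proof.
move/connectedP=> cS; apply/connectedP=> x y; rewrite !in_move => xS yS.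
by have := reach_move (cS _ _ xS yS); rewrite !cpermKV.
Qed.

Lemma subgraph_move S : subgraph S -> subgraph (move g S).
Proof.
move=> sS; apply/forallP=> e; rewrite -(permKV g.2 e); set d := (_ e).
apply/implyP; rewrite -[inr (g.2 d)]/(cperm g (inr d)) mem_move => dS.
rewrite -aut_flip -[inr (g.2 _)]/(cperm g (inr (flip d))) mem_move (subgraph_flip sS dS) aut_inc /=.
case e': (inc d) => [v|] //=; rewrite -[inl (g.1 _)]/(cperm g (inl v)) mem_move.
exact: subgraph_inc e'.
Qed.

Lemma edge_cells_move d : move g (edge_cells d) = edge_cells (g.2 d).
Proof. by rewrite /move /edge_cells imsetU1 imset_set1 /= aut_flip. Qed.

Lemma pendant_edge_move S : pendant_edge S -> pendant_edge (move g S).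
Proof.
case/pendant_edgeP=> d [v [e f ->]]; apply/pendant_edgeP; exists (g.2 d), (g.1 v).
by rewrite -aut_flip !aut_inc e f moveU edge_cells_move move_set1.
Qed.

Lemma card_verts_move S : #|verts (move g S)| = #|verts S|.
Proof.
rewrite -[RHS](card_imset _ (@perm_inj _ g.1)); congr #|pred_of_set _|; apply/setP=> v.
rewrite -(permKV g.1 v) mem_imset; last exact: perm_inj.
by rewrite !in_verts -[inl (g.1 _)]/(cperm g (inl _)) mem_move.
Qed.
End Equivariance.

Section Equivariance2.
Variable G : graph.
Implicit Types (S B K a b c : {set cell G}) (x y z : cell G) (u v w : vert G) (d e : dart G) (g h :
  gperm G).

(** One implication for all automorphisms gives the other by applying it to the inverse. *)
Lemma move_iff (P : {set cell G} -> bool) : (forall g S, g \in Defs.Aut G -> P S -> P (move g S)) ->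
  forall g S, g \in Defs.Aut G -> P (move g S) = P S.
Proof.
move=> h g S gA; apply/idP/idP => [PS|]; last exact: h.
by rewrite -(moveK g S); apply: h; rewrite ?groupV.
Qed.

Lemma connected_moveE g S : g \in Defs.Aut G -> connected (move g S) = connected S.
Proof. by apply: move_iff => {}g {}S gA; apply: connected_move. Qed.

Lemma biconnected_moveE g S : g \in Defs.Aut G -> biconnected (move g S) = biconnected S.
Proof.
apply: move_iff => {}g {}S gA /and4P[h1 h2 h3 /forallP h4]; apply/and4P; split.
- exact: subgraph_move.
- by rewrite card_verts_move.
- exact: connected_move.
apply/forallP=> v; rewrite -(permKV g.1 v); move: (h4 (g.1^-1 v)%g).
rewrite /articulation -moveD1 connected_moveE //.
by rewrite -[inl (g.1 _)]/(cperm g (inl _)) mem_move.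
Qed.

Lemma extremal_move (P : pred {set cell G}) g S : g \in Defs.Aut G ->
  (forall g S, g \in Defs.Aut G -> P (move g S) = P S) ->
  (maxset P S -> maxset P (move g S)) /\ (minset P S -> minset P (move g S)).
Proof.
move=> gA PE; split=> [/maxsetP|/minsetP] [PS mS]; [apply/maxsetP|apply/minsetP];
  split; rewrite ?PE // => S' PS' sS'; rewrite -(moveKV g S'); congr move; apply: mS;
  rewrite ?PE ?groupV // -(moveS g) moveKV //.
Qed.

Lemma block_moveE g S : g \in Defs.Aut G -> block (move g S) = block S.
Proof.
apply: move_iff => {}g {}S gA /orP[h|h]; apply/orP; [left|right; exact: pendant_edge_move].
by case: (extremal_move S gA biconnected_moveE) => m _; apply: m.
Qed.

Lemma articulationT_move g u : g \in Defs.Aut G -> articulation setT (g.1 u) = articulation setT u.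
Proof. by move=> gA; rewrite /articulation -[in LHS](moveT g) -moveD1 connected_moveE // moveT
  !inE. Qed.

Lemma artic_node_moveE g S : g \in Defs.Aut G -> artic_node (move g S) = artic_node S.
Proof.
apply: move_iff => {}g {}S gA /artic_nodeP[u au ->]; apply/artic_nodeP; exists (g.1 u).
  by rewrite articulationT_move.
exact: move_set1.
Qed.

Lemma node_moveE g S : g \in Defs.Aut G -> node (move g S) = node S.
Proof. by move=> gA; rewrite /node artic_node_moveE ?block_moveE. Qed.

Lemma tree_adj_moveE g a b : g \in Defs.Aut G -> tree_adj (move g a) (move g b) = tree_adj a b.
Proof. by move=> gA; rewrite /tree_adj !artic_node_moveE ?block_moveE ?moveS. Qed.

Lemma ecc_le_move g a n : g \in Defs.Aut G -> ecc_le a n -> ecc_le (move g a) n.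
Proof.
move=> gA ea y ny; have [|p [pp lp sp]] := ea (move g^-1 y); first by rewrite node_moveE ?groupV.
exists (map (move g) p); rewrite size_map last_map lp moveKV; split=> //.
by rewrite path_map; apply: sub_path pp => x z; rewrite /= tree_adj_moveE.
Qed.

Lemma tree_center_move g a : g \in Defs.Aut G -> tree_center a -> tree_center (move g a).
Proof.
move=> gA [na [n [en mn]]]; split; first by rewrite node_moveE.
by exists n; split=> //; apply: ecc_le_move.
Qed.

Lemma center_move g a : connected [set: cell G] -> loopless G -> g \in Defs.Aut G ->
  is_center a -> move g a = a.
Proof.
move=> conn noloop gA; rewrite /is_center; case: ifP => _ h.
  rewrite h; apply/setP=> -[v|d]; first by rewrite in_move /= !in_vcells !inE.
  by rewrite in_move /= !inr_vcells.
exact: tree_center_uniq conn noloop _ _ (tree_center_move gA h) h.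
Qed.
End Equivariance2.

(** * Automorphisms permute parts and atoms *)

Section PartMove.
Variable R : rooted.
Notation G := (Defs.rgraph R).
Notation c := (center R).
Implicit Types (S B K a b : {set cell G}) (x z : cell G) (u v w y : vert G) (d e : dart G) (g h :
  gperm G).

(** The center enters the definitions of block parts and proper parts, so these are transported only
    along automorphisms that fix it. *)
Definition rooted_aut g := (g \in Defs.Aut G) && (move g c == c).

Lemma in_subtree_move g a b : rooted_aut g -> in_subtree a b -> @in_subtree R (move g a) (move g b).
Proof.
case/andP=> gA /eqP gc; rewrite /in_subtree (inj_eq (@move_inj _ g)) => /orP[->//|].
move=> nr; apply/orP; right; apply: contra nr => r.
rewrite -(moveK g b) -{1}(moveK g c) gc.
apply: (@connect_ind _ _ (fun s => connect (fun a0 b0 => [&& tree_adj a0 b0,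
  a0 != a & b0 != a]) (move g^-1 c) (move g^-1 s)) _ _ _ r); last exact: connect0.
move=> z1 z2 h /and3P[l n1 n2]; apply: connect_trans h (connect1 _).
rewrite tree_adj_moveE ?groupV // l /= -{1}(moveK g a) (inj_eq (@move_inj _ _)) n1.
by rewrite -(moveK g a) (inj_eq (@move_inj _ _)) n2.
Qed.

Lemma rooted_autV g : rooted_aut g -> rooted_aut g^-1.
Proof. by case/andP=> gA /eqP gc; rewrite /rooted_aut groupV gA -{1}gc moveK eqxx. Qed.

Lemma in_subtree_moveE g a b : rooted_aut g -> @in_subtree R (move g a) (move g b) = in_subtree a b.
Proof.
move=> gR; apply/idP/idP; last exact: in_subtree_move.
by move/(in_subtree_move (rooted_autV gR)); rewrite !moveK.
Qed.

Lemma block_part_move g S : rooted_aut g -> block_part S -> @block_part R (move g S).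
Proof.
move=> gR; have [gA /eqP gc] := andP gR.
case/existsP=> x /and5P[h1 h2 /eqP h3 h4 h5]; apply/existsP; exists (move g x); apply/and5P; split.
- by rewrite node_moveE.
- by rewrite block_moveE // -{1}gc (inj_eq (@move_inj _ _)).
- apply/eqP/setP=> z; rewrite in_move h3; apply/bigcupP/bigcupP=> -[B /andP[bB sB] zB].
    by exists (move g B); rewrite ?in_move // block_moveE // bB in_subtree_moveE.
  exists (move g^-1 B); last by rewrite mem_move.
  by rewrite block_moveE ?groupV // bB -(in_subtree_moveE _ _ gR) moveKV.
- by case/set0Pn: h4 => z zS; apply/set0Pn; exists (cperm g z); rewrite mem_move.
- apply: contra h5 => h; rewrite -(moveK g S); apply: pendant_edge_move => //.
  by rewrite groupV.
Qed.

Lemma off_move g u v : move g (off u v) = @off R (g.1 u) (g.1 v).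
Proof. by rewrite /off moveC move_vcells. Qed.

Lemma component_move g S x : g \in Defs.Aut G ->
  move g (component S x) = component (move g S) (cperm g x).
Proof.
move=> gA; apply/setP=> z; rewrite in_move !in_component in_move; congr (_ && _).
apply/idP/idP => [/(reach_move gA)|]; first by rewrite cpermKV.
have gV : g^-1 \in Defs.Aut G by rewrite groupV.
by move/(reach_move gV); rewrite moveK cpermK.
Qed.

Lemma lobe_move g u v y : g \in Defs.Aut G -> move g (lobe u v y) = @lobe R (g.1 u) (g.1 v) (g.1 y).
Proof. by move=> gA; rewrite /lobe component_move // off_move. Qed.

Lemma degree_in_move g B u : g \in Defs.Aut G -> degree_in B u <= @degree_in R (move g B) (g.1 u).
Proof.
move=> gA; rewrite /degree_in -(card_imset _ (@perm_inj _ g.2)); apply/subset_leq_card/subsetP=> e.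
case/imsetP=> d; rewrite !inE => /andP[dB ed] ->; rewrite aut_incE // ed.
by rewrite -[inr _]/(cperm g (inr d)) mem_move dB.
Qed.

Lemma splitting_move g B u v : g \in Defs.Aut G -> splitting B u v ->
  @splitting R (move g B) (g.1 u) (g.1 v).
Proof.
move=> gA [h1 h2 h3 h4 h5 h6 [y [y' [h7 h8 h9]]]]; split.
- by case: (extremal_move B gA (@biconnected_moveE G)) => m _; apply: m.
- by rewrite (inj_eq (@perm_inj _ _)).
- by rewrite -[inl _]/(cperm g (inl u)) mem_move.
- by rewrite -[inl _]/(cperm g (inl v)) mem_move.
- exact: leq_trans h5 (degree_in_move _ _ gA).
- exact: leq_trans h6 (degree_in_move _ _ gA).
exists (g.1 y), (g.1 y'); rewrite -off_move -moveI.
rewrite -![inl (g.1 _)]/(cperm g (inl _)) !mem_move; split=> //.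
apply: contra h9 => /(reach_move (_ : g^-1 \in Defs.Aut G)); rewrite groupV => /(_ gA).
by rewrite moveK !cpermK.
Qed.

Lemma proper_part_move g S : rooted_aut g -> proper_part S -> @proper_part R (move g S).
Proof.
case/andP=> gA /eqP gc /proper_partP[B [u [v [y [h1 h2 h3 ->]]]]]; apply/proper_partP.
exists (move g B), (g.1 u), (g.1 v), (g.1 y); split.
- exact: splitting_move.
- by rewrite -off_move -moveI -[inl _]/(cperm g (inl y)) mem_move.
- apply: contra h3 => /subsetP h; apply/subsetP=> w; rewrite !in_verts => wc.
  have := h (g.1 w); rewrite !in_verts -gc -lobe_move // -[inl _]/(cperm g (inl w)) !mem_move.
  exact.
- by rewrite moveU move_vcells lobe_move.
Qed.

Lemma dipole_move g S : g \in Defs.Aut G -> dipole S -> dipole (move g S).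
Proof.
move=> gA /dipoleP[u [v [h1 h2 ->]]].
have jE d u' v' : joins (g.2 d) (g.1 u') (g.1 v') = joins d u' v'.
  by rewrite /joins -aut_flip // !aut_incE.
apply/dipoleP; exists (g.1 u), (g.1 v); split; first by rewrite (inj_eq (@perm_inj _ _)).
  apply: leq_trans h2 _; rewrite -(card_imset _ (@perm_inj _ g.2));
    apply/subset_leq_card/subsetP=> e.
  by case/imsetP=> d; rewrite !inE => jd ->; rewrite jE.
rewrite moveU move_vcells; congr (_ :|: _); apply/setP=> -[w|e].
  by rewrite in_move; apply/imsetP/imsetP=> -[].
rewrite in_move /= !mem_imset; try exact: inr_inj.
by rewrite !inE -{3 4}(permKV g.2 e) !jE.
Qed.

Lemma part_moveE g S : rooted_aut g -> @part R (move g S) = part S.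
Proof.
have key h S' : rooted_aut h -> part S' -> @part R (move h S').
  move=> hR; have [hA _] := andP hR; rewrite /part => /or3P[p|p|p].
  - by rewrite (block_part_move hR p).
  - by rewrite (proper_part_move hR p) orbT.
  - by rewrite (dipole_move hA p) !orbT.
move=> gR; apply/idP/idP; last exact: key.
by move/(key _ _ (rooted_autV gR)); rewrite moveK.
Qed.

Lemma atom_move g S : rooted_aut g -> minset (@part R) S -> minset (@part R) (move g S).
Proof.
move=> gR /minsetP[PS mS]; apply/minsetP; split; first by rewrite part_moveE.
move=> S' PS' sS'; rewrite -(moveKV g S'); congr move; apply: mS.
  by rewrite part_moveE ?rooted_autV.
by rewrite -(moveS g) moveKV.
Qed.

Lemma dipole_moveE g S : g \in Defs.Aut G -> dipole (move g S) = dipole S.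
Proof. by apply: (@move_iff G (@dipole R)) => {}g {}S; apply: dipole_move. Qed.

Lemma block_part_moveE g S : rooted_aut g -> @block_part R (move g S) = block_part S.
Proof.
move=> gR; apply/idP/idP; last exact: block_part_move.
by move/(block_part_move (rooted_autV gR)); rewrite moveK.
Qed.

Definition amove g (gR : rooted_aut g) (A : atom R) : atom R :=
  exist (fun S => is_true (minset (@part R) S)) (move g (val A)) (atom_move gR (valP A)).

Lemma boundary_amove g (gR : rooted_aut g) A v : (g.1 v \in boundary (amove gR A)) = (v \in
  boundary A).
Proof.
have [gA /eqP gc] := andP gR; rewrite /boundary /= dipole_moveE //; case: ifP => _; rewrite !inE.
  by rewrite -[inl _]/(cperm g (inl v)) mem_move.
rewrite -[inl (g.1 v)]/(cperm g (inl v)) mem_move /= -move_set1 -{1}gc (inj_eq (@move_inj _ _)).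
congr (_ && (_ || _)); apply/existsP/existsP=> -[d /andP[e dA]].
  exists (g.2^-1 d)%g; rewrite -(aut_incE gA) permKV e; move: dA.
  by rewrite in_move.
exists (g.2 d); rewrite aut_incE // e; rewrite -[inr _]/(cperm g (inr d)) mem_move //.
Qed.

End PartMove.

Definition sub_vert (G : graph) (S : {set cell G}) v (vS : inl v \in S) : vert (sub_graph S) :=
  exist (fun v => is_true (inl v \in S)) v vS.

Definition sub_dart (G : graph) (S : {set cell G}) d (dS : inr d \in S) : dart (sub_graph S) :=
  exist (fun d => is_true (inr d \in S)) d dS.

Section SubGraph.
Variables (G : graph) (S : {set cell G}).
Hypothesis sS : subgraph S.

Lemma sub_graph_inc (d : dart (sub_graph S)) : omap val (inc d) = inc (val d).
Proof.
rewrite /=; case e: (inc (val d)) => [v|] //=.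
by rewrite insubT ?(subgraph_inc sS (valP d) e).
Qed.

Lemma sub_graph_flip (d : dart (sub_graph S)) : val (flip d) = flip (val d).
Proof. by rewrite /= flip_onE (subgraph_flip sS (valP d)). Qed.
End SubGraph.

Lemma omap_val_inj (T : Type) (P : pred T) (sT : subType P) : injective (omap (val : sT -> T)).
Proof. by case=> [x|] [y|] //= [] => /val_inj->. Qed.

(** * Transport along isomorphisms *)

Section Isomorphisms.
Implicit Types G H K : graph.

Lemma preserves_comp G H K (f : gmap G H) (h : gmap H K) :
  preserves f.1 f.2 -> preserves h.1 h.2 -> preserves (h.1 \o f.1) (h.2 \o f.2).
Proof.
move=> /preservesP pf /preservesP ph; apply/preservesP=> d /=.
have [f1 f2 f3 f4 f5] := pf d; have [h1 h2 h3 h4 h5] := ph (f.2 d).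
split; rewrite ?h1 ?f1 ?f2 ?h2 ?h3 ?h4 //; first by case: (inc d).
by move=> kd; rewrite h5 ?f5 ?f4.
Qed.

Lemma preserves_inv G H (f : gmap G H) f1' f2' : cancel f.1 f1' -> cancel f1' f.1 ->
  cancel f.2 f2' -> cancel f2' f.2 -> preserves f.1 f.2 -> preserves f1' f2'.
Proof.
move=> f1K f1K' f2K f2K' /preservesP fP; apply/preservesP=> d; rewrite -(f2K' d);
  move: (f2' d) => {}d.
have [h1 h2 h3 h4 h5] := fP d; rewrite f2K h1 -h2 f2K h3 h4; split=> //.
  by case: (inc d) => //= v; rewrite f1K.
by move=> kd; rewrite h5.
Qed.

Lemma is_iso_comp G H K (f : gmap G H) (h : gmap H K) :
  is_iso f -> is_iso h -> is_iso (h.1 \o f.1, h.2 \o f.2).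
Proof.
move=> [f1 f2 pf] [h1 h2 ph]; split; [exact: bij_comp h1 f1|exact: bij_comp h2 f2|].
exact: (preserves_comp pf ph).
Qed.

Lemma is_iso_inv G H (f : gmap G H) : is_iso f -> exists2 f' : gmap H G, is_iso f' &
  [/\ cancel f.1 f'.1, cancel f'.1 f.1, cancel f.2 f'.2 & cancel f'.2 f.2].
Proof.
case=> [[f1 K1 K1'] [f2 K2 K2'] pf]; exists (f1, f2) => //; split.
- by exists f.1.
- by exists f.2.
- exact: (@preserves_inv _ _ f).
Qed.

Lemma preserves_flip G H (f1 : vert G -> vert H) (f2 : dart G -> dart H) d :
  preserves f1 f2 -> f2 (flip d) = flip (f2 d).
Proof. by move/preservesP/(_ d)=> []. Qed.

Lemma preserves_kind G H (f1 : vert G -> vert H) (f2 : dart G -> dart H) d :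
  preserves f1 f2 -> kind (f2 d) = kind d.
Proof. by move/preservesP/(_ d)=> []. Qed.

Lemma conj_perm (T U : finType) (f : T -> U) (t : {perm T}) : bijective f ->
  exists s : {perm U}, forall x, s (f x) = f (t x).
Proof.
case=> f' fK fK'; have inj : injective (fun y => f (t (f' y))).
  by move=> y z /(can_inj fK)/perm_inj/(can_inj fK').
by exists (perm inj) => x; rewrite permE fK.
Qed.

(** The condition which [semiregular] imposes on every nontrivial element of a group. *)
Definition free_gperm G (t : gperm G) :=
  [&& [forall v, t.1 v != v], [forall d, t.2 d != d] &
      [forall d, (kind d != Halvable) ==> (t.2 d != flip d)]].

Lemma order2P (gT : finGroupType) (x : gT) : (#[x] == 2)%N = (x != 1) && (x * x == 1).
Proof.
apply/eqP/andP=> [o2|[x1 /eqP xx]].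
  split; last by rewrite -(expg_order x) o2 expgS expg1.
  by apply: contra_eq_neq o2 => ->; rewrite order1.
by apply: nt_prime_order; rewrite // expgS expg1.
Qed.

Lemma semiregular_order2 G (t : gperm G) : #[t] = 2 -> semiregular <[t]> = free_gperm t.
Proof.
move=> o2; have : (t != 1) && (t * t == 1) by rewrite -order2P o2.
case/andP=> t1 _; apply/forall_inP/idP => [h|ft g].
  by have := h t (cycle_id t); rewrite t1.
by rewrite cycle2g // !inE => /orP[]/eqP->; rewrite ?eqxx ?t1.
Qed.

Lemma conj_free G H (f : gmap G H) (t : gperm G) (s : gperm H) : is_iso f ->
  (forall v, s.1 (f.1 v) = f.1 (t.1 v)) -> (forall d, s.2 (f.2 d) = f.2 (t.2 d)) ->
  free_gperm t -> free_gperm s.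
Proof.
move=> [[f1 K1 K1'] [f2 K2 K2'] pf] e1 e2 /and3P[/forallP h1 /forallP h2 /forallP h3].
apply/and3P; split; apply/forallP=> x.
- by rewrite -(K1' x) e1 (can_eq K1).
- by rewrite -(K2' x) e2 (can_eq K2).
rewrite -(K2' x) e2 (preserves_kind _ pf) -(preserves_flip _ pf) (can_eq K2); exact: h3.
Qed.

Lemma conj_Aut G H (f : gmap G H) (t : gperm G) (s : gperm H) : is_iso f ->
  (forall v, s.1 (f.1 v) = f.1 (t.1 v)) -> (forall d, s.2 (f.2 d) = f.2 (t.2 d)) ->
  t \in Defs.Aut G -> s \in Defs.Aut H.
Proof.
move=> [[f1 K1 K1'] [f2 K2 K2'] /preservesP pf] e1 e2; rewrite !inE => /preservesP pt.
apply/preservesP=> x; rewrite -(K2' x) e2; move: (f2 x) => d.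
have [h1 h2 h3 h4 h5] := pf (t.2 d); have [k1 k2 k3 k4 k5] := pt d; have [j1 j2 j3 j4 j5] := pf d.
rewrite h1 k1 h3 k3 h4 k4 -j2 e2 k2 h2 j1 j3 j4; split=> //.
  by case: (inc d) => //= v; rewrite e1.
by move=> kd; rewrite h5 ?k5 ?j5 // k4.
Qed.
End Isomorphisms.

Section AtomIso.
Variable R : rooted.
Implicit Types A : atom R.

Lemma boundary_isoP A A' (f : gmap (agraph A) (agraph A')) : boundary_iso f ->
  forall v, (f.1 v \in aboundary A') = (v \in aboundary A).
Proof. by move=> [[b1 _ _] <-] v; rewrite mem_imset //; apply: bij_inj. Qed.

Lemma boundary_iso_def A A' (f : gmap (agraph A) (agraph A')) : is_iso f ->
  (forall v, (f.1 v \in aboundary A') = (v \in aboundary A)) -> boundary_iso f.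
Proof.
move=> fi h; split=> //; apply/setP=> v; have [[f1 K1 K1'] _ _] := fi.
by rewrite -(K1' v) mem_imset ?h //; apply: can_inj K1.
Qed.

Lemma boundary_iso_comp A A' A'' (f : gmap (agraph A) (agraph A')) (h : gmap (agraph A') (agraph
  A'')) :
  boundary_iso f -> boundary_iso h -> @boundary_iso R A A'' (h.1 \o f.1, h.2 \o f.2).
Proof.
move=> bf bh; apply: boundary_iso_def; first by apply: is_iso_comp; [case: bf|case: bh].
by move=> v; rewrite /= (boundary_isoP bh) (boundary_isoP bf).
Qed.

Lemma boundary_iso_inv A A' (f : gmap (agraph A) (agraph A')) : boundary_iso f ->
  exists f' : gmap (agraph A') (agraph A), boundary_iso f'.
Proof.
move=> bf; have [f' fi [K1 K1' _ _]] := is_iso_inv (proj1 bf); exists f'.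
by apply: boundary_iso_def => // v; rewrite -(boundary_isoP bf) K1'.
Qed.

Lemma Aut_boundaryP A (t : gperm (agraph A)) : reflect
  (t \in Defs.Aut (agraph A) /\ forall v, (t.1 v \in aboundary A) = (v \in aboundary A))
  (t \in Aut_boundary A).
Proof.
rewrite [_ \in Aut_boundary A]in_set; case: (t \in Defs.Aut _) => /=; last by constructor=> -[].
apply: (iffP eqP) => [h|[_ h]].
  by split=> // v; rewrite -{1}h mem_imset //; apply: perm_inj.
apply/setP=> v; rewrite -(permKV t.1 v) mem_imset ?h //; exact: perm_inj.
Qed.

Lemma exchangingP A (t : gperm (agraph A)) : reflect
  [/\ t \in Defs.Aut (agraph A), forall v, (t.1 v \in aboundary A) = (v \in aboundary A) &
      forall v, v \in aboundary A -> t.1 v != v] (exchanging t).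
Proof.
apply: (iffP andP) => [[/Aut_boundaryP[h1 h2] /forall_inP h3]|[h1 h2 h3]]; first by split.
by split; [apply/Aut_boundaryP|apply/forall_inP].
Qed.

Lemma halvingP A (t : gperm (agraph A)) :
  halving t = [&& exchanging t, t != 1, t * t == 1 & free_gperm t].
Proof.
rewrite /halving order2P; case: (exchanging t) => //=.
case: (boolP ((t != 1) && (t * t == 1))) => [h|]; last by rewrite andbA => /negPf->.
have /andP[-> ->] := h; rewrite /=; apply: semiregular_order2.
by apply/eqP; rewrite order2P.
Qed.

Lemma exchanging_conj A A' (f : gmap (agraph A) (agraph A')) (t : gperm (agraph A)) : boundary_iso
  f ->
  exchanging t -> exists t' : gperm (agraph A'), [/\ exchanging t', forall v,
    t'.1 (f.1 v) = f.1 (t.1 v) &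
    forall d, t'.2 (f.2 d) = f.2 (t.2 d)].
Proof.
move=> bf /exchangingP[h1 h2 h3]; have [fi _] := bf; have [b1 b2 pf] := fi.
have [s1 e1] := conj_perm t.1 b1; have [s2 e2] := conj_perm t.2 b2.
exists (s1, s2); split=> //; apply/exchangingP; have [f1 K1 K1'] := b1; split.
- exact: (conj_Aut fi _ _ h1).
- by move=> v; rewrite -(K1' v) e1 !(boundary_isoP bf) h2.
- by move=> v; rewrite -(K1' v) e1 (can_eq K1) (boundary_isoP bf); apply: h3.
Qed.

Lemma halving_conj A A' (f : gmap (agraph A) (agraph A')) (t : gperm (agraph A)) : boundary_iso f ->
  halving t -> exists t' : gperm (agraph A'), halving t'.
Proof.
rewrite halvingP => bf /and4P[h1 h2 /eqP h3 h4].
have [t' [h1' e1 e2]] := exchanging_conj bf h1.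
have [fi _] := bf; have [[f1 K1 K1'] [f2 K2 K2'] _] := fi.
exists t'; rewrite halvingP h1' /=; apply/and3P; split; last exact: (conj_free fi e1 e2 h4).
  apply/eqP=> t1; case/eqP: h2; rewrite t1 in e1 e2; case: t e1 e2 {h1 h3 h4} => t1' t2' e1 e2.
  by congr (_, _); apply/permP=> x; rewrite perm1; [apply: (can_inj K1)|apply: (can_inj K2)];
    rewrite -?e1 -?e2 perm1.
have hv v : t.1 (t.1 v) = v by rewrite -permM -[t.1 * t.1]/((t * t).1) h3 perm1.
have hd d : t.2 (t.2 d) = d by rewrite -permM -[t.2 * t.2]/((t * t).2) h3 perm1.
apply/eqP; rewrite (_ : t' * t' = ((t'.1 * t'.1)%g, (t'.2 * t'.2)%g)) //.
by congr (_, _); apply/permP=> x; rewrite perm1 permM;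
  [rewrite -(K1' x) !e1 hv|rewrite -(K2' x) !e2 hd].
Qed.

(** Exchanging and halving automorphisms are transported by conjugation. Being a block atom refers
    to the position of [A] in the block-tree, which a boundary isomorphism does not see; hence the
    hypothesis. *)
Lemma boundary_iso_kind A A' (f : gmap (agraph A) (agraph A')) : boundary_iso f ->
  block_atom A = block_atom A' -> atom_kind A = atom_kind A'.
Proof.
move=> bf e; have [f' bf'] := boundary_iso_inv bf; rewrite /atom_kind e.
have -> : [exists t : gperm (agraph A), halving t] = [exists t : gperm (agraph A'), halving t].
  by apply/existsP/existsP=> -[t ht]; [have [t' ?] := halving_conj bf ht|have [t' ?] :=
    halving_conj bf' ht]; exists t'.
suff -> : [exists t : gperm (agraph A), exchanging t] = [exists t : gperm (agraph A'),
  exchanging t] by [].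
by apply/existsP/existsP=> -[t ht]; [have [t' [? _ _]] := exchanging_conj bf ht|have [t' [? _ _]]
  := exchanging_conj bf' ht]; exists t'.
Qed.
End AtomIso.

(** * The induced action on the reduced graph *)

Section Induced.
Variable R : rooted.
Notation G := (Defs.rgraph R).
Notation c := (center R).
Hypotheses (conn : connected [set: cell G]) (noloop : loopless G).
Hypothesis autR : forall g, g \in Defs.Aut G -> rooted_aut g.
Variable l : labelling R.
Implicit Types (A : atom R) (g : gperm G).

Definition amap g A : atom R := insubd A (move g (val A)).

Lemma val_amap g A : g \in Defs.Aut G -> val (amap g A) = move g (val A).
Proof. by move=> gA; rewrite val_insubd (atom_move (autR gA) (valP A)). Qed.

Lemma amapM g h A : g \in Defs.Aut G -> h \in Defs.Aut G -> amap (g * h) A = amap h (amap g A).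
Proof. by move=> gA hA; apply: val_inj; rewrite !val_amap ?groupM // moveM. Qed.

Lemma amap1 A : amap 1 A = A.
Proof. by apply: val_inj; rewrite val_amap ?group1 // move1. Qed.

Lemma amapK g A : g \in Defs.Aut G -> amap g^-1 (amap g A) = A.
Proof. by move=> gA; rewrite -amapM ?groupV // mulgV amap1. Qed.

Lemma amapKV g A : g \in Defs.Aut G -> amap g (amap g^-1 A) = A.
Proof. by move=> gA; rewrite -amapM ?groupV // mulVg amap1. Qed.

Lemma mem_amap_v g A v : g \in Defs.Aut G -> (inl (g.1 v) \in val (amap g A)) = (inl v \in val A).
Proof. by move=> gA; rewrite val_amap // -[inl _]/(cperm g (inl v)) mem_move. Qed.

Lemma mem_amap_d g A d : g \in Defs.Aut G -> (inr (g.2 d) \in val (amap g A)) = (inr d \in val A).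
Proof. by move=> gA; rewrite val_amap // -[inr _]/(cperm g (inr d)) mem_move. Qed.

Lemma boundary_amap g A v : g \in Defs.Aut G -> (g.1 v \in boundary (amap g A)) = (v \in boundary
  A).
Proof.
move=> gA; rewrite -(boundary_amove (autR gA) A); congr (_ \in boundary _).
by apply: val_inj; rewrite val_amap.
Qed.

Lemma block_atom_amap g A : g \in Defs.Aut G -> block_atom (amap g A) = block_atom A.
Proof.
by move=> gA; rewrite /block_atom val_amap // block_part_moveE ?autR // dipole_moveE.
Qed.

Lemma res_exists g A : g \in Defs.Aut G -> exists f : gmap (agraph A) (agraph (amap g A)),
  [/\ boundary_iso f, forall v : vert (agraph A), avert (f.1 v) = g.1 (avert v) &
      forall d : dart (agraph A), val (f.2 d) = g.2 (val d)].
Proof.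
move=> gA.
have mv (v : vert (agraph A)) : inl (g.1 (val v)) \in val (amap g A).
  by rewrite mem_amap_v //; apply: (valP v).
have md (d : dart (agraph A)) : inr (g.2 (val d)) \in val (amap g A).
  by rewrite mem_amap_d //; apply: (valP d).
pose f1 v : vert (agraph (amap g A)) := sub_vert (mv v).
pose f2 d : dart (agraph (amap g A)) := sub_dart (md d).
have mv' (v : vert (agraph (amap g A))) : inl (g.1^-1 (val v))%g \in val A.
  by rewrite -(mem_amap_v _ _ gA) permKV; apply: (valP v).
have md' (d : dart (agraph (amap g A))) : inr (g.2^-1 (val d))%g \in val A.
  by rewrite -(mem_amap_d _ _ gA) permKV; apply: (valP d).
have sA := atom_subgraph (valP A); have sA' := atom_subgraph (valP (amap g A)).
exists (f1, f2); split=> //; apply: boundary_iso_def.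
  split=> /=.
  - exists (fun v => sub_vert (mv' v)) => v; apply: val_inj; rewrite /= ?permK ?permKV //.
  - exists (fun d => sub_dart (md' d)) => d; apply: val_inj; rewrite /= ?permK ?permKV //.
  apply/preservesP=> d; have [h1 h2 h3 h4 h5] := autP gA (val d); split=> //.
    apply: (@omap_val_inj _ _ (vert (agraph (amap g A)))).
    apply: (etrans (sub_graph_inc sA' (f2 d))); rewrite [LHS]h1 -(sub_graph_inc sA d).
    by case: (inc d).
  apply: val_inj; rewrite (sub_graph_flip sA') -[val (f2 (flip d))]/(g.2 (val (flip d)))
    (sub_graph_flip sA).
  exact: h2.
move=> v; rewrite !inE /avert /= boundary_amap //.
Qed.

Lemma atom_kind_amap g A : g \in Defs.Aut G -> atom_kind (amap g A) = atom_kind A.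
Proof.
move=> gA; have [f [bf _ _]] := res_exists A gA; apply/esym/(boundary_iso_kind bf).
by rewrite block_atom_amap.
Qed.

Implicit Types (u v w : vert G) (d e : dart G).

(** By [shared_boundary], a vertex on the boundary of one atom is not interior to another. *)
Lemma kept_boundary A v : v \in boundary A -> kept_vert v.
Proof.
move=> vb; apply/forallP=> A'; apply/implyP=> vA'.
case: (eqVneq A A') => [<-//|]; rewrite eq_sym; apply: shared_boundary => //.
exact: boundary_in.
Qed.

Lemma kept_inc d v : kept_dart d -> inc d = Some v -> kept_vert v.
Proof.
move=> /forallP kd e; apply/forallP=> A; apply/implyP=> vA; apply: contraT => vb.
by have := kd A; rewrite (interior_dart vA vb e).
Qed.

Lemma kept_flip d : kept_dart (flip d) = kept_dart d.
Proof.
suff h e : kept_dart e -> kept_dart (flip e).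
  by apply/idP/idP => [/h|/h//]; rewrite flipK.
move/forallP=> ke; apply/forallP=> A; apply: contra (ke A) => fA.
by rewrite -(flipK e); apply: subgraph_flip fA; apply: atom_subgraph (valP A).
Qed.

Lemma kept_vert_aut g v : g \in Defs.Aut G -> kept_vert (g.1 v) = kept_vert v.
Proof.
have h g' v' : g' \in Defs.Aut G -> kept_vert v' -> kept_vert (g'.1 v').
  move=> gA /forallP kv; apply/forallP=> A; rewrite -(amapKV A gA) mem_amap_v // boundary_amap //.
move=> gA; apply/idP/idP; last exact: h.
have gV : g^-1 \in Defs.Aut G by rewrite groupV.
by move/(h _ _ gV); rewrite permK.
Qed.

Lemma kept_dart_aut g d : g \in Defs.Aut G -> kept_dart (g.2 d) = kept_dart d.
Proof.
have h g' d' : g' \in Defs.Aut G -> kept_dart d' -> kept_dart (g'.2 d').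
  by move=> gA /forallP kd; apply/forallP=> A; rewrite -(amapKV A gA) mem_amap_d.
move=> gA; apply/idP/idP; last exact: h.
have gV : g^-1 \in Defs.Aut G by rewrite groupV.
by move/(h _ _ gV); rewrite permK.
Qed.

(** The vertex at which the dart [e_dart l A b] is attached. *)
Definition bend A b := if b then Some (tail l A) else [pick v in boundary A | v != tail l A].

Lemma boundary_two A u v w : u \in boundary A -> v \in boundary A -> u != v ->
  w \in boundary A -> w = u \/ w = v.
Proof.
move=> uA vA uv wA; have c2 := card_boundary conn noloop A.
have uvA : [set u; v] \subset boundary A.
  by apply/subsetP=> x; rewrite !inE => /orP[]/eqP->.
have : boundary A = [set u; v].
  by apply/esym/eqP; rewrite eqEcard uvA cards2 uv.
by move=> e; move: wA; rewrite e !inE => /orP[]/eqP; auto.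
Qed.

(** With at most two boundary vertices, the one picked for [b = false] is the only one different
    from the tail. *)
Lemma bendE A b v : (bend A b == Some v) = (v \in boundary A) && ((v == tail l A) == b).
Proof.
have tA := tail_boundary l A; case: b => /=.
  rewrite eqb_id; apply/eqP/andP=> [[<-]|[_ /eqP->//]]; by rewrite eqxx.
rewrite eqbF_neg; case: pickP => [w /andP[wA wt]|none].
  apply/eqP/andP=> [[<-]//|[vA vt]]; congr Some.
  by case: (boundary_two wA tA wt vA) vt => // ->; rewrite eqxx.
by have /= -> := none v.
Qed.

Lemma option_ext (T : eqType) (o o' : option T) :
  (forall x, (o == Some x) = (o' == Some x)) -> o = o'.
Proof.
by case: o => [x|] h; [apply/esym/eqP; rewrite -h|case: o' h => // y /(_ y); rewrite eqxx].
Qed.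

Lemma rinc_val (x : dart (reduce l)) : omap (@old_vert R l) (inc x) =
  match x with inl d => inc (val d) | inr (A, b) => bend A b end.
Proof.
have h o : (forall v, o = Some v -> kept_vert v) -> omap (@old_vert R l) (obind insub o) = o.
  by case: o => //= v /(_ v erefl) kv; rewrite insubT.
case: x => [d|[A b]] /=; apply: h => v.
  exact: kept_inc (valP d).
by move/eqP; rewrite -/(bend A b) bendE => /andP[/kept_boundary].
Qed.

Definition hat_v g (v : vert (reduce l)) : vert (reduce l) := insubd (v : rvert R) (g.1 (old_vert
  v)).

(** The action exchanges the darts of [e_A] when [g] does not respect the chosen tails. *)
Definition hat_b g A b := b (+) (g.1 (tail l A) != tail l (amap g A)).

Definition hat_k g (d : {d : dart R | kept_dart d}) : {d : dart R | kept_dart d} :=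
  insubd d (g.2 (val d)).

Definition hat_d g (x : dart (reduce l)) : dart (reduce l) :=
  match x with
  | inl d => inl (hat_k g d)
  | inr (A, b) => inr (amap g A, hat_b g A b)
  end.

Lemma val_hat_v g (v : vert (reduce l)) : g \in Defs.Aut G ->
  old_vert (hat_v g v) = g.1 (old_vert v).
Proof. by move=> gA; rewrite /old_vert val_insubd kept_vert_aut // (valP (v : rvert R)). Qed.

Lemma val_hat_k g k : g \in Defs.Aut G -> val (hat_k g k) = g.2 (val k).
Proof. by move=> gA; rewrite val_insubd kept_dart_aut // (valP k). Qed.

Lemma hat_kM g h k : g \in Defs.Aut G -> h \in Defs.Aut G -> hat_k (g * h) k = hat_k h (hat_k g k).
Proof. by move=> gA hA; apply: val_inj; rewrite !val_hat_k ?groupM // permM. Qed.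

Lemma hat_k1 k : hat_k 1 k = k.
Proof. by apply: val_inj; rewrite val_hat_k ?group1 // perm1. Qed.

Lemma old_vert_inj : injective (@old_vert R l).
Proof. exact: val_inj. Qed.

(** [g] maps the boundary, of at most two vertices, onto the boundary of the image, so being the
    tail is preserved for all boundary vertices or reversed for all of them. *)
Lemma eq_tail_amap g A v : g \in Defs.Aut G -> v \in boundary A ->
  (g.1 v == tail l (amap g A)) = ((v == tail l A) (+) (g.1 (tail l A) != tail l (amap g A))).
Proof.
move=> gA vA; have tA := tail_boundary l A; have tA' := tail_boundary l (amap g A).
case: (eqVneq v (tail l A)) => [->|vt] /=; first by rewrite negbK.
have gv := etrans (boundary_amap A v gA) vA; have gt := etrans (boundary_amap A _ gA) tA.
have gn : g.1 v != g.1 (tail l A) by rewrite (inj_eq (@perm_inj _ _)).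
case: (boundary_two gv gt gn tA') => ->; first by rewrite eqxx eq_sym gn.
by rewrite eqxx (negPf gn).
Qed.

Lemma bend_amap g A b : g \in Defs.Aut G -> bend (amap g A) (hat_b g A b) = omap g.1 (bend A b).
Proof.
move=> gA; apply: option_ext => w; rewrite -(permKV g.1 w); move: (_ w) => v.
have -> : (omap g.1 (bend A b) == Some (g.1 v)) = (bend A b == Some v).
  by case: (bend A b) => [u|] //=; apply/eqP/eqP=> -[]; [move/perm_inj->|move->].
rewrite !bendE boundary_amap //; case vA: (v \in boundary A) => //=.
rewrite eq_tail_amap // /hat_b; case: (v == _); case: b; case: (_ != _) => //.
Qed.

Lemma hat_vM g h (v : vert (reduce l)) : g \in Defs.Aut G -> h \in Defs.Aut G ->
  hat_v (g * h) v = hat_v h (hat_v g v).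
Proof. by move=> gA hA; apply: old_vert_inj; rewrite !val_hat_v ?groupM // permM. Qed.

Lemma hat_dM g h x : g \in Defs.Aut G -> h \in Defs.Aut G -> hat_d (g * h) x = hat_d h (hat_d g x).
Proof.
move=> gA hA; case: x => [d|[A b]] /=.
  by rewrite hat_kM.
congr (inr (_, _)); first exact: amapM.
(* The correction bits of [g] and [h] add up to that of [g * h]. *)
rewrite /hat_b amapM // -addbA; congr (_ (+) _).
have tA := tail_boundary l A.
have := eq_tail_amap hA (etrans (boundary_amap A _ gA) tA).
rewrite permM => ->; by case: (_ == _); case: (_ == _).
Qed.

Lemma hat_v1 (v : vert (reduce l)) : hat_v 1 v = v.
Proof. by apply: old_vert_inj; rewrite val_hat_v ?group1 // perm1. Qed.

Lemma hat_d1 x : hat_d 1 x = x.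
Proof.
case: x => [d|[A b]] /=; first by rewrite hat_k1.
by rewrite /hat_b amap1 perm1 eqxx addbF.
Qed.

(** A relation, since [hat_v g] and [hat_d g] are shown to be permutations only for an automorphism
    [g]. *)
Definition induced g (h : gperm (reduce l)) := [forall v : vert (reduce l),
  h.1 v == hat_v g v] && [forall x, h.2 x == hat_d g x].

Lemma inducedP g (h : gperm (reduce l)) : reflect ((forall v : vert (reduce l),
  h.1 v = hat_v g v) /\ (forall x, h.2 x = hat_d g x)) (induced g h).
Proof.
apply: (iffP andP) => [[/forallP h1 /forallP h2]|[h1 h2]].
  by split=> x; apply/eqP.
by split; apply/forallP=> x; apply/eqP.
Qed.

Lemma induced_exists g : g \in Defs.Aut G -> exists h, induced g h.
Proof.
move=> gA; have gV : g^-1 \in Defs.Aut G by rewrite groupV.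
have i1 : injective (hat_v g).
  by apply: (can_inj (g := hat_v g^-1)) => v; rewrite -hat_vM // mulgV hat_v1.
have i2 : injective (hat_d g).
  by apply: (can_inj (g := hat_d g^-1)) => v; rewrite -hat_dM // mulgV hat_d1.
by exists (perm i1, perm i2); apply/inducedP; split=> x; rewrite permE.
Qed.

(** For directed atoms [tail_iso] applies to the restriction of [g], so the correction bit vanishes
    and orientations are preserved. *)
Lemma tail_directed g A : g \in Defs.Aut G -> atom_kind A = Directed ->
  g.1 (tail l A) = tail l (amap g A).
Proof.
move=> gA kA; have [f [bf f1 _]] := res_exists A gA.
have tA := boundary_in (tail_boundary l A).
pose t : vert (agraph A) := sub_vert tA.
by rewrite -(tail_iso (l := l) kA bf (v := t)) // f1.
Qed.

Lemma new_color_amap g A : g \in Defs.Aut G -> new_color l (amap g A) = new_color l A.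
Proof.
by move=> gA; have [f [bf _ _]] := res_exists A gA; apply/esym/(new_colorP l); exists f.
Qed.

Lemma induced_Aut g (h : gperm (reduce l)) : g \in Defs.Aut G -> induced g h ->
  h \in Defs.Aut (reduce l).
Proof.
move=> gA /inducedP[h1 h2]; rewrite inE; apply/preservesP=> x; rewrite !h2; split.
- have -> : omap h.1 (inc x) = omap (hat_v g) (inc x) by case: (inc x) => //= v; rewrite h1.
  apply: (inj_omap old_vert_inj); rewrite rinc_val.
  transitivity (omap g.1 (omap (@old_vert R l) (inc x))); last first.
    by case: (inc x) => //= v; rewrite val_hat_v.
  rewrite rinc_val; case: x => [k|[A b]]; last exact: bend_amap.
  change (inc (val (hat_k g k)) = omap g.1 (inc (val k))).
  by rewrite val_hat_k // aut_inc.
- case: x => [k|[A b]]; last by rewrite /= /hat_b addNb.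
  change (inl (hat_k g (flip_on k)) = inl (flip_on (hat_k g k)) :> rdart R).
  congr inl; apply: val_inj; rewrite flip_onE !val_hat_k // flip_onE kept_flip (valP k) aut_flip //.
  by rewrite kept_flip kept_dart_aut // (valP k).
- case: x => [k|[A b]]; last exact: new_color_amap.
  change (color (val (hat_k g k)) = color (val k)).
  by rewrite val_hat_k //; case: (autP gA (val k)).
- case: x => [k|[A b]]; last exact: atom_kind_amap.
  change (kind (val (hat_k g k)) = kind (val k)).
  by rewrite val_hat_k //; case: (autP gA (val k)).
case: x => [k|[A b]] kd; last by rewrite /= /hat_b tail_directed // eqxx addbF.
change (fwd (val (hat_k g k)) = fwd (val k)).
by rewrite val_hat_k //; case: (autP gA (val k)) => _ _ _ _; apply.
Qed.

Variable Gam : {group gperm G}.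
Hypothesis sGam : Gam \subset Defs.Aut G.

Definition hat_set := [set h : gperm (reduce l) | [exists g in Gam, induced g h]].

Lemma hat_setP h : reflect (exists2 g, g \in Gam & induced g h) (h \in hat_set).
Proof. by rewrite inE; apply: exists_inP. Qed.

Lemma hat_group_set : group_set hat_set.
Proof.
apply/group_setP; split.
  apply/hat_setP; exists 1 => //; apply/inducedP; split=> x; rewrite perm1 ?hat_v1 ?hat_d1 //.
move=> h h' /hat_setP[g gG /inducedP[h1 h2]] /hat_setP[g' gG' /inducedP[h1' h2']].
apply/hat_setP; exists (g * g'); first exact: groupM.
have gA := subsetP sGam _ gG; have gA' := subsetP sGam _ gG'.
by apply/inducedP; split=> x; rewrite permM ?h1' ?h1 ?h2' ?h2 ?hat_vM ?hat_dM.
Qed.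
Definition hat_group : {group gperm (reduce l)} := Group hat_group_set.

Lemma hat_sub : hat_group \subset Defs.Aut (reduce l).
Proof.
apply/subsetP=> h /hat_setP[g gG ig]; exact: induced_Aut (subsetP sGam _ gG) ig.
Qed.

Hypothesis semG : semiregular Gam.

Lemma semiregularP (G' : graph) (Gam' : {group gperm G'}) : reflect
  (forall t, t \in Gam' -> t != 1 -> free_gperm t) (semiregular Gam').
Proof.
by apply: (iffP forall_inP) => h g gG; [move=> n1; apply: (implyP (h g gG))|apply/implyP; apply: h].
Qed.

Lemma fix_vertex g v : g \in Gam -> g.1 v = v -> g = 1.
Proof.
move=> gG gv; apply/eqP; apply: contraT => n1.
by have /and3P[/forallP/(_ v)] := semiregularP _ semG g gG n1; rewrite gv eqxx.
Qed.

Lemma swap_halving g A : g \in Gam -> amap g A = A -> g.1 (tail l A) != tail l A ->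
  exists t : gperm (agraph A), [/\ halving t, forall v : vert (agraph A),
    avert (t.1 v) = g.1 (avert v) &
    forall d : dart (agraph A), val (t.2 d) = g.2 (val d)].
Proof.
move=> gG gA nt; have gAut := subsetP sGam _ gG; have := res_exists A gAut.
rewrite gA => -[f [bf f1 f2]]; have [[b1 b2 pf] _] := bf.
pose t : gperm (agraph A) := (perm (bij_inj b1), perm (bij_inj b2)).
have t1 (v : vert (agraph A)) : avert (t.1 v) = g.1 (avert v) by rewrite permE f1.
have t2 (d : dart (agraph A)) : val (t.2 d) = g.2 (val d) by rewrite permE f2.
exists t; split=> //; have tA := tail_boundary l A.
have gt : g.1 (tail l A) \in boundary A by rewrite -{2}gA boundary_amap.
have g1 : g != 1 by apply: contraNneq nt => ->; rewrite perm1.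
(* [g] moves the tail to the other boundary vertex and back; its square fixes a vertex and is
   trivial by semiregularity. *)
have gg : g * g = 1.
  apply: (@fix_vertex _ (tail l A)); rewrite ?groupM // permM.
  have ggt : g.1 (g.1 (tail l A)) \in boundary A by rewrite -{2}gA boundary_amap.
  case: (boundary_two gt tA nt ggt) => // /perm_inj e; by rewrite e eqxx in nt.
have sA := atom_subgraph (valP A).
have /and3P[/forallP fv /forallP fd /forallP fe] := semiregularP _ semG g gG g1.
have ft : free_gperm t.
  apply/and3P; split; apply/forallP=> x.
  - by apply: contraNneq (fv (avert x)) => e; rewrite -t1 e.
  - by apply: contraNneq (fd (val x)) => e; rewrite -t2 e.
  apply/implyP=> kx; apply: contraNneq (implyP (fe (val x)) kx) => e.
  by rewrite -t2 e (sub_graph_flip sA).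
rewrite halvingP; apply/and4P; split=> //.
- apply/exchangingP; split.
  + rewrite inE; apply/preservesP=> d; have [h1 h2 h3 h4 h5] := preservesP _ _ pf d.
    rewrite !permE h1 h2 h3 h4; split=> //.
    by case: (inc d) => //= v; rewrite permE.
  + by move=> v; rewrite permE (boundary_isoP bf).
  + by move=> v _; case/and3P: ft => /forallP.
- apply: contraNneq nt => e; pose tv : vert (agraph A) := sub_vert (boundary_in tA).
  by have := t1 tv; rewrite e perm1 => <-.
apply/eqP; rewrite (_ : t * t = ((t.1 * t.1)%g, (t.2 * t.2)%g)) //.
have ggv v : g.1 (g.1 v) = v by rewrite -permM -[g.1 * g.1]/((g * g).1) gg perm1.
have ggd d : g.2 (g.2 d) = d by rewrite -permM -[g.2 * g.2]/((g * g).2) gg perm1.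
congr (_, _); apply/permP=> x; rewrite perm1 permM; apply: val_inj.
  by rewrite -!/(avert _) !t1 ggv.
by rewrite !t2 ggd.
Qed.

(** An element fixing a dart of [e_A] fixes the tail of [A] in [G], so it is trivial. Exchanging the
    two darts moves the tail: [swap_halving] makes the atom halvable, and block atoms are excluded
    by their boundary of at most one vertex. *)
Lemma hat_semiregular : semiregular hat_group.
Proof.
apply/semiregularP=> h /hat_setP[g gG ig] h1; have gAut := subsetP sGam _ gG.
have [hv hd] := inducedP _ _ ig.
have g1 : g != 1.
  apply: contraNneq h1 => e; apply/eqP; case: h hv hd {ig} => h1 h2 hv hd.
  by congr (_, _); apply/permP=> x; rewrite perm1 ?hv ?hd e ?hat_v1 ?hat_d1.
have /and3P[/forallP fv /forallP fd /forallP fe] := semiregularP _ semG g gG g1.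
apply/and3P; split; apply/forallP=> x.
- by apply: contraNneq (fv (old_vert x)) => e; rewrite -val_hat_v // -hv e.
- rewrite hd; case: x => [k|[A b]].
    by apply: contraNneq (fd (val k)) => -[e]; rewrite -val_hat_k // e.
  apply: contraNneq (fv (tail l A)) => -[eA]; rewrite /hat_b eA.
  by case: eqP => // _; case: b.
apply/implyP; rewrite hd; case: x => [k|[A b]] kd.
  apply: contraNneq (implyP (fe (val k)) kd) => -[e]; rewrite -val_hat_k // e flip_onE kept_flip.
  by rewrite (valP k).
apply: contraNneq kd => -[eA eb].
have nt : g.1 (tail l A) != tail l A.
  by apply: contra_eq_neq eb => e; rewrite /hat_b eA e eqxx addbF; case: b.
have [t [ht _ _]] := swap_halving gG eA nt; change (atom_kind A == Halvable); rewrite /atom_kind.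
case: ifP => [bA|_]; last by case: ifP => // /existsP[]; exists t.
have tA := tail_boundary l A.
have gt : g.1 (tail l A) \in boundary A by rewrite -{2}eA boundary_amap.
by case/eqP: nt; apply: (card_le1_eqP (card_boundary_block conn noloop bA)).
Qed.

End Induced.

(** * The expansion of the quotient *)

Section QuotientFacts.
Variables (G : graph) (Gam : {group gperm G}) (sGam : Gam \subset Defs.Aut G).

Lemma qproj_vP v v' : reflect (exists2 g, g \in Gam & v' = g.1 v) (qproj_v Gam v == qproj_v Gam v').
Proof.
apply: (iffP eqP) => [/(congr1 val)/= E | [g gG ->]].
  have : v' \in vorb Gam v by rewrite E; apply/imsetP; exists 1; rewrite ?perm1.
  by case/imsetP=> g gG ->; exists g.
apply: val_inj => /=; apply/setP=> x; apply/imsetP/imsetP=> -[h hG ->].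
  by exists (g^-1 * h); rewrite ?groupM ?groupV // permM permK.
by exists (g * h); rewrite ?groupM // permM.
Qed.

Lemma qproj_v_surj (O : vert (quot sGam)) : exists v, O = qproj_v Gam v.
Proof. by exists (iinv (valP O)); apply: val_inj; rewrite /= f_iinv. Qed.

Lemma qproj_d_surj (O : dart (quot sGam)) : exists d, O = qproj_d Gam d.
Proof. by exists (qrepr O); rewrite qreprK. Qed.

Lemma quot_flip d : flip (qproj_d Gam d : dart (quot sGam)) = qproj_d Gam (flip d).
Proof. exact: qflip_proj. Qed.

Lemma quot_inc d : inc (qproj_d Gam d : dart (quot sGam)) = omap (qproj_v Gam) (inc d).
Proof.
rewrite /=; have [g gG ->] := qrepr_proj Gam d; rewrite (aut_inc (subsetP sGam _ gG)).
case: (inc d) => //= v; congr Some; apply/esym/eqP/qproj_vP; by exists g.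
Qed.

Lemma quot_color d : color (qproj_d Gam d : dart (quot sGam)) = color d.
Proof. by rewrite /=; have [g gG ->] := qrepr_proj Gam d; case: (autP (subsetP sGam _ gG) d). Qed.

Lemma quot_kind d : kind (qproj_d Gam d : dart (quot sGam)) = kind d.
Proof. by rewrite /=; have [g gG ->] := qrepr_proj Gam d; case: (autP (subsetP sGam _ gG) d). Qed.

Lemma quot_fwd d : kind d = Directed -> fwd (qproj_d Gam d : dart (quot sGam)) = fwd d.
Proof. by rewrite /=; have [g gG ->] := qrepr_proj Gam d; case: (autP (subsetP sGam _ gG) d). Qed.
End QuotientFacts.

(** Turns a total, functional relation into a function by finite choice; used for the isomorphism of
    the expansion and for lifted automorphisms. *)
Lemma bijection_of_relation (Y Z : finType) (rel : Y -> Z -> Prop) :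
  (forall y, exists z, rel y z) -> (forall z, exists y, rel y z) ->
  (forall y z z', rel y z -> rel y z' -> z = z') -> (forall y y' z, rel y z -> rel y' z ->
    y = y') ->
  exists2 f : Y -> Z, bijective f & forall y, rel y (f y).
Proof.
move=> /fin_all_exists[f fP] /fin_all_exists[h hP] u1 u2; exists f => //.
by exists h => x; [apply: u2 (hP _) (fP _)|apply: u1 (fP _) (hP _)].
Qed.

Section AtomQuotient.
Variables (R : rooted) (A : atom R).

Definition quotient_dmap (k : atom_quotient A) : dart (agraph A) -> dart (quotient_graph k) :=
  match k with
  | EdgeQuotient => id
  | LoopQuotient => id
  | HalfQuotient t h => qproj_d <[t]>
  end.

Lemma quotient_dmapP (k : atom_quotient A) d :
  [/\ inc (quotient_dmap k d) = omap (quotient_map k) (inc d),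
      flip (quotient_dmap k d) = quotient_dmap k (flip d), color (quotient_dmap k d) = color d,
      kind (quotient_dmap k d) = kind d & kind d = Directed -> fwd (quotient_dmap k d) = fwd d].
Proof.
case: k => [| |t h]; [by split=> //=; case: (obind _ _)|by []|].
split; [exact: (quot_inc (halving_sub h))|exact: (quot_flip (halving_sub h))|
  exact: (quot_color (halving_sub h))|exact: (quot_kind (halving_sub h))|exact: (quot_fwd
    (halving_sub h))].
Qed.

Lemma quotient_dmap_surj (k : atom_quotient A) d : exists e, d = quotient_dmap k e.
Proof.
by case: k d => [| |t h] d /=; [exists d|exists d|have [e ->] := qproj_d_surj d; exists e].
Qed.

Lemma quotient_map_surj (k : atom_quotient A) w : aboundary A != set0 ->
  w \notin quotient_boundary k -> exists u, w = quotient_map k u.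
Proof.
case: k w => [| |t h] w; first by exists w.
  case: w => [w|] b0; first by exists (val w); rewrite /= valK.
  case/set0Pn: b0 => b bA /imsetP[]; exists b => //=; by rewrite insubF // bA.
by move=> _ _; have [v ->] := qproj_v_surj w; exists v.
Qed.

Lemma quotient_map_boundary (k : atom_quotient A) w :
  (quotient_map k w \in quotient_boundary k) = (w \in aboundary A).
Proof.
apply/idP/idP => [|wA]; last exact: imset_f.
case: k => [| |t h] /imsetP[b bA] /=; first by move->.
  case: insubP => [u _ eu|]; last by rewrite negbK.
  by rewrite insubF // bA.
move=> /esym/eqP e; have /qproj_vP[g gt ->] : qproj_v <[t]>%G b == qproj_v <[t]>%G w by exact: e.
move: h; rewrite halvingP => /and4P[/exchangingP[_ tb _] t1 /eqP t2 _].
have o2 : #[t] = 2 by apply/eqP; rewrite order2P t1 t2 eqxx.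
have : g \in <[t]> by [].
by rewrite cycle2g // in_set2 => /orP[]/eqP->; rewrite ?perm1 // tb.
Qed.
End AtomQuotient.

(** * Stabilizers of atoms and the choice of their quotients *)

Section Stabilizers.
Variable R : rooted.
Notation G := (Defs.rgraph R).
Notation c := (center R).
Hypotheses (conn : connected [set: cell G]) (noloop : loopless G).
Hypothesis autR : forall g, g \in Defs.Aut G -> rooted_aut g.
Variable l : labelling R.
Variable Gam : {group gperm G}.
Hypothesis sGam : Gam \subset Defs.Aut G.
Hypothesis semG : semiregular Gam.
Implicit Types (A : atom R) (g : gperm G).

Notation hat := (hat_group conn noloop autR l sGam).
Notation H := (quot (hat_sub conn noloop autR l sGam)).
Definition hat_proj : gmap (reduce l) H := (qproj_v hat, qproj_d hat).
Notation p := hat_proj.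

Lemma hat_proj_v (v v' : vert (reduce l)) :
  p.1 v = p.1 v' <-> exists2 g, g \in Gam & old_vert v' = g.1 (old_vert v).
Proof.
split=> [/eqP/qproj_vP[h /hat_setP[g gG /inducedP[h1 _]] ->]|[g gG e]].
  by exists g; rewrite // h1 val_hat_v // (subsetP sGam).
have gA := subsetP sGam _ gG; have [h ih] := induced_exists conn noloop autR l gA.
apply/eqP/qproj_vP; exists h; first by apply/hat_setP; exists g.
by have [h1 _] := inducedP _ _ ih; apply: old_vert_inj; rewrite h1 val_hat_v.
Qed.

Lemma hat_proj_d (x x' : dart (reduce l)) :
  p.2 x = p.2 x' <-> exists2 g, g \in Gam & x' = hat_d g x.
Proof.
split=> [/eqP/qproj_dP[h /hat_setP[g gG /inducedP[_ h2]] ->]|[g gG ->]].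
  by exists g; rewrite // h2.
have gA := subsetP sGam _ gG; have [h ih] := induced_exists conn noloop autR l gA.
apply/eqP/qproj_dP; exists h; first by apply/hat_setP; exists g.
by have [_ ->] := inducedP _ _ ih.
Qed.

Lemma image_edgeE A : image_edge p A = [set p.2 (e_dart l A true); p.2 (e_dart l A false)].
Proof. by rewrite /image_edge /edge_of quot_flip. Qed.

Definition same_orbit A A' := [exists g in Gam, A' == amap g A].

Lemma same_orbitP A A' : reflect (exists2 g, g \in Gam & A' = amap g A) (same_orbit A A').
Proof. by apply: (iffP exists_inP) => -[g gG /eqP e]; exists g => //; apply/eqP. Qed.

Lemma same_orbit_refl A : same_orbit A A.
Proof. by apply/same_orbitP; exists 1; rewrite ?amap1 //. Qed.

Lemma same_orbit_sym A A' : same_orbit A A' -> same_orbit A' A.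
Proof.
case/same_orbitP=> g gG ->; apply/same_orbitP; exists g^-1; rewrite ?groupV // amapK //.
exact: (subsetP sGam).
Qed.

Lemma same_orbit_trans A A' A'' : same_orbit A A' -> same_orbit A' A'' -> same_orbit A A''.
Proof.
case/same_orbitP=> g gG -> /same_orbitP[h hG ->]; apply/same_orbitP; exists (g * h).
  exact: groupM.
by rewrite amapM // (subsetP sGam).
Qed.

Lemma image_edge_same A A' : image_edge p A' = image_edge p A <-> same_orbit A A'.
Proof.
rewrite !image_edgeE; split.
  move/setP/(_ (p.2 (e_dart l A' true))); rewrite !inE eqxx /= => /esym/orP[]/eqP/esym/hat_proj_d;
  case=> g gG [e _]; apply/same_orbitP; by exists g.
have sub A1 A2 : same_orbit A1 A2 ->
    [set p.2 (e_dart l A2 true); p.2 (e_dart l A2 false)] \subset [set p.2 (e_dart l A1 true);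
      p.2 (e_dart l A1 false)].
  case/same_orbitP=> g gG ->; apply/subsetP=> x.
  have key b : p.2 (e_dart l A1 b) = p.2 (e_dart l (amap g A1) (hat_b l g A1 b)).
    by apply/hat_proj_d; exists g.
  have := key true; have := key false; rewrite /hat_b; case: (_ != _) => /= <- <- //.
  by rewrite setUC.
by move=> s; apply/eqP; rewrite eqEsubset !sub // same_orbit_sym.
Qed.

(** [pick] depends only on the set described by the predicate, so atoms in one orbit get the same
    representative; the default never occurs, as the orbit contains [A]. *)
Definition orbit_rep A : atom R := odflt A [pick A' | same_orbit A A'].

Lemma orbit_rep_same A : same_orbit A (orbit_rep A).
Proof. by rewrite /orbit_rep; case: pickP => [//|/(_ A)]; rewrite same_orbit_refl. Qed.

Lemma orbit_rep_eq A A' : same_orbit A A' -> orbit_rep A = orbit_rep A'.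
Proof.
move=> s; rewrite /orbit_rep; rewrite (@eq_pick _ (same_orbit A) (same_orbit A')).
  by case: pickP => [//|/(_ A')]; rewrite same_orbit_refl.
move=> A''; apply/idP/idP; apply: same_orbit_trans => //; exact: same_orbit_sym.
Qed.

Definition reps : {set atom R} := [set orbit_rep A | A : atom R].

Lemma reps_eq A A' : A \in reps -> A' \in reps -> same_orbit A A' -> A = A'.
Proof.
case/imsetP=> B _ -> /imsetP[B' _ ->] s; apply: orbit_rep_eq.
apply: same_orbit_trans (orbit_rep_same B) (same_orbit_trans s _).
by apply: same_orbit_sym; apply: orbit_rep_same.
Qed.

Lemma reps_selects : selects p reps.
Proof.
move=> A; exists (orbit_rep A); split.
  by split; [apply: imset_f|apply/image_edge_same/orbit_rep_same].
move=> A' [A'T /image_edge_same s]; apply: reps_eq; rewrite ?imset_f //.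
exact: same_orbit_trans (same_orbit_sym (orbit_rep_same A)) s.
Qed.

Definition stab A g := (g \in Gam) && (amap g A == A).

(** [comp_v] excludes the boundary because the loop-quotient identifies its two vertices. *)
Record compatible A (k : atom_quotient A) : Prop := Compatible {
  comp_fits : fits p k;
  comp_v : forall x y, x \notin aboundary A ->
    quotient_map k x = quotient_map k y <-> exists2 g, stab A g & avert y = g.1 (avert x);
  comp_d : forall d e, quotient_dmap k d = quotient_dmap k e <->
    exists2 g, stab A g & val e = g.2 (val d);
  comp_b : forall x y, x \in aboundary A -> quotient_map k x = quotient_map k y ->
    exists2 g, g \in Gam & avert y = g.1 (avert x)
}.

Lemma stab_fix A g : stab A g -> g.1 (tail l A) = tail l A -> g = 1.
Proof. by case/andP=> gG _; apply: (fix_vertex semG gG). Qed.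

Lemma boundary_inc A v : v \in boundary A -> exists2 x : vert (reduce l),
  old_vert x = v & inc (e_dart l A (v == tail l A)) = Some x.
Proof.
move=> vA; have : omap (@old_vert R l) (inc (e_dart l A (v == tail l A))) = bend l A (v == tail l
  A).
  exact: (rinc_val conn noloop (e_dart l A _)).
have /eqP -> : bend l A (v == tail l A) == Some v by rewrite bendE // vA eqxx.
by case: (inc _) => //= x [e]; exists x.
Qed.

Lemma stab1 A : stab A 1.
Proof. by rewrite /stab group1 amap1 ?eqxx. Qed.

Lemma hat_proj_swap A : p.2 (e_dart l A true) = p.2 (e_dart l A false) ->
  exists2 g, stab A g & g.1 (tail l A) != tail l A.
Proof.
case/hat_proj_d=> g gG [eA eb]; exists g; first by rewrite /stab gG -eA eqxx.
by apply: contra_eq_neq eb => e; rewrite /hat_b -eA e eqxx.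
Qed.

Lemma halving_cycle A (t s : gperm (agraph A)) : halving t -> s \in <[t]> -> s = 1 \/ s = t.
Proof.
rewrite halvingP => /and4P[_ t1 t2 _].
have o2 : #[t] = 2 by apply/eqP; rewrite order2P t1 t2.
by rewrite cycle2g // in_set2 => /orP[]/eqP; auto.
Qed.

Lemma compatible_half A g (t : gperm (agraph A)) (ht : halving t) : stab A g ->
  g.1 (tail l A) != tail l A -> (forall v : vert (agraph A), avert (t.1 v) = g.1 (avert v)) ->
  (forall d : dart (agraph A), val (t.2 d) = g.2 (val d)) -> compatible (HalfQuotient ht).
Proof.
move=> sg ng t1 t2; have [gG /eqP gA] := andP sg; have gAut := subsetP sGam _ gG.
have tA := tail_boundary l A.
have gt : g.1 (tail l A) \in boundary A by rewrite -{2}gA boundary_amap.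
(* The stabilizer is exactly [1] and [g]: an element either fixes the tail and is trivial, or agrees
   with [g] at the tail and so equals [g]. *)
have only h : stab A h -> h = 1 \/ h = g.
  move=> sh; have [hG /eqP hA] := andP sh; have hAut := subsetP sGam _ hG.
  have hb : h.1 (tail l A) \in boundary A by rewrite -{2}hA boundary_amap.
  case: (boundary_two conn noloop gt tA ng hb) => e; last by left; apply: stab_fix sh e.
  right; apply/eqP; rewrite eq_mulgV1; apply/eqP; apply: (fix_vertex semG (v := tail l A)).
    by rewrite groupM ?groupV.
  by rewrite permM e permK.
have cv (x y : vert (agraph A)) : qproj_v <[t]> x = qproj_v <[t]> y <->
    exists2 g, stab A g & avert y = g.1 (avert x).
  split=> [/eqP/qproj_vP[s st ->]|[h /only[]-> e]].
  - case: (halving_cycle ht st) => ->; last by exists g.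
    by exists 1; [apply: stab1|rewrite !perm1].
  - by rewrite perm1 in e; rewrite (val_inj e).
  apply/eqP/qproj_vP; exists t; first exact: cycle_id.
  by apply: val_inj; rewrite [LHS]e -t1.
have cd (d e : dart (agraph A)) : qproj_d <[t]> d = qproj_d <[t]> e <->
    exists2 g, stab A g & val e = g.2 (val d).
  split=> [/eqP/qproj_dP[s st ->]|[h /only[]-> ed]].
  - case: (halving_cycle ht st) => ->; last by exists g.
    by exists 1; [apply: stab1|rewrite !perm1].
  - by rewrite perm1 in ed; rewrite (val_inj ed).
  apply/eqP/qproj_dP; exists t; first exact: cycle_id.
  by apply: val_inj; rewrite ed -t2.
split.
- rewrite /fits quot_flip; apply/esym/hat_proj_d; exists g => //.
  by rewrite /e_dart /hat_d /hat_b gA ng.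
- by move=> x y _; apply: cv.
- exact: cd.
by move=> x y _ /cv[h /andP[hG _] e]; exists h.
Qed.

(** The stabilizer of [A] is trivial, so the image of [e_A] is not a half-edge; whether its two
    darts have the same incidence decides between loop-quotient and edge-quotient. *)
Lemma compatible_free A : (forall g, stab A g -> g.1 (tail l A) = tail l A) ->
  exists k : atom_quotient A, compatible k.
Proof.
move=> none; have only g : stab A g -> g = 1 by move=> sg; apply: stab_fix (none g sg).
have cv (x y : vert (agraph A)) : x = y <-> exists2 g, stab A g & avert y = g.1 (avert x).
  split=> [->|[g /only->]]; first by exists 1; rewrite ?stab1 ?perm1.
  by rewrite perm1 => /val_inj.
have cd (d e : dart (agraph A)) : d = e <-> exists2 g, stab A g & val e = g.2 (val d).
  split=> [->|[g /only->]]; first by exists 1; rewrite ?stab1 ?perm1.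
  by rewrite perm1 => /val_inj.
have nflip : flip (p.2 (e_dart l A true)) <> p.2 (e_dart l A true).
  rewrite quot_flip => /esym/hat_proj_swap[g sg]; by rewrite none ?eqxx.
case: (eqVneq (inc (p.2 (e_dart l A true))) (inc (flip (p.2 (e_dart l A true))))) => einc.
  exists (LoopQuotient A); split=> //.
    move=> x y xb; split=> [e|/cv->//]; apply/cv; move: e; rewrite /= insubT.
    by case: insubP => // u _ <- [<-].
  (* In the loop case the two boundary vertices have the same projection, which supplies the element
     of [Gam] relating them. *)
  move=> x y xb e; have yb : y \in aboundary A.
    by apply: contraT => yb; move: e; rewrite /= insubF ?xb // insubT.
  have xA : avert x \in boundary A by rewrite inE in xb.
  have yA : avert y \in boundary A by rewrite inE in yb.
  have [x' ex ix] := boundary_inc xA; have [y' ey iy] := boundary_inc yA.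
  have ei b b' : inc (p.2 (e_dart l A b)) = inc (p.2 (e_dart l A b')).
    by move: einc; rewrite quot_flip; case: b; case: b'.
  have := ei (avert x == tail l A) (avert y == tail l A); rewrite !quot_inc ix iy => /Some_inj e'.
  by have := (hat_proj_v x' y').1 e'; rewrite ex ey.
exists (EdgeQuotient A); split=> //; first by split=> //; apply/eqP.
by move=> x y _ /cv[g /andP[gG _] e]; exists g.
Qed.

Lemma compatible_exists A : exists k : atom_quotient A, compatible k.
Proof.
case: (pickP (fun g => stab A g && (g.1 (tail l A) != tail l A))) => [g /andP[sg ng]|none].
  have [gG /eqP gA] := andP sg.
  have [t [ht t1 t2]] := swap_halving conn noloop autR sGam semG gG gA ng.
  by exists (HalfQuotient ht); apply: compatible_half sg ng t1 t2.
apply: compatible_free => g sg; have := none g; rewrite sg /=.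
by move/negbFE/eqP.
Qed.
End Stabilizers.

(** * The expansion is isomorphic to the quotient *)

Section Expand.
Variable R : rooted.
Notation G := (Defs.rgraph R).
Notation c := (center R).
Hypotheses (conn : connected [set: cell G]) (noloop : loopless G).
Hypothesis autR : forall g, g \in Defs.Aut G -> rooted_aut g.
Variable l : labelling R.
Variable Gam : {group gperm G}.
Hypothesis sGam : Gam \subset Defs.Aut G.
Hypothesis semG : semiregular Gam.
Implicit Types (A : atom R) (g : gperm G).

Notation p := (hat_proj conn noloop autR l sGam).
Notation T := (reps Gam).
Variable k : forall A : atom R, atom_quotient A.
Hypothesis kP : forall A, compatible conn noloop autR l sGam (k A).
Notation X := (expansion p T k).
Notation Q := (quot sGam).

(** The [Gam]-orbit represented by a vertex of the expansion, as a relation; together with [over_d]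
    it becomes the required isomorphism. *)
Definition over_v (y : vert X) (O : vert Q) : Prop :=
  match y with
  | inl o => exists2 v : vert (reduce l), o = p.1 v & O = qproj_v Gam (old_vert v)
  | inr w => exists2 u : vert (agraph (val (tag w))),
      val (tagged w) = quotient_map (k (val (tag w))) u & O = qproj_v Gam (avert u)
  end.

Definition over_d (y : dart X) (O : dart Q) : Prop :=
  match y with
  | inl d => exists2 e : {d : dart G | kept_dart d}, val d = p.2 (inl e) & O = qproj_d Gam (val e)
  | inr w => exists2 e : dart (agraph (val (tag w))),
      tagged w = quotient_dmap (k (val (tag w))) e & O = qproj_d Gam (val e)
  end.

Lemma aboundary_ne A : aboundary A != set0.
Proof.
have tA := tail_boundary l A.
apply/set0Pn; exists (sub_vert (boundary_in tA)); by rewrite inE.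
Qed.

Lemma proj_v_aut g (v v' : vert G) : g \in Gam -> v' = g.1 v -> qproj_v Gam v' = qproj_v Gam v.
Proof. by move=> gG ->; apply/esym/eqP/qproj_vP; exists g. Qed.

Lemma proj_d_aut g (d d' : dart G) : g \in Gam -> d' = g.2 d -> qproj_d Gam d' = qproj_d Gam d.
Proof. by move=> gG ->; apply/esym/eqP/qproj_dP; exists g. Qed.

Lemma rep_move A : exists2 g, g \in Gam & amap g A \in T.
Proof.
have /same_orbitP[g gG e] := orbit_rep_same autR Gam A; exists g => //.
by rewrite -e; apply: imset_f.
Qed.

Lemma interior_v (w : {A : {A : atom R | A \in T} & copy_interior k A}) u :
  val (tagged w) = quotient_map (k (val (tag w))) u -> u \notin aboundary (val (tag w)).
Proof.
by move=> e; rewrite -(quotient_map_boundary (k (val (tag w)))) -e; apply: (valP (tagged w)).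
Qed.

Lemma not_kept A (u : vert (agraph A)) : u \notin aboundary A -> ~~ kept_vert (avert u).
Proof.
rewrite inE => ub; apply/negP=> /forallP/(_ A); rewrite (negPf ub) implybF => /negP[].
exact: (valP u).
Qed.

Lemma over_v_ex y : exists O, over_v y O.
Proof.
case: y => [o|w] /=.
  by have [v ->] := qproj_v_surj o; exists (qproj_v Gam (old_vert v)), v.
have [u e] := quotient_map_surj (aboundary_ne _) (valP (tagged w)).
by exists (qproj_v Gam (avert u)), u.
Qed.

Lemma over_v_fun y O O' : over_v y O -> over_v y O' -> O = O'.
Proof.
case: y => [o|w] /= [v e ->] [v' e' ->].
  have [g gG eg] := (hat_proj_v conn noloop autR sGam v v').1 (etrans (esym e) e').
  exact/esym/(proj_v_aut gG eg).
have ub := interior_v e; have [g /andP[gG _] eg] := (comp_v (kP _) v' ub).1 (etrans (esym e) e').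
exact/esym/(proj_v_aut gG eg).
Qed.

(** An interior vertex lies in only one atom, so [g] carries [A] to [A']; being selected
    representatives of one orbit, they are equal. *)
Lemma same_atom (A A' : {A : atom R | A \in T}) g v : g \in Gam ->
  inl v \in val (val A) -> inl (g.1 v) \in val (val A') -> g.1 v \notin boundary (val A') ->
  A = A' /\ stab Gam (val A) g.
Proof.
move=> gG vA vA' vb; have gA := subsetP sGam _ gG.
have vA2 : inl (g.1 v) \in val (amap g (val A)) by rewrite mem_amap_v.
have e : amap g (val A) = val A'.
  apply/eqP; apply: contraNT vb => n; apply: (shared_boundary conn noloop) vA2 _ => //.
  by rewrite eq_sym.
have eA : val A = val A'.
  apply: (reps_eq autR sGam (valP A) (valP A')); apply/same_orbitP; exists g => //.
split; first exact: val_inj.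
by rewrite /stab gG e eA eqxx.
Qed.

Lemma over_v_inj y y' O : over_v y O -> over_v y' O -> y = y'.
Proof.
case: y y' => [o|[A w]] [o'|[A' w']] /= [v e ->] [v' e' /eqP/qproj_vP[g gG eg]].
- by congr inl; rewrite e e'; apply/hat_proj_v; exists g.
- have := not_kept (interior_v (w := Tagged (copy_interior k) w') e').
  rewrite eg kept_vert_aut ?(subsetP sGam) //; case/negP; exact: (valP (v : rvert R)).
- have := not_kept (interior_v (w := Tagged (copy_interior k) w) e).
  rewrite -(kept_vert_aut autR _ (subsetP sGam _ gG)) -eg; case/negP; exact: (valP (v' : rvert R)).
have ub := interior_v (w := Tagged (copy_interior k) w) e;
  have ub' := interior_v (w := Tagged (copy_interior k) w') e'.
have [||eA sg] := same_atom (A := A) (A' := A') gG (valP v) _ _.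
- by rewrite -eg; apply: (valP v').
- by rewrite -eg; move: ub'; rewrite inE.
case: A' / eA w' v' e' eg ub' => w' v' e' eg ub'.
congr (inr (existT _ _ _)); apply: val_inj; apply: (etrans e (etrans _ (esym e'))).
by apply/(comp_v (kP _)) => //; exists g.
Qed.

Lemma over_v_surj O : exists y, over_v y O.
Proof.
have [v ->] := qproj_v_surj O; case: (boolP (kept_vert v)) => [kv|].
  by exists (inl (p.1 (exist (fun v => is_true (kept_vert v)) v kv : vert (reduce l)))),
    (exist (fun v => is_true (kept_vert v)) v kv).
case/forallPn=> A; rewrite negb_imply => /andP[vA vb].
(* Only representatives have a copy in the expansion, so [v] is moved into the representative of its
   atom. *)
have [g gG gT] := rep_move A; have gAut := subsetP sGam _ gG.
have gv : inl (g.1 v) \in val (amap g A) by rewrite mem_amap_v.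
pose u : vert (agraph (amap g A)) := sub_vert gv.
have ub : u \notin aboundary (amap g A) by rewrite inE /avert /= boundary_amap.
have qb : quotient_map (k (amap g A)) u \notin quotient_boundary (k (amap g A)).
  by rewrite quotient_map_boundary.
pose A' : {A : atom R | A \in T} := exist (fun A => is_true (A \in T)) _ gT.
pose w : copy_interior k A' := exist (fun w => is_true (w \notin quotient_boundary (k (amap g A))))
  _ qb.
exists (inr (Tagged (copy_interior k) w)), u => //.
exact/esym/(proj_v_aut gG).
Qed.

Lemma over_d_ex y : exists O, over_d y O.
Proof.
case: y => [d|w] /=; last first.
  by have [e ->] := quotient_dmap_surj (tagged w); exists (qproj_d Gam (val e)), e.
have [x ex] := qproj_d_surj (val d).
case: x ex => [e|[A b]] ex; first by exists (qproj_d Gam (val e)), e.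
case/negP: (valP d); apply/existsP; exists A; rewrite image_edgeE ex !inE.
by case: b ex => _; rewrite eqxx ?orbT.
Qed.

Lemma over_d_fun y O O' : over_d y O -> over_d y O' -> O = O'.
Proof.
case: y => [d|w] /= [v e ->] [v' e' ->].
  have [g gG eg] := (hat_proj_d conn noloop autR sGam (inl v) (inl v')).1 (etrans (esym e) e').
  case: eg => eg; apply/esym; apply: (proj_d_aut gG).
  by rewrite eg val_hat_k // (subsetP sGam).
have [g /andP[gG _] eg] := (comp_d (kP _) v v').1 (etrans (esym e) e').
exact/esym/(proj_d_aut gG eg).
Qed.

Lemma over_d_inj y y' O : over_d y O -> over_d y' O -> y = y'.
Proof.
case: y y' => [d|[A w]] [d'|[A' w']] [v e ->] [v' e' /eqP/qproj_dP[g gG eg]];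
  have gAut := subsetP sGam _ gG.
- congr inl; apply: val_inj; apply: (etrans e (etrans _ (esym e'))); apply/hat_proj_d;
    exists g => //.
  change (inl v' = inl (hat_k g v) :> rdart R).
  by congr inl; apply: val_inj; rewrite eg val_hat_k.
- have := valP v; rewrite -(kept_dart_aut autR _ gAut) -eg => /forallP/(_ (val A'))/negP[].
  exact: (valP v').
- have := valP v'; rewrite eg kept_dart_aut // => /forallP/(_ (val A))/negP[].
  exact: (valP v).
have dA : inr (val v') \in val (amap g (val A)) by rewrite eg mem_amap_d //; apply: (valP v).
have eg2 : amap g (val A) = val A' := atom_eq conn noloop dA (valP v').
have eA : A = A'.
  apply: val_inj; apply: (reps_eq autR sGam (valP A) (valP A')); apply/same_orbitP; exists g => //.
case: A' / eA w' v' e' eg {dA} eg2 => w' v' e' eg eg2.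
congr (inr (existT _ _ _)); apply: (etrans e (etrans _ (esym e'))).
by apply/(comp_d (kP _)); exists g; rewrite // /stab gG eg2 eqxx.
Qed.

Lemma over_d_surj O : exists y, over_d y O.
Proof.
have [d ->] := qproj_d_surj O; case: (boolP (kept_dart d)) => [kd|].
  pose e : {d : dart G | kept_dart d} := exist (fun d => is_true (kept_dart d)) d kd.
  have nr : ~~ replaced p (p.2 (inl e)).
    apply/negP=> /existsP[A]; rewrite image_edgeE !inE => /orP[]/eqP/hat_proj_d[g _]; by [].
  by exists (inl (exist (fun d => is_true (~~ replaced p d)) _ nr)), e.
case/forallPn=> A; rewrite negbK => dA.
have [g gG gT] := rep_move A; have gAut := subsetP sGam _ gG.
have gd : inr (g.2 d) \in val (amap g A) by rewrite mem_amap_d.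
pose A' : {A : atom R | A \in T} := exist (fun A => is_true (A \in T)) _ gT.
exists (inr (Tagged (fun B : {A : atom R | A \in T} =>
  dart (copy k B)) (quotient_dmap (k (val A')) (sub_dart gd)))), (sub_dart gd) => //.
exact/esym/(proj_d_aut gG).
Qed.

Lemma glue_interior (A : {A : atom R | A \in T}) u (ub : u \notin aboundary (val A)) :
  exists2 w : copy_interior k A, val w = quotient_map (k (val A)) u &
    glue p (k := k) (quotient_map (k (val A)) u) = Some (inr (Tagged (copy_interior k) w)).
Proof.
rewrite -(quotient_map_boundary (k (val A))) in ub.
pose w : copy_interior k A := exist (fun w => is_true (w \notin quotient_boundary (k (val A)))) _
  ub.
by exists w => //; rewrite /glue insubT.
Qed.

(** The [pick] in [glue] may choose a boundary vertex other than [u] with the same image in the atom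
    quotient; by [comp_b] both lie in the same [Gam]-orbit. *)
Lemma over_glue (phi : vert X -> vert Q) : (forall y, over_v y (phi y)) ->
  forall (A : {A : atom R | A \in T}) u,
  omap phi (glue p (quotient_map (k (val A)) u)) = Some (qproj_v Gam (avert u)).
Proof.
move=> phiP A u; case: (boolP (u \in aboundary (val A))) => ub; last first.
  have [w ew ->] := glue_interior ub; congr Some.
  apply: over_v_fun (phiP _) _; by exists u.
rewrite /glue insubF; last by rewrite quotient_map_boundary ub.
case: pickP => [x /existsP[b /and3P[bA /eqP bx /eqP qb]]|none] /=; last first.
  have ubA : avert u \in boundary (val A) by rewrite inE in ub.
  have [x ex _] := boundary_inc conn noloop l ubA.
  by case/existsP: (negbT (none x)); exists u; rewrite ub ex !eqxx.
congr Some; have [g gG eg] := comp_b (kP (val A)) bA qb.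
apply: (over_v_fun (phiP (inl (p.1 x)))); exists x => //.
by rewrite -bx; apply: proj_v_aut eg.
Qed.

Lemma kept_not_replaced (e : {d : dart G | kept_dart d}) : ~~ replaced p (p.2 (inl e)).
Proof.
by apply/negP=> /existsP[A]; rewrite image_edgeE !inE => /orP[]/eqP/hat_proj_d[g _].
Qed.

Lemma expansion_isomorphic : isomorphic X Q.
Proof.
have [phi bphi phiP] := bijection_of_relation over_v_ex over_v_surj over_v_fun over_v_inj.
have [psi bpsi psiP] := bijection_of_relation over_d_ex over_d_surj over_d_fun over_d_inj.
exists (phi, psi); split=> //; apply/preservesP=> y.
have psiE y' O : over_d y' O -> psi y' = O by apply: over_d_fun.
have := psiP y; case: y => [d|[A d]] [e ed eO]; rewrite [_.2 _]eO.
  have ee : val (flip_on e) = flip (val e) by rewrite flip_onE kept_flip // (valP e).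
  have ef : flip (val d) = p.2 (inl (flip_on e)) by rewrite ed; apply: quot_flip.
  have ce : color (inl d : dart X) = color (val e) by change (color (val d) = color (val e));
    rewrite ed; apply: quot_color.
  have ke : kind (inl d : dart X) = kind (val e) by change (kind (val d) = kind (val e));
    rewrite ed; apply: quot_kind.
  split.
  - have hi : omap (@old_vert R l) (inc (inl e : dart (reduce l))) = inc (val e).
      exact: (rinc_val conn noloop (inl e : dart (reduce l))).
    have hd : inc (inl d : dart X) = omap inl (omap p.1 (inc (inl e : dart (reduce l)))).
      by apply: (congr1 (omap _)); rewrite ed; apply: quot_inc.
    rewrite quot_inc -hi hd; case: (inc _) => //= v; congr Some; apply/esym.
    by apply: (over_v_fun (phiP _)); exists v.
  - rewrite quot_flip; apply: psiE; exists (flip_on e); last by rewrite ee.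
    by rewrite flip_onE ef kept_not_replaced.
  - by rewrite quot_color ce.
  - by rewrite quot_kind ke.
  rewrite ke => kd; rewrite quot_fwd //; change (fwd (val e) = fwd (val d)).
  by rewrite ed; apply/esym; apply: quot_fwd.
have [d1 d2 d3 d4 d5] := quotient_dmapP (k (val A)) e.
have {}ed : d = quotient_dmap (k (val A)) e by exact: ed.
have sA := atom_subgraph (valP (val A)).
split.
- have hd : inc (inr (Tagged (fun B : {A : atom R | A \in T} => dart (copy k B)) d) : dart X) =
      obind (@glue _ _ _ p _ k A) (inc d) by [].
  rewrite quot_inc hd ed d1 -(sub_graph_inc sA); case: (inc e) => //= v.
  by rewrite over_glue.
- rewrite quot_flip; apply: psiE; exists (flip e); last by rewrite (sub_graph_flip sA).
  by rewrite /= ed d2.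
- by rewrite quot_color /= ed d3.
- by rewrite quot_kind /= ed d4.
move=> kd; rewrite quot_fwd /= ?ed ?d5 //; by move: kd; rewrite /= ed d4.
Qed.

End Expand.

(** * Lifting automorphisms of the reduced graph *)

Section Reduced.
Variable R : rooted.
Notation G := (Defs.rgraph R).
Hypotheses (conn : connected [set: cell G]) (noloop : loopless G) (nohalf : no_half_edge G).
Variable l : labelling R.
Notation Gr := (Defs.rgraph (reduce l)).
Implicit Types (A : atom R).

Lemma boundary_kept A v : v \in boundary A -> exists2 x : vert (reduce l),
  old_vert x = v & inc (e_dart l A (v == tail l A)) = Some x.
Proof. exact: boundary_inc. Qed.

Lemma kept_in_boundary A (x : vert (reduce l)) : inl (old_vert x) \in val A ->
  old_vert x \in boundary A.
Proof. exact: (implyP (forallP (valP (x : rvert R)) A)). Qed.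

Lemma interior_not_kept A v : inl v \in val A -> v \notin boundary A -> ~~ kept_vert v.
Proof. by move=> vA vb; apply/negP=> /forallP/(_ A)/implyP/(_ vA); rewrite (negPf vb). Qed.

Lemma reduce_inl_inc (k : {d : dart R | kept_dart d}) :
  omap (@old_vert R l) (inc (inl k : dart (reduce l))) = inc (val k).
Proof. exact: (rinc_val conn noloop (inl k : dart (reduce l))). Qed.

Lemma reduce_inr_inc A b : omap (@old_vert R l) (inc (e_dart l A b)) = bend l A b.
Proof. exact: (rinc_val conn noloop (e_dart l A b)). Qed.

(** By [bendE], a vertex carrying both darts of [e_A] would both be and not be the tail of [A]. *)
Lemma reduce_loopless : loopless (reduce l).
Proof.
move=> x v ex ef; have ov y : inc y = Some v -> omap (@old_vert R l) (inc y) = Some (old_vert v).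
  by move=> ->.
case: x ex ef => [k|[A b]] /ov ex /ov ef.
  move: ex ef; rewrite (reduce_inl_inc k) (reduce_inl_inc (flip_on k)) flip_onE kept_flip (valP k).
  exact: noloop.
move: ex ef; rewrite (reduce_inr_inc A b) (reduce_inr_inc A (~~ b)) => /eqP + /eqP.
rewrite !bendE // => /andP[_ /eqP->] /andP[_]; by case: b.
Qed.

Lemma reduce_no_half : no_half_edge (reduce l).
Proof.
move=> [k|[A b]] [] /=; last by case: b.
by move/(congr1 val); rewrite flip_onE kept_flip (valP k); apply: nohalf.
Qed.

(** A cell absorbed by an atom is related to both darts of [e_A]. The image is thus determined only
    up to reachability, which is enough to carry walks of [G] to the reduced graph. *)
Definition image_cell (x : cell G) (y : cell Gr) : Prop :=
  match x with
  | inl v => (exists2 v' : vert (reduce l), old_vert v' = v & y = inl v') \/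
     (exists A b, [/\ inl v \in val A, v \notin boundary A & y = inr (e_dart l A b)])
  | inr d => (exists2 k : {d : dart R | kept_dart d},
    val k = d & y = inr (inl k : dart (reduce l))) \/
     (exists A b, inr d \in val A /\ y = inr (e_dart l A b))
  end.

Notation reaches y y' := (reach [set: cell Gr] y y').

Lemma reach_e_dart A b b' : reaches (inr (e_dart l A b)) (inr (e_dart l A b')).
Proof.
case: (eqVneq b b') => [->|nb]; first exact: reach0.
apply: reach1; rewrite ?inE //=; apply/eqP; congr (inr (_, _)).
by case: b b' nb => [] [].
Qed.

Lemma image_cell_ex x : exists y, image_cell x y.
Proof.
case: x => [v|d] /=.
  case: (boolP (kept_vert v)) => [kv|/forallPn[A]].
    pose v' : vert (reduce l) := exist (fun v => is_true (kept_vert v)) v kv.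
    by exists (inl v'); left; exists v'.
  by rewrite negb_imply => /andP[vA vb]; exists (inr (e_dart l A true)); right; exists A, true.
case: (boolP (kept_dart d)) => [kd|/forallPn[A]].
  pose k : {d : dart R | kept_dart d} := exist (fun d => is_true (kept_dart d)) d kd.
  by exists (inr (inl k : dart (reduce l))); left; exists k.
by rewrite negbK => dA; exists (inr (e_dart l A true)); right; exists A, true.
Qed.

Lemma image_cell_reach x y y' : image_cell x y -> image_cell x y' -> reaches y y'.
Proof.
case: x => [v|d] [[a ea ->]|[A [b h]]] [[a' ea' ->]|[A' [b' h']]].
- by rewrite -ea' in ea; rewrite (old_vert_inj ea); apply: reach0.
- case: h' => vA vb _; have := interior_not_kept vA vb.
  by rewrite -ea (valP (a : rvert R)).
- case: h => vA vb _; have := interior_not_kept vA vb.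
  by rewrite -ea' (valP (a' : rvert R)).
- move: h h' => [vA vb ->] [vA' vb' ->].
  have -> : A = A' by apply/eqP; apply: contraNT vb; apply: (shared_boundary conn noloop).
  exact: reach_e_dart.
- by rewrite -ea' in ea; rewrite (val_inj ea); apply: reach0.
- by case: h' => dA _; have /forallP/(_ A') := valP a; rewrite ea dA.
- by case: h => dA _; have /forallP/(_ A) := valP a'; rewrite ea' dA.
by move: h h' => [dA ->] [dA' ->]; rewrite (atom_eq conn noloop dA dA'); apply: reach_e_dart.
Qed.

Lemma kept_not_in_atom (k : {d : dart R | kept_dart d}) A : inr (val k) \notin val A.
Proof. exact: (forallP (valP k)). Qed.

Lemma image_cell_inc d v y y' : inc d = Some v -> image_cell (inr d) y -> image_cell (inl v) y' ->
  reaches y y'.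
Proof.
move=> e [[k ek ->]|[A [b [dA ->]]]] [[v' ev ->]|[A' [b' [vA vb ->]]]].
- have ei : inc (inl k : dart (reduce l)) = Some v'.
    by apply: (inj_omap (@old_vert_inj R l)); rewrite reduce_inl_inc ek e /= ev.
  by apply: reach_inc ei; rewrite inE.
- by have := kept_not_in_atom k A'; rewrite ek (interior_dart vA vb e).
(* A kept vertex in an atom is on its boundary, so one of the two darts of [e_A] is attached
   there. *)
- have vA : inl (old_vert v') \in val A by rewrite ev; apply: subgraph_inc e => //;
    apply: atom_subgraph (valP A).
  have [x ex ix] := boundary_kept (kept_in_boundary vA).
  apply: reach_trans (reach_e_dart A b (old_vert v' == tail l A)) _.
  by rewrite (old_vert_inj ex) in ix; apply: reach_inc ix; rewrite inE.
by rewrite (atom_eq conn noloop dA (interior_dart vA vb e)); apply: reach_e_dart.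
Qed.

Lemma image_cell_link x x' y y' : link x x' -> image_cell x y -> image_cell x' y' -> reaches y y'.
Proof.
case: x => [v|d].
  by case/link_vertP=> d e -> hy hy'; rewrite reach_sym; apply: image_cell_inc e hy' hy.
case/link_dartP=> [->|[v e ->]]; last exact: image_cell_inc.
move=> [[k ek ->]|[A [b [dA ->]]]] hy'; last first.
  apply: image_cell_reach hy'; right; exists A, b; split=> //.
  by apply: subgraph_flip dA; apply: atom_subgraph (valP A).
have hk : image_cell (inr (flip d)) (inr (inl (flip_on k) : dart (reduce l))).
  by left; exists (flip_on k); rewrite // flip_onE kept_flip // (valP k) ek.
by apply: reach_trans (image_cell_reach hk hy'); apply: reach1; rewrite ?inE //=.
Qed.

Lemma image_cell_surj y : exists x, image_cell x y.
Proof.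
case: y => [v|[k|[A b]]]; first by exists (inl (old_vert v)); left; exists v.
  by exists (inr (val k)); left; exists k.
have [d dA _] := atom_has_dart conn (valP A) (boundary_in (tail_boundary l A)).
by exists (inr d); right; exists A, b.
Qed.

Lemma reduce_connected : connected [set: cell Gr].
Proof.
apply/connectedP=> y y' _ _; have [x hx] := image_cell_surj y; have [x' hx'] := image_cell_surj y'.
suff h : forall y'', image_cell x' y'' -> reaches y y'' by apply: h.
apply: (@reach_ind _ _ (fun x' => forall y'', image_cell x' y'' ->
  reaches y y'') _ _ _ (reachT conn x x')).
  move=> a b IH _ _ ab y2 hb; have [y1 ha] := image_cell_ex a.
  exact: reach_trans (IH _ ha) (image_cell_link ab ha hb).
by move=> y2 hy2; apply: image_cell_reach hx hy2.
Qed.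

(** * Lifting a single automorphism *)

Section Lift.
Variable pi : gperm (reduce l).
Hypothesis piA : pi \in Defs.Aut (reduce l).

(** The colours of the new edges are fresh, so an automorphism cannot mix them with the kept
    ones. *)
Lemma pi_kept (k : {d : dart R | kept_dart d}) : exists k' : {d : dart R | kept_dart d},
  pi.2 (inl k : dart (reduce l)) = inl k'.
Proof.
case e: (pi.2 _) => [k'|[A b]]; first by exists k'.
have [_ _ + _ _] := autP piA (inl k : dart (reduce l)); rewrite e => h.
by case: (@new_color_fresh _ l A (val k)).
Qed.

Lemma pi_e_dart A : exists A' s, forall b, pi.2 (e_dart l A b) = e_dart l A' (b (+) s).
Proof.
case e: (pi.2 (e_dart l A true)) => [k|[A' s]].
  have [_ _ + _ _] := autP piA (e_dart l A true); rewrite e.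
  by move=> h; case: (@new_color_fresh _ l A (val k)).
exists A', (~~ s); case; first by rewrite e /= negbK.
have [_ + _ _ _] := autP piA (e_dart l A true); rewrite e /= => h.
by rewrite [LHS]h.
Qed.

Lemma pi_inc (x : dart (reduce l)) : inc (pi.2 x) = omap pi.1 (inc x).
Proof. exact: aut_inc. Qed.

Definition agrees A A' (f : gmap (agraph A) (agraph A')) :=
  forall (w : vert (agraph A)) (x : vert (reduce l)), avert w = old_vert x ->
    avert (f.1 w) = old_vert (pi.1 x).

(** A boundary isomorphism either agrees with [pi] at the boundary of [A], or does so after
    exchanging the two boundary vertices. *)
Lemma lift_atom A : exists A', (exists s, forall b, pi.2 (e_dart l A b) = e_dart l A' (b (+) s)) /\
  exists f : gmap (agraph A) (agraph A'), boundary_iso f /\ agrees f.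
Proof.
have [A' [s hs]] := pi_e_dart A; exists A'; split; first by exists s.
have cA : new_color l A = new_color l A'.
  by have [_ _ + _ _] := autP piA (e_dart l A true); rewrite hs => /esym.
have [f bf] := (new_colorP l A A').1 cA.
have tA := tail_boundary l A; have [t et it] := boundary_kept tA; rewrite eqxx in it.
have pit (x : vert (reduce l)) : old_vert x \in boundary A -> old_vert (pi.1 x) \in boundary A' /\
    ((old_vert (pi.1 x) == tail l A') = (old_vert x == tail l A) (+) s).
  move=> xA; have [x' ex ix] := boundary_kept xA; rewrite (old_vert_inj ex) in ix.
  have := reduce_inr_inc A' ((old_vert x == tail l A) (+) s); rewrite -hs pi_inc ix /= => /esym/eqP.
  by rewrite bendE // => /andP[-> /eqP].
have inb (w : vert (agraph A)) (x : vert (reduce l)) : avert w = old_vert x ->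
  old_vert x \in boundary A.
  by move=> ew; apply: kept_in_boundary; rewrite -ew; apply: (valP w).
have fb (w : vert (agraph A)) (x : vert (reduce l)) : avert w = old_vert x ->
  avert (f.1 w) \in boundary A'.
  by move=> ew; have := boundary_isoP bf w; rewrite !inE ew (inb _ _ ew).
pose wt : vert (agraph A) := sub_vert (boundary_in tA).
have wtE : avert wt = old_vert t by rewrite et.
(* With at most two boundary vertices, agreement at the tail forces agreement at the other one by
   injectivity. *)
have agree_at_tail (h : gmap (agraph A) (agraph A')) : boundary_iso h ->
    avert (h.1 wt) = old_vert (pi.1 t) -> agrees h.
  move=> bh ht w x ew; case: (eqVneq x t) => [ext|xt].
    by rewrite ext -ht; congr (avert (h.1 _)); apply: val_inj; rewrite /= -/(avert w) ew ext et.
  have xA := inb _ _ ew; have xt' : old_vert x != tail l A by rewrite -et (inj_eq (@old_vert_inj R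
    l)).
  have [p1 _] := pit x xA; have tA2 : old_vert t \in boundary A by rewrite et.
  have [p2 _] := pit t tA2.
  have hw : avert (h.1 w) \in boundary A' by have := boundary_isoP bh w; rewrite !inE ew xA.
  have ne : old_vert (pi.1 x) != old_vert (pi.1 t).
    by rewrite (inj_eq (@old_vert_inj R l)) (inj_eq (@perm_inj _ _)).
  case: (boundary_two conn noloop p1 p2 ne hw) => // hwt.
  have [[b1 _ _] _] := bh; have : h.1 w = h.1 wt by apply: val_inj; rewrite -/(avert _) hwt -ht.
  move/(bij_inj b1) => wwt; move: ew; rewrite wwt wtE => /(@old_vert_inj R l) tx.
  by rewrite tx eqxx in xt.
case: (eqVneq (avert (f.1 wt)) (old_vert (pi.1 t))) => [ok|bad]; first by exists f; split=> //;
  apply: agree_at_tail.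
have tA2 : old_vert t \in boundary A by rewrite et.
have [p2 pt] := pit t tA2; have fA := fb wt t wtE.
(* An automorphism of [A] exchanging its boundary exists whenever [f] disagrees at the tail: this is
   the meaning of the types halvable and symmetric. A block atom has no other boundary vertex to
   disagree with, and in the directed case orientation and [tail_iso] force agreement. *)
have [g [hg1 hg2]] : exists g : gperm (agraph A), exchanging g /\ true.
  case kA: (atom_kind A).
  - move: kA; rewrite /atom_kind; case: ifP => // _; case: ifP => [/existsP[g /andP[hg _]] _|_].
      by exists g.
    by case: ifP.
  - move: kA; rewrite /atom_kind; case: ifP => [bA _|_]; last first.
      by case: ifP => // _; case: ifP => // /existsP[g hg]; exists g.
    case/eqP: bad.
    have [[[f1 K K'] _ _] _] := bf; pose q : vert (agraph A') := sub_vert (boundary_in p2).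
    have qA : avert (f1 q) \in boundary A.
      by have := boundary_isoP bf (f1 q); rewrite K' !inE => <-.
    have qw : avert (f1 q) = avert wt := card_le1_eqP (card_boundary_block conn noloop bA) _ _ tA
      qA.
    by rewrite -(val_inj qw) K'.
  - case/eqP: bad; have [_ _ _ _ h] := autP piA (e_dart l A true).
    have := h kA; rewrite hs /= => s0.
    have := tail_iso (l := l) kA bf (v := wt) erefl.
    by move=> ->; apply/eqP; rewrite eq_sym pt et eqxx; case: (s) s0.
have [gA gb gn] := exchangingP _ hg1.
have bg : @boundary_iso R A A (fun v => g.1 v, fun d => g.2 d).
  apply: boundary_iso_def => //; split=> /=; [exact: injF_bij perm_inj|exact: injF_bij perm_inj|].
  by move: gA; rewrite [_ \in Defs.Aut _]inE.
have wb : wt \in aboundary A by rewrite inE.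
exists ((f.1 \o g.1), (f.2 \o g.2)); split; first exact: (boundary_iso_comp bg bf).
apply: agree_at_tail; first exact: (boundary_iso_comp bg bf).
have fg : avert (f.1 (g.1 wt)) \in boundary A'.
  by have := boundary_isoP bf (g.1 wt); rewrite gb wb inE.
case: (boundary_two conn noloop fA p2 bad fg) => // e.
have [[b1 _ _] _] := bf; have := gn wt wb; rewrite -(inj_eq (bij_inj b1)).
by rewrite (val_inj e) eqxx.
Qed.
Section Glue.
Variable m : atom R -> atom R.
Hypothesis mP : forall A, exists s, forall b, pi.2 (e_dart l A b) = e_dart l (m A) (b (+) s).
Variable f : forall A, gmap (agraph A) (agraph (m A)).
Hypothesis bf : forall A, boundary_iso (f A).
Hypothesis af : forall A, agrees (f A).

Lemma m_inj : injective m.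
Proof.
move=> A A' e; have [s hs] := mP A; have [s' hs'] := mP A'.
have : pi.2 (e_dart l A (s)) = pi.2 (e_dart l A' s') by rewrite hs hs' e !addbb.
by move/perm_inj=> [].
Qed.

(** Kept vertices follow [pi] and interior ones the chosen boundary isomorphism. Excluding the
    boundary in the second case makes the cases disjoint; [agrees] makes them fit together along the
    boundary. *)
Definition lift_v (v v2 : vert G) : Prop :=
  (exists2 x : vert (reduce l), v = old_vert x & v2 = old_vert (pi.1 x)) \/
  (exists A, exists2 w : vert (agraph A), w \notin aboundary A /\
    v = avert w & v2 = avert ((f A).1 w)).

Definition lift_d (d d2 : dart G) : Prop :=
  (exists k k' : {d : dart R | kept_dart d}, [/\ pi.2 (inl k : dart (reduce l)) = inl k',
    d = val k & d2 = val k']) \/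
  (exists A, exists2 e : dart (agraph A), d = val e & d2 = val ((f A).2 e)).

Lemma kept_sub v : kept_vert v -> exists x : vert (reduce l), v = old_vert x.
Proof. by move=> kv; exists (exist (fun v => is_true (kept_vert v)) v kv). Qed.

Lemma kept_dart_sub (d : dart G) : kept_dart d -> exists k : {d : dart R | kept_dart d}, d = val k.
Proof. by move=> kd; exists (exist (fun d => is_true (kept_dart d)) d kd). Qed.

Lemma not_kept_sub v : ~~ kept_vert v -> exists A, exists2 w : vert (agraph A),
  w \notin aboundary A & v = avert w.
Proof.
case/forallPn=> A; rewrite negb_imply => /andP[vA vb]; exists A, (sub_vert vA) => //.
by rewrite inE.
Qed.

Lemma not_kept_dart_sub (d : dart G) : ~~ kept_dart d -> exists A, exists e : dart (agraph A),
  d = val e.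
Proof. by case/forallPn=> A; rewrite negbK => dA; exists A, (sub_dart dA). Qed.

Lemma interior_sub A (w : vert (agraph A)) (x : vert (reduce l)) : w \notin aboundary A ->
  avert w <> old_vert x.
Proof.
rewrite inE => wb e; have := interior_not_kept (valP w) wb; rewrite -/(avert w) e.
by rewrite (valP (x : rvert R)).
Qed.

Lemma f_interior A (w : vert (agraph A)) : w \notin aboundary A -> (f A).1 w \notin aboundary (m A).
Proof. by rewrite (boundary_isoP (bf A)). Qed.

Lemma interior_atom A A' (w : vert (agraph A)) (w' : vert (agraph A')) : w \notin aboundary A ->
  avert w = avert w' -> A = A'.
Proof.
rewrite inE => wb e; apply/eqP; apply: contraNT wb; apply: (shared_boundary conn noloop) (valP w) _.
by rewrite -/(avert w) e; apply: (valP w').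
Qed.

Lemma lift_v_ex v : exists v2, lift_v v v2.
Proof.
case: (boolP (kept_vert v)) => [/kept_sub[x e]|/not_kept_sub[A [w wb e]]].
  by exists (old_vert (pi.1 x)); left; exists x.
by exists (avert ((f A).1 w)); right; exists A, w.
Qed.

Lemma m_surj A : exists A', A = m A'.
Proof. by have [h K K'] := injF_bij m_inj; exists (h A). Qed.

Lemma f_surj_v A w : exists u, w = (f A).1 u.
Proof. by have [[[h K K'] _ _] _] := bf A; exists (h w). Qed.

Lemma f_surj_d A e : exists e', e = (f A).2 e'.
Proof. by have [[_ [h K K'] _] _] := bf A; exists (h e). Qed.

Lemma lift_v_surj v2 : exists v, lift_v v v2.
Proof.
case: (boolP (kept_vert v2)) => [/kept_sub[x ->]|/not_kept_sub[A2 [w wb ->]]].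
  by exists (old_vert (pi.1^-1 x)%g); left; exists (pi.1^-1 x)%g; rewrite ?permKV.
have [A eA] := m_surj A2; subst A2; have [u eu] := f_surj_v w.
exists (avert u); right; exists A, u; rewrite ?eu //; split=> //.
by rewrite -(boundary_isoP (bf A)) -eu.
Qed.

Lemma lift_v_fun v v2 v2' : lift_v v v2 -> lift_v v v2' -> v2 = v2'.
Proof.
move=> [[x ex ->]|[A [w [wb ew] ->]]] [[x' ex' ->]|[A' [w' [wb' ew'] ->]]].
- by congr (old_vert (pi.1 _)); apply: old_vert_inj; rewrite -ex.
- by case: (interior_sub (x := x) wb'); rewrite -ew' -ex.
- by case: (interior_sub (x := x') wb); rewrite -ew -ex'.
have e : avert w = avert w' by rewrite -ew.
have eA := interior_atom wb e; case: A' / eA w' wb' ew' e => w' wb' ew' e.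
by rewrite (val_inj e).
Qed.

Lemma lift_v_inj v v' v2 : lift_v v v2 -> lift_v v' v2 -> v = v'.
Proof.
move=> [[x -> ex]|[A [w [wb ->] ew]]] [[x' -> ex']|[A' [w' [wb' ->] ew']]].
- by congr old_vert; apply: (@perm_inj _ pi.1); apply: old_vert_inj; rewrite -ex.
- by case: (interior_sub (x := pi.1 x) (f_interior wb')); rewrite -ew' -ex.
- by case: (interior_sub (x := pi.1 x') (f_interior wb)); rewrite -ew -ex'.
have e : avert ((f A).1 w) = avert ((f A').1 w') by rewrite -ew.
have eA := m_inj (interior_atom (f_interior wb) e).
case: A' / eA w' wb' ew' e => w' wb' ew' /val_inj e.
by have [[b _ _] _] := bf A; rewrite (bij_inj b e).
Qed.

Lemma lift_d_ex d : exists d2, lift_d d d2.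
Proof.
case: (boolP (kept_dart d)) => [/kept_dart_sub[k e]|/not_kept_dart_sub[A [w e]]].
  by have [k' ek] := pi_kept k; exists (val k'); left; exists k, k'.
by exists (val ((f A).2 w)); right; exists A, w.
Qed.

Lemma lift_d_surj d2 : exists d, lift_d d d2.
Proof.
case: (boolP (kept_dart d2)) => [/kept_dart_sub[k ->]|/not_kept_dart_sub[A2 [w ->]]].
  case e: (pi.2^-1 (inl k : dart (reduce l)))%g => [k'|[A b]].
    by exists (val k'); left; exists k', k; rewrite -e permKV.
  have [s hs] := mP A; have := hs b.
  by rewrite /e_dart -[inr (A, b)]e permKV.
have [A eA] := m_surj A2; subst A2; have [u eu] := f_surj_d w.
by exists (val u); right; exists A, u; rewrite ?eu.
Qed.

Lemma lift_d_fun d d2 d2' : lift_d d d2 -> lift_d d d2' -> d2 = d2'.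
Proof.
move=> [[k [k2 [ek ed ->]]]|[A [e ed ->]]] [[k' [k2' [ek' ed' ->]]]|[A' [e' ed' ->]]].
- have kk : k = k' by apply: val_inj; rewrite -ed.
  by move: ek; rewrite kk ek' => -[->].
- by have := kept_not_in_atom k A'; rewrite -ed ed' (valP e').
- by have := kept_not_in_atom k' A; rewrite -ed' ed (valP e).
have ee : val e = val e' by rewrite -ed.
have eA : A = A' by apply: (atom_eq conn noloop (valP e)); rewrite ee; apply: (valP e').
by case: A' / eA e' ed' ee => e' ed' /val_inj->.
Qed.

Lemma lift_d_inj d d' d2 : lift_d d d2 -> lift_d d' d2 -> d = d'.
Proof.
move=> [[k [k2 [ek -> ed]]]|[A [e -> ed]]] [[k' [k2' [ek' -> ed']]]|[A' [e' -> ed']]].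
- have kk : k2 = k2' by apply: val_inj; rewrite -ed.
  by move: ek; rewrite kk -ek' => /perm_inj[->].
- by have := kept_not_in_atom k2 (m A'); rewrite -ed ed' (valP ((f A').2 e')).
- by have := kept_not_in_atom k2' (m A); rewrite -ed' ed (valP ((f A).2 e)).
have ee : val ((f A).2 e) = val ((f A').2 e') by rewrite -ed.
have eA : A = A'.
  by apply/m_inj/(atom_eq conn noloop (valP ((f A).2 e))); rewrite ee; apply: (valP ((f A').2 e')).
case: A' / eA e' ed' ee => e' ed' /val_inj ee.
by have [[_ b _] _] := bf A; rewrite (bij_inj b ee).
Qed.

Lemma lift_exists : exists rho : gperm G, [/\ rho \in Defs.Aut G, forall v, lift_v v (rho.1 v) &
  forall d, lift_d d (rho.2 d)].
Proof.
have [phi bphi phiP] := bijection_of_relation lift_v_ex lift_v_surj lift_v_fun lift_v_inj.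
have [psi bpsi psiP] := bijection_of_relation lift_d_ex lift_d_surj lift_d_fun lift_d_inj.
exists (perm (bij_inj bphi), perm (bij_inj bpsi)); split=> [|v|d]; rewrite ?permE //.
rewrite [_ \in Defs.Aut _]inE; apply/preservesP=> d /=; rewrite !permE.
have -> : omap (perm (bij_inj bphi)) (inc d) = omap phi (inc d) by case: (inc d) => //= v;
  rewrite permE.
have phiE v v2 : lift_v v v2 -> phi v = v2 by apply: lift_v_fun.
have psiE e e2 : lift_d e e2 -> psi e = e2 by apply: lift_d_fun.
have phi_old (x : vert (reduce l)) : phi (old_vert x) = old_vert (pi.1 x) by apply: phiE; left;
  exists x.
case: (psiP d) => [[k [k' [ek -> ->]]]|[A [e -> ->]]].
  have [p1 p2 p3 p4 p5] := autP piA (inl k : dart (reduce l)); rewrite ek in p1 p2 p3 p4 p5.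
  split=> //.
  - rewrite -(reduce_inl_inc k') -(reduce_inl_inc k) p1; case: (inc _) => //= x.
    by rewrite phi_old.
  - apply: psiE; left; exists (flip_on k), (flip_on k').
    by split; rewrite ?flip_onE ?kept_flip // ?(valP k) ?(valP k').
have [[b1 b2 /preservesP pf] _] := bf A; have [p1 p2 p3 p4 p5] := pf e.
have sA := atom_subgraph (valP A); have sA' := atom_subgraph (valP (m A)).
split=> //.
- rewrite -(sub_graph_inc sA) -(sub_graph_inc sA') p1; case: (inc e) => //= w; congr Some.
  (* The only place where both definitions meet: the end of a dart of [A] is a boundary vertex,
     moved according to [pi], and [af] identifies the two images. *)
  case: (boolP (w \in aboundary A)) => wb; last by apply/esym/phiE; right; exists A, w.
  have [x ex] : exists x : vert (reduce l), avert w = old_vert x.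
    by apply: kept_sub; apply: (kept_boundary conn noloop (_ : avert w \in boundary A));
      rewrite inE in wb.
  by rewrite -[sval w]/(avert w) ex phi_old; apply: af.
- by rewrite -(sub_graph_flip sA) -(sub_graph_flip sA') -p2; apply: psiE; right; exists A, (flip e).
Qed.
End Glue.

(** The three clauses match the three kinds of cells in [reduced_center]: kept vertices, kept darts
    and darts of [e_A]. *)
Lemma aut_lift : exists rho : gperm G, [/\ rho \in Defs.Aut G,
  forall x : vert (reduce l), rho.1 (old_vert x) = old_vert (pi.1 x),
  forall k k' : {d : dart R | kept_dart d}, pi.2 (inl k : dart (reduce l)) = inl k' ->
    rho.2 (val k) = val k' &
  forall A A' b b' d, pi.2 (e_dart l A b) = e_dart l A' b' -> inr d \in val A ->
    inr (rho.2 d) \in val A'].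
Proof.
have [m mP] := fin_all_exists lift_atom.
have [f fP] := fin_all_exists (fun A => proj2 (mP A)).
have mP' A := proj1 (mP A); have bf A := proj1 (fP A); have af A := proj2 (fP A).
have [rho [rA rv rd]] := lift_exists mP' bf af; exists rho; split=> //.
- by move=> x; apply: (lift_v_fun (rv _)); left; exists x.
- by move=> k k' ek; apply: (lift_d_fun (rd _)); left; exists k, k'.
move=> A A' b b' d; have [s ->] := mP' A => -[eA _] dA; rewrite -eA.
have -> : rho.2 d = val ((f A).2 (sub_dart dA)).
  by apply: (lift_d_fun (rd _)); right; exists A, (sub_dart dA).
exact: (valP ((f A).2 (sub_dart dA))).
Qed.
End Lift.

Hypothesis autR : forall g, g \in Defs.Aut G -> move g (center R) = center R.

Lemma reduce_center_aut (pi : gperm (reduce l)) : pi \in Defs.Aut (reduce l) ->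
  move pi (center (reduce l)) = center (reduce l).
Proof.
move=> piA; have [rho [rA rv rk re]] := aut_lift piA; have rc := autR rA.
have rin x : x \in center R -> cperm rho x \in center R by rewrite -{2}rc mem_move.
(* [cperm] is injective, so the inclusion of the moved center in the center is enough. *)
apply/eqP; rewrite eqEcard card_imset ?leqnn ?andbT; last exact: cperm_inj.
apply/subsetP=> y /imsetP[x xc ->]; case: x xc => [v|[k|[A b]]].
- rewrite !inE => vc; have := rin _ vc; by rewrite /= -/(old_vert v) rv.
- have [k' ek] := pi_kept piA k; rewrite !inE /= ek => kc; have := rin _ kc.
  by rewrite /= (rk _ _ ek).
have [A' [s hs]] := pi_e_dart piA A.
rewrite !inE /= -/(e_dart l A b) hs /= => /existsP[d /andP[dA dc]].
apply/existsP; exists (rho.2 d); rewrite (re _ _ _ _ _ (hs b) dA) /=.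
exact: (rin _ dc).
Qed.

End Reduced.

(** The invariant of the reduction series: it holds for [G] and passes from each term to the next,
    so the one-step result applies to every term. *)
Definition tame (R : rooted) : Prop :=
  [/\ connected [set: cell R], loopless R, no_half_edge R &
      forall g, g \in Defs.Aut R -> move g (center R) = center R].

Lemma tame_reduce (R : rooted) (l : labelling R) : tame R -> tame (reduce l).
Proof.
case=> conn noloop nohalf autR; split.
- exact: reduce_connected.
- exact: reduce_loopless.
- exact: reduce_no_half.
- by move=> g; apply: reduce_center_aut.
Qed.

Lemma tame_term (G : graph) (s : reduction_series G) (conn : connected [set: cell G])
  (noloop : loopless G) (nohalf : no_half_edge G) i : i <= len s -> tame (term s i).
Proof.
elim: i => [_|i IH ilt].
  rewrite term0; split=> // g gA; apply: center_move => //; exact: root_center.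
by have := termS (Ordinal ilt); rewrite /= => ->; apply: tame_reduce; apply: IH; apply: ltnW.
Qed.

Lemma quotient_reduction (R : rooted) (l : labelling R) (H0 : graph) : tame R -> is_quotient R H0 ->
  exists (H : graph) (p : gmap (reduce l) H), quotient_projection p /\ constructed_from p H0.
Proof.
case=> conn noloop _ cR [q [Gam [sGam [f [semG isof _ _]]]]].
have autR g : g \in Defs.Aut R -> rooted_aut g by move=> gA; rewrite /rooted_aut gA cR ?eqxx.
exists (quot (hat_sub conn noloop autR l sGam)), (hat_proj conn noloop autR l sGam); split.
  exists (hat_group conn noloop autR l sGam), (hat_sub conn noloop autR l sGam), (id, id);
    split=> //.
    exact: hat_semiregular.
  split; try by exists id.
  by apply/preservesP=> d; split=> //; case: (inc d).
have [k kP] := fin_all_exists (compatible_exists conn noloop autR l sGam semG).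
exists (reps Gam), k; split.
- exact: reps_selects.
- by move=> A _; apply: comp_fits.
have [h hiso] := expansion_isomorphic kP.
by exists (f.1 \o h.1, f.2 \o h.2); apply: is_iso_comp.
Qed.

Theorem theorem1p2 (G : graph) (Gconn : connected [set: cell G])
    (Gloopless : loopless G) (Gnohalf : no_half_edge G)
    (Gpendant : pendant_undirected G)
    (s : reduction_series G) (i : 'I_(len s)) (Hi : graph)
    (HiQ : is_quotient (term s i) Hi) :
  exists (Hi1 : graph) (p : gmap (reduce (term_label i)) Hi1),
    quotient_projection p /\ constructed_from p Hi.
Proof.
apply: quotient_reduction HiQ; apply: tame_term => //; exact: ltnW.
Qed.
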